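(* Let $z\in\mathbb D(\mathbf 0)$. Then $z$ lies in the Gelfand-Tsetlin support of the Verma module $M(-\tilde\rho)$, $\tilde\rho=-(0,1,\dots,n-1)$, if and only if $z_{k,i}\le0$ for all $1\le i\le k\le n-1$ and $z_{k-1,j}\le z_{k,i}$ for all $2\le k\le n-1$ and all $1\le i\le j\le k-1$. Equivalently, the support of $M(-\tilde\rho)$ (as a subset of $\mathbb D(\mathbf 0)$) coincides with $\overline{\mathcal P}(\Omega^+(v))$, where $v\in\mathbb Z_0^\mu$ is the element with $v_{k,i}=-i+1$ for all $1\le i\le k\le n-1$.
   Context: Fix $n\ge1$. $\mathbb C^\mu=\mathbb C^1\times\mathbb C^2\times\cdots\times\mathbb C^n$, with elements $v=(v_{k,i})_{1\le i\le k\le n}$; $S_\mu=S_1\times\cdots\times S_n$ acts on $\mathbb C^\mu$ by permuting the entries in each row. $\mathbb Z_0^\mu$ is the set of $z\in\mathbb C^\mu$ with integer entries and $z_{n,i}=0$ for all $i$. $\mathbb D(\mathbf 0)$ is the set of $z\in\mathbb Z_0^\mu$ with $z_{k,1}\ge z_{k,2}\ge\cdots\ge z_{k,k}$ for all $k\le n-1$. For $z\in\mathbb D(\mathbf 0)$, $\Omega^+(z)$ is the graph with vertices $[k,i]$, $1\le i\le k\le n$, and an edge $[k,i]-[k-1,j]$ (for $2\le k\le n$, $1\le i\le k$, $1\le j\le k-1$) exactly when $z_{k,i}\ge z_{k-1,j}$. For a graph $\Omega$ on this vertex set, $\overline{\mathcal P}(\Omega)=\{z\in\mathbb D(\mathbf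 0):\text{every edge of }\Omega\text{ is an edge of }\Omega^+(z)\}$. $U=U(\mathfrak{gl}(n,\mathbb C))$; $\Gamma\subset U$ is the (commutative) Gelfand-Tsetlin subalgebra generated by the centers of $U(\mathfrak{gl}(k,\mathbb C))$, $1\le k\le n$ (top-left-corner inclusions), equivalently by $c_{k,i}=\sum_{(r_1,\dots,r_i)\in\{1,\dots,k\}^i}E_{r_1,r_2}E_{r_2,r_3}\cdots E_{r_i,r_1}$, $1\le i\le k\le n$. Each $v\in\mathbb C^\mu$ defines a character $\chi_v:\Gamma\to\mathbb C$, $c_{k,i}\mapsto\gamma_{k,i}(v)$, where $\gamma_{k,i}=\sum_{j=1}^k(x_{k,j}+k-1)^i\prod_{m\ne j}\bigl(1-\frac1{x_{k,j}-x_{k,m}}\bigr)$ (a polynomial); $\chi_v=\chi_w$ iff $w\in S_\mu v$. For a $U$-module $M$, $M[v]=\{x\in M:(\ker\chi_v)^rx=0\text{ for some }r\ge0\}$, and $v$ is in the Gelfand-Tsetlin support of $M$ iff $M[v]\ne0$. For $\lambda\in\mathbb C^n$ (a weight of the diagonal Cartan subalgebra), $M(\lambda)$ is the Verma module of $\mathfrak{gl}(n,\mathbb C)$ of highest weight $\lambda$ with respect to the Borel subalgebra of upper triangular matrices. *)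

(* Defs.v *)
From HB Require Import structures.
From mathcomp Require Import all_boot all_order all_algebra.
From mathcomp Require Import boolp reals complex.
From mathcomp Require Import finmap mpoly.

Set Implicit Arguments.
Unset Strict Implicit.
Unset Printing Implicit Defensive.

Import Order.TTheory GRing.Theory Num.Theory.
Import Quotient.
Local Open Scope ring_scope.
Local Open Scope quotient_scope.
Local Notation "x %:F" := (@tofrac _ x).

(* The sum below is the divided difference of [f] at the points [x j]: it is,
   up to the embedding, the coefficient of degree k-1 of the remainder of [f]
   modulo the product of the 'X - x j.  Hence the rational function
   [gamma_frac] is a polynomial, and [gamma] can be evaluated also at points
   with coinciding coordinates. *)
Lemma divided_difference_int (A : idomainType) (k : nat) (x : 'I_k -> A)
    (f : {poly A}) : injective x ->
  exists p : A, p%:F = \sum_j (f.[x j])%:F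
     / (\prod_(m | m != j) ((x j)%:F - (x m)%:F)) :> {fraction A}.
Proof.
move=> xI.
pose g : {poly A} := \prod_m ('X - (x m)%:P).
have gm : g \is monic by apply: monic_prod => m _; apply: monicXsubC.
have sg : size g = k.+1.
  rewrite /g size_prod_XsubC; congr _.+1.
  by rewrite /index_enum; case: index_enum_key => /=; rewrite -enumT size_enum_ord.
pose r := Pdiv.Ring.rmodp f g.
have sr : (size r <= k)%N.
  by rewrite -ltnS -sg; apply: Pdiv.Ring.ltn_rmodpN0; apply: monic_neq0.
have fr j : f.[x j] = r.[x j].
  have gj : g.[x j] = 0.
    by rewrite /g horner_prod (bigD1 j) //= hornerXsubC subrr mul0r.
  by rewrite [f in LHS](Pdiv.RingMonic.rdivp_eq gm f) hornerD hornerM gj mulr0 add0r.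
exists r`_k.-1.
pose X j : {fraction A} := (x j)%:F.
have XI : injective X by move=> i j /eqP; rewrite tofrac_eq => /eqP /xI.
pose D j := \prod_(m | m != j) (X j - X m).
have D0 j : D j != 0.
  by apply/prodf_neq0 => m mj; rewrite subr_eq0 (inj_eq XI) eq_sym.
pose P j : {poly {fraction A}} := \prod_(m | m != j) ('X - (X m)%:P).
pose L := \sum_j ((r.[x j])%:F / D j) *: P j.
have sP j : size (P j) = k.
  rewrite /P -big_filter size_prod_XsubC -[k in RHS]card_ord (cardD1 j) inE /= add1n.
  congr _.+1; rewrite cardE; congr size; apply: eq_filter => m; rewrite !inE andbT //.
have PM j : P j \is monic by apply: monic_prod => m _; apply: monicXsubC.
have P0 m j : m != j -> (P m).[X j] = 0.
  move=> mj; rewrite /P horner_prod; apply/eqP/prodf_eq0; exists j.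
    by rewrite eq_sym.
  by rewrite hornerXsubC subrr.
pose rF := map_poly (@tofrac A) r.
have rFE j : rF.[X j] = (r.[x j])%:F by rewrite /rF horner_map.
have LrF : rF = L.
  apply/eqP; rewrite -subr_eq0; apply/eqP.
  apply: (@roots_geq_poly_eq0 _ _ [seq X j | j <- enum 'I_k]).
  - apply/allP => y /mapP [j _ ->]; rewrite rootE hornerD hornerN rFE /L.
    rewrite horner_sum (bigD1 j) //= big1 ?addr0 => [|m mj].
      rewrite hornerZ /P horner_prod.
      rewrite (eq_bigr (fun m => X j - X m)) => [|m _]; last by rewrite hornerXsubC.
      by rewrite -/(D j) divfK // subrr.
    by rewrite hornerZ P0 // mulr0.
  - by rewrite map_inj_uniq ?enum_uniq.
  - rewrite size_map size_enum_ord.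
    apply: leq_trans (size_polyD _ _) _; rewrite size_polyN geq_max.
    apply/andP; split; first by apply: leq_trans (size_poly _ _) _.
    apply: leq_trans (size_sum _ _ _) _; apply/bigmax_leqP => j _.
    by apply: leq_trans (size_scale_leq _ _) _; rewrite sP.
have -> : (r`_k.-1)%:F = rF`_k.-1 by rewrite coef_map.
rewrite LrF coef_sum; apply: eq_bigr => j _.
rewrite coefZ fr -/(X j) -/(D j).
by have /monicP := PM j; rewrite /lead_coef sP => ->; rewrite mulr1.
Qed.

Lemma shifted_power_sum_int (A : idomainType) (k : nat) (x : 'I_k -> A)
    (c : A) (i : nat) : injective x ->
  exists p : A, p%:F = \sum_j (x j + c)%:F ^+ i
     * \prod_(m | m != j) (1 - (x j - x m)%:F^-1) :> {fraction A}.
Proof.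
move=> xI; pose f : {poly A} := - (('X + c%:P) ^+ i * \prod_m ('X - (x m + 1)%:P)).
have [p hp] := divided_difference_int f xI.
exists p; rewrite hp; apply: eq_bigr => j _.
have fE : f.[x j] = (x j + c) ^+ i * \prod_(m | m != j) (x j - x m - 1).
  rewrite /f hornerN hornerM horner_exp hornerD hornerX hornerC horner_prod.
  rewrite (bigD1 j) //= hornerXsubC opprD addrA subrr add0r mulN1r mulrN opprK.
  by congr (_ * _); apply: eq_bigr => m _; rewrite hornerXsubC opprD addrA.
rewrite fE rmorphM rmorphXn rmorph_prod /= -mulrA -prodf_div; congr (_ * _).
apply: eq_bigr => m mj; rewrite -tofracB (tofracB _ 1) tofrac1 mulrBl divff ?mul1r //.
by rewrite tofrac_eq0 subr_eq0 (inj_eq xI) eq_sym.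
Qed.

Section Gamma.
Variables (C : fieldType) (k : nat).

Definition gamma_frac (i : nat) : {fraction {mpoly C[k]}} :=
  \sum_(j < k) ('X_j + (k.-1)%:R)%:F ^+ i
     * \prod_(m < k | m != j) (1 - ('X_j - 'X_m)%:F^-1).

Lemma mpolyX_inj : injective (fun j : 'I_k => 'X_j : {mpoly C[k]}).
Proof.
move=> j m /mpolyP /(_ U_(j)%MM) /eqP; rewrite !mcoeffXU eqxx.
by case: (eqVneq m j) => [-> //|_]; rewrite /= oner_eq0.
Qed.

Lemma gamma_subproof i : exists p : {mpoly C[k]}, p%:F == gamma_frac i.
Proof.
have [p hp] := shifted_power_sum_int (k.-1)%:R i mpolyX_inj.
by exists p; apply/eqP.
Qed.

Definition gamma (i : nat) : {mpoly C[k]} := xchoose (gamma_subproof i).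

Lemma gammaE i : (gamma i)%:F = gamma_frac i.
Proof. exact/eqP/(xchooseP (gamma_subproof i)). Qed.

End Gamma.

Inductive ideal_gen (R : nzRingType) (G : R -> Prop) : R -> Prop :=
| IdealBase x of G x : ideal_gen G x
| Ideal0 : ideal_gen G 0
| IdealB x y of ideal_gen G x & ideal_gen G y : ideal_gen G (x - y)
| IdealMl a x of ideal_gen G x : ideal_gen G (a * x)
| IdealMr a x of ideal_gen G x : ideal_gen G (x * a).

Inductive left_ideal_gen (R : nzRingType) (G : R -> Prop) : R -> Prop :=
| LIdealBase x of G x : left_ideal_gen G x
| LIdeal0 : left_ideal_gen G 0
| LIdealB x y of left_ideal_gen G x & left_ideal_gen G y :
    left_ideal_gen G (x - y)
| LIdealMl a x of left_ideal_gen G x : left_ideal_gen G (a * x).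

Definition ideal_pred (R : nzRingType) (G : R -> Prop) : {pred R} :=
  fun x => `[< ideal_gen G x >].

Definition left_ideal_pred (R : nzRingType) (G : R -> Prop) : {pred R} :=
  fun x => `[< left_ideal_gen G x >].

Lemma ideal_predP (R : nzRingType) (G : R -> Prop) x :
  reflect (ideal_gen G x) (x \in ideal_pred G).
Proof. exact: asboolP. Qed.

Lemma left_ideal_predP (R : nzRingType) (G : R -> Prop) x :
  reflect (left_ideal_gen G x) (x \in left_ideal_pred G).
Proof. exact: asboolP. Qed.

Lemma ideal_pred_zmod (R : nzRingType) (G : R -> Prop) :
  zmod_closed (ideal_pred G).
Proof.
split=> [|x y /ideal_predP hx /ideal_predP hy]; apply/ideal_predP.
  exact: Ideal0.
exact: IdealB.
Qed.

HB.instance Definition _ (R : nzRingType) (G : R -> Prop) :=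
  GRing.isZmodClosed.Build R (ideal_pred G) (ideal_pred_zmod G).

Lemma left_ideal_pred_zmod (R : nzRingType) (G : R -> Prop) :
  zmod_closed (left_ideal_pred G).
Proof.
split=> [|x y /left_ideal_predP hx /left_ideal_predP hy];
  apply/left_ideal_predP.
  exact: LIdeal0.
exact: LIdealB.
Qed.

HB.instance Definition _ (R : nzRingType) (G : R -> Prop) :=
  GRing.isZmodClosed.Build R (left_ideal_pred G) (left_ideal_pred_zmod G).

Lemma ideal_predM (R : nzRingType) (G : R -> Prop) a b x :
  x \in ideal_pred G -> a * x * b \in ideal_pred G.
Proof. by move=> /ideal_predP hx; apply/ideal_predP/IdealMr/IdealMl. Qed.

Lemma left_ideal_predM (R : nzRingType) (G : R -> Prop) a x :
  x \in left_ideal_pred G -> a * x \in left_ideal_pred G.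
Proof. by move=> /left_ideal_predP hx; apply/left_ideal_predP/LIdealMl. Qed.

Section QuotientModule.
Variables (R : nzRingType) (G : R -> Prop).

Definition quot_mod : Type := {quot (left_ideal_pred G)}.
HB.instance Definition _ := GRing.Zmodule.on quot_mod.

Definition pi_mod (x : R) : quot_mod := \pi_({quot (left_ideal_pred G)}) x.

Lemma pi_mod_surj (u : quot_mod) : exists x, u = pi_mod x.
Proof. by exists (repr u); rewrite /pi_mod reprK. Qed.

Lemma pi_modE x y : (pi_mod x = pi_mod y) <-> x - y \in left_ideal_pred G.
Proof. by rewrite idealrBE; split=> [h|/eqP //]; apply/eqP. Qed.

Lemma pi_modB x y : pi_mod (x - y) = pi_mod x - pi_mod y.
Proof. by rewrite /pi_mod raddfB. Qed.

Lemma pi_modD x y : pi_mod (x + y) = pi_mod x + pi_mod y.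
Proof. by rewrite /pi_mod raddfD. Qed.

Definition quot_scale (a : R) (u : quot_mod) : quot_mod :=
  pi_mod (a * repr (u : {quot (left_ideal_pred G)})).

Lemma quot_scaleE a x : quot_scale a (pi_mod x) = pi_mod (a * x).
Proof.
apply/pi_modE; rewrite -mulrBr; apply/left_ideal_predM.
by rewrite idealrBE reprK.
Qed.

Lemma quot_scalerA a b u :
  quot_scale a (quot_scale b u) = quot_scale (a * b) u.
Proof. by have [x ->] := pi_mod_surj u; rewrite !quot_scaleE mulrA. Qed.

Lemma quot_scale1r : left_id 1 quot_scale.
Proof. by move=> u; have [x ->] := pi_mod_surj u; rewrite quot_scaleE mul1r. Qed.

Lemma quot_scalerDr : right_distributive quot_scale +%R.
Proof.
move=> a u w; have [x ->] := pi_mod_surj u; have [y ->] := pi_mod_surj w.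
by rewrite -pi_modD !quot_scaleE mulrDr pi_modD.
Qed.

Lemma quot_scalerDl u : {morph quot_scale^~ u : a b / a + b}.
Proof.
move=> a b; have [x ->] := pi_mod_surj u.
by rewrite !quot_scaleE mulrDl pi_modD.
Qed.

HB.instance Definition _ := GRing.Zmodule_isLmodule.Build R quot_mod
  quot_scalerA quot_scale1r quot_scalerDr quot_scalerDl.

End QuotientModule.

Section QuotientAlgebra.
Variables (C : comNzRingType) (A : algType C) (G : A -> Prop).
Hypothesis G1 : 1 \notin ideal_pred G.

(* The proof of properness is a parameter of the type, so that the quotient
   canonically carries nonzero ring structures. *)
Definition quot_alg of 1 \notin ideal_pred G : Type := {quot (ideal_pred G)}.
Local Notation Q := (quot_alg G1).
HB.instance Definition _ := GRing.Zmodule.on Q.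

Definition pi_alg (x : A) : Q := \pi_({quot (ideal_pred G)}) x.

Lemma pi_alg_surj (u : Q) : exists x, u = pi_alg x.
Proof. by exists (repr (u : {quot (ideal_pred G)})); rewrite /pi_alg reprK. Qed.

Lemma pi_algE x y : (pi_alg x = pi_alg y) <-> x - y \in ideal_pred G.
Proof. by rewrite idealrBE; split=> [h|/eqP //]; apply/eqP. Qed.

Lemma pi_algB x y : pi_alg (x - y) = pi_alg x - pi_alg y.
Proof. by rewrite /pi_alg raddfB. Qed.

Lemma pi_algD x y : pi_alg (x + y) = pi_alg x + pi_alg y.
Proof. by rewrite /pi_alg raddfD. Qed.

Definition quot_mul (u v : Q) : Q :=
  pi_alg (repr (u : {quot (ideal_pred G)}) * repr (v : {quot (ideal_pred G)})).

Lemma quot_mulE x y : quot_mul (pi_alg x) (pi_alg y) = pi_alg (x * y).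
Proof.
rewrite /quot_mul; set x' := repr _; set y' := repr _.
have hx : x' - x \in ideal_pred G by rewrite idealrBE reprK.
have hy : y' - y \in ideal_pred G by rewrite idealrBE reprK.
apply/pi_algE.
have -> : x' * y' - x * y = 1 * (x' - x) * y' + x * (y' - y) * 1.
  by rewrite mul1r mulr1 mulrBl mulrBr addrA subrK.
by apply: rpredD; apply: ideal_predM.
Qed.

Lemma quot_mulA : associative quot_mul.
Proof.
move=> u v w; have [x ->] := pi_alg_surj u; have [y ->] := pi_alg_surj v.
by have [z ->] := pi_alg_surj w; rewrite !quot_mulE mulrA.
Qed.

Lemma quot_mul1r : left_id (pi_alg 1) quot_mul.
Proof. by move=> u; have [x ->] := pi_alg_surj u; rewrite quot_mulE mul1r. Qed.

Lemma quot_mulr1 : right_id (pi_alg 1) quot_mul.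
Proof. by move=> u; have [x ->] := pi_alg_surj u; rewrite quot_mulE mulr1. Qed.

Lemma quot_mulDl : left_distributive quot_mul +%R.
Proof.
move=> u v w; have [x ->] := pi_alg_surj u; have [y ->] := pi_alg_surj v.
have [z ->] := pi_alg_surj w.
by rewrite -pi_algD !quot_mulE mulrDl pi_algD.
Qed.

Lemma quot_mulDr : right_distributive quot_mul +%R.
Proof.
move=> u v w; have [x ->] := pi_alg_surj u; have [y ->] := pi_alg_surj v.
have [z ->] := pi_alg_surj w.
by rewrite -pi_algD !quot_mulE mulrDr pi_algD.
Qed.

Lemma quot_oner_neq0 : pi_alg 1 != 0.
Proof.
apply/eqP; have -> : 0 = pi_alg 0 by rewrite -[X in pi_alg X](subrr 0) pi_algB subrr.
by move/pi_algE; rewrite subr0 (negbTE G1).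
Qed.

HB.instance Definition _ := GRing.Zmodule_isNzRing.Build Q
  quot_mulA quot_mul1r quot_mulr1 quot_mulDl quot_mulDr quot_oner_neq0.

Lemma pi_algM x y : pi_alg (x * y) = pi_alg x * pi_alg y.
Proof. by rewrite -quot_mulE. Qed.

Lemma pi_alg1 : pi_alg 1 = 1.
Proof. by []. Qed.

Definition quot_cscale (c : C) (u : Q) : Q := pi_alg c%:A * u.

Lemma quot_cscaleE c x : quot_cscale c (pi_alg x) = pi_alg (c *: x).
Proof. by rewrite /quot_cscale -pi_algM mulr_algl. Qed.

Lemma quot_cscalerA a b u :
  quot_cscale a (quot_cscale b u) = quot_cscale (a * b) u.
Proof. by have [x ->] := pi_alg_surj u; rewrite !quot_cscaleE scalerA. Qed.

Lemma quot_cscale1r : left_id 1 quot_cscale.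
Proof. by move=> u; have [x ->] := pi_alg_surj u; rewrite quot_cscaleE scale1r. Qed.

Lemma quot_cscalerDr : right_distributive quot_cscale +%R.
Proof. by move=> a u w; rewrite /quot_cscale mulrDr. Qed.

Lemma quot_cscalerDl u : {morph quot_cscale^~ u : a b / a + b}.
Proof. by move=> a b; rewrite /quot_cscale scalerDl pi_algD mulrDl. Qed.

HB.instance Definition _ := GRing.Zmodule_isLmodule.Build C Q
  quot_cscalerA quot_cscale1r quot_cscalerDr quot_cscalerDl.

Lemma pi_algZ c x : pi_alg (c *: x) = c *: pi_alg x.
Proof. by rewrite -quot_cscaleE. Qed.

Lemma quot_cscalerAl (c : C) (u v : Q) : c *: (u * v) = (c *: u) * v.
Proof. by rewrite /GRing.scale /= /quot_cscale mulrA. Qed.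

HB.instance Definition _ := GRing.Lmodule_isLalgebra.Build C Q quot_cscalerAl.

Lemma quot_cscalerAr (c : C) (u v : Q) : c *: (u * v) = u * (c *: v).
Proof.
have [x ->] := pi_alg_surj u; have [y ->] := pi_alg_surj v.
by rewrite -pi_algM -!pi_algZ -pi_algM scalerAr.
Qed.

HB.instance Definition _ := GRing.Lalgebra_isAlgebra.Build C Q quot_cscalerAr.

End QuotientAlgebra.

Lemma rmorph_comm_rel (A B : nzRingType) (f : {rmorphism A -> B}) (a b c d : A)
    (s t : bool) : f a = 0 -> f b = 0 -> f c = 0 -> f d = 0 ->
  f (a * b - b * a - (c *+ s - d *+ t)) = 0.
Proof.
move=> ha hb hc hd.
by rewrite !rmorphB !rmorphM !rmorphMn ha hb hc hd !mul0rn mul0r !subrr.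
Qed.

Lemma scalerAr_of_comm (C : nzRingType) (A : lalgType C) (c : C) (x y : A) :
  x * c%:A = c%:A * x -> c *: (x * y) = x * (c *: y).
Proof. by move=> h; rewrite -(mulr_algl c y) mulrA h -mulrA mulr_algl. Qed.

From mathcomp Require Import monalg.

(* The free associative algebra on the matrix units. *)
Definition gl_free (C : fieldType) (n : nat) : Type :=
  {malg C[{fmonom ('I_n * 'I_n)%type}]}.

Section FreeAlgebra.
Variables (C : fieldType) (n : nat).
Local Notation FA := {malg C[{fmonom ('I_n * 'I_n)%type}]}.

HB.instance Definition _ := GRing.Lalgebra.on (gl_free C n).

Lemma gl_free_scaleAr (c : C) (x y : gl_free C n) :
  c *: (x * y) = x * (c *: y).
Proof.
have comm (u : FA) : u * c%:MP = c%:MP * u.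
  rewrite (mul_malgC c u) malgM_def malgZ_def fgmulgU; apply: eq_bigr=> k _ /=.
  by rewrite mulrC mulm1.
apply: scalerAr_of_comm; rewrite -[c%:A](mul_malgC c (1 : FA)) mulr1.
exact: comm.
Qed.

HB.instance Definition _ :=
  GRing.Lalgebra_isAlgebra.Build C (gl_free C n) gl_free_scaleAr.

Definition gl_free_gen (i j : 'I_n) : gl_free C n := (<< fmu (i, j) >> : FA).
Local Notation e := gl_free_gen.

Definition gl_rel (x : gl_free C n) : Prop := exists i j k l : 'I_n,
  x = e i j * e k l - e k l * e i j
      - (e i l *+ (j == k) - e k j *+ (l == i)).

Lemma gl_rel_proper : 1 \notin ideal_pred gl_rel.
Proof.
pose aug : {rmorphism FA -> C} := mcoeff (@mone _).
suff augG (x : gl_free C n) : ideal_gen gl_rel x -> aug x = 0.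
  apply/ideal_predP => /augG /eqP.
  by rewrite (rmorph1 aug) oner_eq0.
elim=> [{}x [i [j [k [l ->]]]]||{}x y _ hx _ hy|a {}x _ hx|a {}x _ hx].
- have he a b : aug (e a b) = 0.
    rewrite /aug /= mcoeffU1; case: eqP => // /(congr1 (@fdeg _)).
    by rewrite /fdeg fmuE fm1.
  by apply: (rmorph_comm_rel (f := aug)); apply: he.
- exact: (rmorph0 aug).
- by rewrite (rmorphB aug) hx hy subr0.
- by rewrite (rmorphM aug) hx mulr0.
- by rewrite (rmorphM aug) hx mul0r.
Qed.

End FreeAlgebra.

Definition Ugl (C : fieldType) (n : nat) : Type := quot_alg (gl_rel_proper C n).
HB.instance Definition _ (C : fieldType) (n : nat) :=
  GRing.Algebra.on (Ugl C n).

Definition Egl (C : fieldType) (n : nat) (i j : 'I_n) : Ugl C n :=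
  pi_alg (gl_rel_proper C n) (gl_free_gen C i j).

Lemma Egl_comm (C : fieldType) (n : nat) (i j k l : 'I_n) :
  Egl C i j * Egl C k l - Egl C k l * Egl C i j
    = Egl C i l *+ (j == k) - Egl C k j *+ (l == i).
Proof.
have piMn (x : gl_free C n) (b : bool) :
    pi_alg (gl_rel_proper C n) (x *+ b) = pi_alg (gl_rel_proper C n) x *+ b.
  case: b => //=; rewrite !mulr0n -(subrr 0) pi_algB subrr //.
rewrite /Egl -!piMn -!pi_algM -!pi_algB; apply/pi_algE/ideal_predP/IdealBase.
by exists i, j, k, l.
Qed.

(* U / (U n^+ + sum_i U (E_ii - lam_i)), i.e. the module induced from the
   one-dimensional module of weight [lam] of the upper triangular Borel
   subalgebra; there is no shift by rho. *)
Definition verma_rel (C : fieldType) (n : nat) (lam : 'rV[C]_n) (x : Ugl C n) :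
    Prop :=
  (exists i j : 'I_n, (i < j)%N /\ x = Egl C i j) \/
  (exists i : 'I_n, x = Egl C i i - (lam 0 i)%:A).

Definition verma (C : fieldType) (n : nat) (lam : 'rV[C]_n) : Type :=
  quot_mod (verma_rel lam).
HB.instance Definition _ (C : fieldType) (n : nat) (lam : 'rV[C]_n) :=
  GRing.Lmodule.on (verma lam).

Inductive subalg_gen (C : nzRingType) (A : lalgType C) (G : A -> Prop) :
    A -> Prop :=
| SubalgBase x of G x : subalg_gen G x
| Subalg1 : subalg_gen G 1
| SubalgP (c : C) x y of subalg_gen G x & subalg_gen G y :
    subalg_gen G (c *: x + y)
| SubalgM x y of subalg_gen G x & subalg_gen G y : subalg_gen G (x * y).

(* The vertices [k,i] with 1 <= i <= k <= n, stored with 0-based components;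
   [vrow] and [vcol] return the 1-based k and i. *)
Definition vtx (n : nat) := {k : 'I_n & 'I_k.+1}.

Definition vrow (n : nat) (a : vtx n) : nat := (tag a).+1.
Definition vcol (n : nat) (a : vtx n) : nat := (tagged a).+1.

Section GelfandTsetlin.
Variables (C : fieldType) (n : nat).
Local Notation U := (Ugl C n).
Local Notation E := (@Egl C n).

(* U(gl_k), for the top left corner inclusion of gl_k in gl_n. *)
Definition Ugl_corner (k : nat) : U -> Prop :=
  subalg_gen (fun x => exists i j : 'I_n,
    [/\ (i < k)%N, (j < k)%N & x = E i j]).

Definition corner_center (k : nat) (x : U) : Prop :=
  Ugl_corner k x /\ forall y, Ugl_corner k y -> x * y = y * x.

Definition GT_subalg : U -> Prop :=
  subalg_gen (fun x => exists k, (1 <= k <= n)%N /\ corner_center k x).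

(* c_{k,i} for [k,i] = a: [r] ranges over the maps from 'I_i to {1..k}, and
   [ordS] is the cyclic successor on 'I_i. *)
Definition GT_gen (a : vtx n) : U :=
  \sum_(r : {ffun 'I_(vcol a) -> 'I_n} | [forall t, (r t < vrow a)%N])
     \prod_(t < vcol a) E (r t) (r (ordS t)).

Definition gamma_at (v : {ffun vtx n -> C}) (a : vtx n) : C :=
  (gamma C (vrow a) (vcol a)).@[fun j => v (Tagged (fun k : 'I_n => 'I_k.+1) j)].

(* A character of Gamma is represented by a function on U, of which only the
   restriction to Gamma matters; that restriction is determined by [v], as the
   c_{k,i} generate Gamma. *)
Record GT_char (v : {ffun vtx n -> C}) (chi : U -> C) : Prop := {
  GT_char1 : chi 1 = 1;
  GT_charP : forall (c : C) x y, GT_subalg x -> GT_subalg y ->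
    chi (c *: x + y) = c * chi x + chi y;
  GT_charM : forall x y, GT_subalg x -> GT_subalg y ->
    chi (x * y) = chi x * chi y;
  GT_char_gen : forall a : vtx n, chi (GT_gen a) = gamma_at v a
}.

Definition GT_ker (chi : U -> C) (x : U) : Prop := GT_subalg x /\ chi x = 0.

Definition ideal_mul (I J : U -> Prop) (x : U) : Prop :=
  exists s : seq (U * U),
    (forall p, p \in s -> I p.1 /\ J p.2) /\ x = \sum_(p <- s) p.1 * p.2.

Definition GT_ker_pow (chi : U -> C) (r : nat) : U -> Prop :=
  iter r (ideal_mul (GT_ker chi)) GT_subalg.

Definition GT_space (M : lmodType U) (chi : U -> C) (x : M) : Prop :=
  exists r, forall a, GT_ker_pow chi r a -> a *: x = 0.

Definition GT_support (M : lmodType U) (v : {ffun vtx n -> C}) : Prop :=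
  exists2 chi, GT_char v chi & exists2 x : M, x != 0 & GT_space chi x.

End GelfandTsetlin.

Definition tab_embed (C : fieldType) (n : nat) (z : {ffun vtx n -> int}) :
  {ffun vtx n -> C} := [ffun a => (z a)%:~R].

Definition in_D0 (n : nat) (z : {ffun vtx n -> int}) : Prop :=
  (forall a, vrow a = n -> z a = 0) /\
  (forall a b, vrow a = vrow b -> (vrow a < n)%N -> (vcol a <= vcol b)%N ->
     z b <= z a).

Definition omega_plus (n : nat) (z : {ffun vtx n -> int}) : rel (vtx n) :=
  fun a b => (vrow a == (vrow b).+1) && (z b <= z a)
          || (vrow b == (vrow a).+1) && (z a <= z b).

Definition Pbar (n : nat) (Omega : rel (vtx n)) (z : {ffun vtx n -> int}) :
    Prop :=
  in_D0 z /\ forall a b, Omega a b -> omega_plus z a b.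

Definition v_dec (n : nat) : {ffun vtx n -> int} :=
  [ffun a => if (vrow a < n)%N then 1 - (vcol a)%:Z else 0].

Lemma v_dec_D0 n : in_D0 (v_dec n).
Proof.
split=> [a an|a b ab an le_ab]; rewrite !ffunE; first by rewrite an ltnn.
by rewrite -ab an lerD2l lerN2 lez_nat.
Qed.

Definition rho_tilde (C : fieldType) (n : nat) : 'rV[C]_n :=
  - \row_i (nat_of_ord i)%:R.

(* Main.v *)
(* The restriction of a Verma module of gl_n to gl_(n-1) is filtered by Verma
   modules. Iterating down the chain of corners, order the lowering operators
   E_ij (j < i) by their row i: the vectors v_w = E_w v_lam, w a word whose rows
   weakly increase from left to right, span the Verma module. An element of the center
   of U(gl_k) commutes with the letters of w in gl_k, and its action on the
   remaining part t of w is that on a vector which is a highest weight vector of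
   gl_k modulo words with as many letters in each row but in later columns; so the
   whole Gelfand-Tsetlin subalgebra acts triangularly on the v_w, with finitely
   many words of each height. The eigenvalue of c_(k,i) is gamma_(k,i) evaluated
   at the gl_k-weight of t, by the recursion of Perelomov and Popov. The v_w with
   distinct multisets of letters are linearly independent because gl_n acts on a
   polynomial ring in such a way that v_w goes to the monomial of w. Hence the support consists of the tableaux of
   all words, whose k-th row, for lam = (0, 1, .., n-1), has c-th entry minus the
   number of letters of w in column c and in rows beyond k. The gamma_(k,i),
   i <= k, determine a row up to permutation. *)
From HB Require Import structures.
From mathcomp Require Import all_boot all_order all_algebra.
Require Import Defs.
From mathcomp Require Import boolp reals complex.
From mathcomp Require Import finmap mpoly ring zify.
From mathcomp Require monalg.
Set Implicit Arguments.
Unset Strict Implicit.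
Unset Printing Implicit Defensive.
Import Order.TTheory GRing.Theory Num.Theory Quotient.
Local Open Scope ring_scope.
Local Open Scope quotient_scope.

(** * The polynomials gamma *)

(** The top row of a tableau is constant, so for [n >= 2] the characters sit at points where terms
    of the rational formula for gamma have poles. Eigenvalues are therefore compared through a
    division-free recursion, which agrees with gamma at generic points and hence everywhere. Several
    words may share a character, and the action is only triangular, so generalized eigenvectors have
    to be produced. Words of bounded height being finite in number, a single element of Gamma
    separates a character from the others among them, and its high powers kill what belongs to the
    others. The weight (0, 1, .., n-1) cancels a shift by the column number in the eigenvalues, so
    the empty word has the zero tableau. The rows of the tableau of a word need not decrease,
    whereas those of an element of D(0) do; sorting two rows keeps the entrywise inequality between
    them, which removes this discrepancy. *)

Section PerelomovPopov.
Variable A : comNzRingType.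

(* [- pp s i] is the coefficient of [u^(-i-1)] in the product of the
   [1 - 1 / (u - y)] for [y] in [s]; the recursion also makes sense when [s] has
   repetitions. *)
Fixpoint pp (s : seq A) : nat -> A :=
  if s is y :: s' then
    let f := pp s' in
    fix g i := if i is i'.+1 then f i + y * (g i' - f i') - f i' else f 0 + 1
  else fun=> 0.

Lemma pp0 s : pp s 0 = (size s)%:R.
Proof. by elim: s => //= y s ->; rewrite -natr1. Qed.

(** Comparing the coefficients of [u^(-i-1)] in [(u - y) F = (u - y - 1) G], where [F] and [G] are
    the products for [y :: s] and for [s]. *)
Lemma ppS y s i :
  pp (y :: s) i.+1 = pp s i.+1 + y * (pp (y :: s) i - pp s i) - pp s i.
Proof. by []. Qed.

End PerelomovPopov.

Lemma pp_morph (A B : comNzRingType) (f : {rmorphism A -> B}) s i :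
  f (pp s i) = pp (map f s) i.
Proof.
elim: s i => [|y s IHs] i; first exact: rmorph0.
elim: i => [|i IHi]; first by rewrite /= rmorphD rmorph1 IHs.
by rewrite ppS !rmorphB rmorphD rmorphM rmorphB IHi !IHs -ppS.
Qed.

Section ResidueSum.
Variable K : fieldType.
Implicit Types (f : K -> K) (s : seq K).

(* The sum over [y] in [s] of [f y] times the product of the [1 - 1 / (y - m)]
   for the other [m] in [s]; the right value only if [s] has no repetitions. *)
Fixpoint res_sum s f : K :=
  if s is y :: s' then
    f y * (\prod_(m <- s') (1 - (y - m)^-1))
    + res_sum s' (fun x => f x * (1 - (x - y)^-1))
  else 0.

Lemma eq_res_sum s f g : {in s, f =1 g} -> res_sum s f = res_sum s g.
Proof.
elim: s f g => //= y s IHs f g fg; rewrite fg ?mem_head //; congr (_ + _).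
by apply: IHs => x xs; rewrite fg // inE xs orbT.
Qed.

Lemma res_sumD s f g :
  res_sum s (fun x => f x + g x) = res_sum s f + res_sum s g.
Proof.
elim: s f g => [|y s IHs] f g /=; first by rewrite addr0.
rewrite mulrDl addrACA -IHs; congr (_ + _).
by apply: eq_res_sum => x _; rewrite mulrDl.
Qed.

Lemma res_sumZ s c f : res_sum s (fun x => c * f x) = c * res_sum s f.
Proof.
elim: s f => [|y s IHs] f /=; first by rewrite mulr0.
rewrite mulrDr mulrA -IHs; congr (_ + _).
by apply: eq_res_sum => x _; rewrite mulrA.
Qed.

Lemma res_sumB s f g :
  res_sum s (fun x => f x - g x) = res_sum s f - res_sum s g.
Proof.
rewrite -[X in _ - X]mul1r -mulNr -res_sumZ -res_sumD.
by apply: eq_res_sum => x _; rewrite mulN1r.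
Qed.

(* Partial fractions of the product of the [1 - 1 / (u - y)]. *)
Lemma res_sum_pfrac s u : uniq (u :: s) ->
  \prod_(m <- s) (1 - (u - m)^-1) = 1 - res_sum s (fun y => (u - y)^-1).
Proof.
elim: s u => [|y s IHs] u; first by rewrite big_nil /= subr0.
rewrite /= inE negb_or -!andbA => /and4P [uy us ys us'].
have usu : uniq (u :: s) by rewrite /= us.
have ysu : uniq (y :: s) by rewrite /= ys.
rewrite big_cons (IHs u usu) (IHs y ysu) /=.
have uy0 : u - y != 0 by rewrite subr_eq0.
suff -> : res_sum s (fun x => (u - x)^-1 * (1 - (x - y)^-1)) =
   res_sum s (fun x => (u - x)^-1) +
   (u - y)^-1 * (res_sum s (fun x => (y - x)^-1) -
                 res_sum s (fun x => (u - x)^-1)).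
  by rewrite !mulrBr !mulrBl !mul1r !mulr1; ring.
rewrite -res_sumB -res_sumZ -res_sumD; apply: eq_res_sum => x xs.
have ux : u - x != 0 by rewrite subr_eq0; apply: contraNneq us => ->.
have xy : x - y != 0 by rewrite subr_eq0; apply: contraNneq ys => <-.
have yx : y - x != 0 by rewrite -opprB oppr_eq0.
by field; rewrite ux xy yx uy0.
Qed.

(** The right side satisfies [ppS], because [x^(i+1) (1 - 1/(x-y)) = y x^i (1 - 1/(x-y)) + x^(i+1) -
    (y+1) x^i] for each [x] in [s]. At [i = 0] the term of [y] is expanded by partial fractions,
    which cancel the poles in the other terms. *)
Lemma pp_res_sum s i : uniq s -> pp s i = res_sum s (fun y => y ^+ i).
Proof.
elim: s i => // y s IHs i us; have /andP [ys us'] := us.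
elim: i => [|i IHi].
  rewrite [LHS]/= [RHS]/= IHs // mul1r res_sum_pfrac //.
  have -> : res_sum s (fun x => x ^+ 0 * (1 - (x - y)^-1)) =
      res_sum s (fun x => x ^+ 0) + res_sum s (fun x => (y - x)^-1).
    rewrite -res_sumD; apply: eq_res_sum => x _.
    by rewrite expr0 mul1r -[x - y]opprB invrN opprK.
  ring.
rewrite ppS IHi !IHs // [res_sum (y :: s) _]/= [RHS]/=.
set p := \prod_(m <- s) _.
have -> : res_sum s (fun x => x ^+ i.+1 * (1 - (x - y)^-1)) =
   y * res_sum s (fun x => x ^+ i * (1 - (x - y)^-1))
   + res_sum s (fun x => x ^+ i.+1)
   - (y + 1) * res_sum s (fun x => x ^+ i).
  rewrite -!res_sumZ -res_sumD -res_sumB; apply: eq_res_sum => x xs.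
  have xy : x - y != 0 by rewrite subr_eq0; apply: contraNneq ys => <-.
  by rewrite exprS; field.
by rewrite exprS; ring.
Qed.

Lemma res_sumE k (x : 'I_k -> K) f : injective x ->
  res_sum [seq x j | j <- enum 'I_k] f =
  \sum_j f (x j) * \prod_(m | m != j) (1 - (x j - x m)^-1).
Proof.
move=> xI.
have gen (l : seq 'I_k) g : uniq l -> res_sum [seq x j | j <- l] g =
  \sum_(j <- l) g (x j) * \prod_(m <- l | m != j) (1 - (x j - x m)^-1).
  elim: l g => [|j l IHl] g /=; first by rewrite big_nil.
  case/andP=> jl ul; rewrite big_cons big_cons eqxx /= IHl // big_map.
  congr (_ * _ + _).
    rewrite [RHS]big_seq_cond [LHS]big_seq; apply: eq_bigl => m.
    by case: eqP => [->|]; rewrite ?andbT // (negPf jl).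
  rewrite big_seq [RHS]big_seq; apply: eq_bigr => m ml.
  rewrite big_cons ifT -?mulrA //.
  by apply: contraNneq jl => ->.
rewrite gen ?enum_uniq // big_enum /=; apply: eq_bigr => j _.
by rewrite big_enum_cond.
Qed.

End ResidueSum.

(** Both sides are polynomial in the coordinates, so they are compared at the generic point in the
    fraction field, where the coordinates are distinct. The shift by [k.-1] cancels in the
    differences. *)
Lemma gamma_pp (C : fieldType) k i (v : 'I_k -> C) :
  (gamma C k i).@[v] = pp [seq v j + (k.-1)%:R | j <- enum 'I_k] i.
Proof.
pose X : seq {mpoly C[k]} := [seq 'X_j + (k.-1)%:R | j <- enum 'I_k].
suff -> : gamma C k i = pp X i.
  rewrite (pp_morph (meval v)) -map_comp; congr pp.
  apply: eq_map => j /=; rewrite mevalD mevalXU.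
  by rewrite (rmorph_nat (meval v)).
apply/eqP; rewrite -tofrac_eq gammaE; apply/eqP.
rewrite (pp_morph (@tofrac _)) -map_comp.
have XI : injective (fun j => tofrac ('X_j + (k.-1)%:R : {mpoly C[k]})).
  by move=> j m /eqP; rewrite tofrac_eq => /eqP /addIr /mpolyX_inj.
rewrite pp_res_sum; last by rewrite map_inj_uniq ?enum_uniq.
rewrite (res_sumE _ XI); apply: eq_bigr => j _; congr (_ * _).
by apply: eq_bigr => m _; rewrite -tofracB opprD addrACA subrr addr0.
Qed.

(** * The numbers [pp] determine a sequence up to order *)

Section Separation.
Variable A : comNzRingType.
Implicit Types (s : seq A) (f : {poly A}).

(* The linear functional sending ['X^i] to [pp s i]. *)
Definition ppl s f : A := \sum_(i < size f) f`_i * pp s i.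

Lemma pplE N s f : (size f <= N)%N -> ppl s f = \sum_(i < N) f`_i * pp s i.
Proof.
move=> fN; rewrite /ppl (big_ord_widen _ (fun i => f`_i * pp s i) fN).
rewrite big_mkcond; apply: eq_bigr => i _; case: ltnP => // fi.
by rewrite nth_default // mul0r.
Qed.

Lemma pplD s f g : ppl s (f + g) = ppl s f + ppl s g.
Proof.
pose N := maxn (size f) (size g).
rewrite !(@pplE N) ?leq_maxl ?leq_maxr ?size_polyD // -big_split /=.
by apply: eq_bigr => i _; rewrite coefD mulrDl.
Qed.

Lemma pplZ s c f : ppl s (c *: f) = c * ppl s f.
Proof.
rewrite !(@pplE (size f)) ?size_scale_leq // mulr_sumr.
by apply: eq_bigr => i _; rewrite coefZ mulrA.
Qed.

Lemma pplB s f g : ppl s (f - g) = ppl s f - ppl s g.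
Proof. by rewrite -scaleN1r pplD pplZ mulN1r. Qed.

Lemma pplC s c : ppl s c%:P = c * (size s)%:R.
Proof.
rewrite (@pplE 1%N) ?size_polyC ?leq_b1 // big_ord1 coefC eqxx.
by rewrite pp0.
Qed.

Lemma pplXM s f : ppl s ('X * f) = \sum_(i < size f) f`_i * pp s i.+1.
Proof.
rewrite -commr_polyX (@pplE (size f).+1); last first.
  by apply: leq_trans (size_polyMleq _ _) _; rewrite size_polyX addn2.
rewrite big_ord_recl coefMX mul0r add0r.
by apply: eq_bigr => i _; rewrite coefMX.
Qed.

Lemma ppl_cons y s f :
  ppl (y :: s) (('X - y%:P) * f) = ppl s (('X - (y + 1)%:P) * f).
Proof.
rewrite !mulrBl !pplB !pplXM !mul_polyC !pplZ !(@pplE (size f)) //.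
rewrite !mulr_sumr -!sumrB; apply: eq_bigr => i _.
by rewrite ppS; ring.
Qed.

Definition rootsp s : {poly A} := \prod_(y <- s) ('X - y%:P).

Lemma rootsp_cons y s : rootsp (y :: s) = ('X - y%:P) * rootsp s.
Proof. by rewrite /rootsp big_cons. Qed.

(** [ppl_cons] removes the elements of [s] one at a time. So the functional lives on the quotient by
    [rootsp s], like a combination of evaluations at the roots. *)
Lemma ppl_rootsp s f : ppl s (f * rootsp s) = 0.
Proof.
elim: s f => [|y s IHs] f.
  by rewrite /ppl big1 // => i _; rewrite /= mulr0.
by rewrite rootsp_cons mulrCA ppl_cons mulrA IHs.
Qed.

Lemma drop_polyXM m f : drop_poly m.+1 ('X * f) = drop_poly m f.
Proof. by apply/polyP => i; rewrite !coef_drop_poly coefXM addnS. Qed.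

Lemma drop_poly_step m f :
  drop_poly m.+1 f * 'X + (f`_m)%:P = drop_poly m f.
Proof.
apply/polyP => i; rewrite coefD coefMX coefC !coef_drop_poly.
by case: i => [|i] /=; rewrite ?add0r ?addr0 // addnS.
Qed.

(* Comparing coefficients in [P(X) - P(X-1) = P(X) * sum_i pp_i X^(-i-1)]. *)
Lemma ppl_drop s m : ppl s (drop_poly m (rootsp s)) =
  ('X * (rootsp s - (rootsp s \Po ('X - 1))))`_m.
Proof.
elim: s m => [|y s IHs] m.
  have -> : rootsp [::] = 1%:P by rewrite /rootsp big_nil.
  rewrite comp_polyC subrr mulr0 coef0.
  by rewrite /ppl big1 // => i _; rewrite mulr0.
set P := rootsp s in IHs *.
rewrite rootsp_cons -/P comp_polyM comp_polyB comp_polyX comp_polyC.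
(* The new right side is [X - (y+1)] times the old one plus [X * P]; [ppl_cons] brings the left side
   into the same form. *)
have -> : 'X * (('X - y%:P) * P - ('X - 1 - y%:P) * (P \Po ('X - 1))) =
   ('X - (y + 1)%:P) * ('X * (P - (P \Po ('X - 1)))) + 'X * P.
  by rewrite polyCD; ring.
rewrite [in RHS]coefD [in RHS]mulrBl coefB coefCM.
case: m => [|m].
  rewrite !drop_poly0l ppl_cons mulrBl pplB mul_polyC pplZ.
  rewrite -IHs drop_poly0l ppl_rootsp !coefXM /=.
  by rewrite addr0.
have dE f : drop_poly m.+1 (('X - y%:P) * f) =
    ('X - y%:P) * drop_poly m.+1 f + (f`_m)%:P.
  rewrite mulrBl mul_polyC linearB linearZ /= drop_polyXM -drop_poly_step.
  by rewrite -mul_polyC mulrBl; ring.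
rewrite dE pplD ppl_cons pplC mulrBl pplB mul_polyC pplZ IHs.
rewrite [('X * ('X * _))`_m.+1]coefXM [('X * P)`_m.+1]coefXM /= -!IHs.
rewrite -(drop_poly_step m P) pplD pplC commr_polyX /= -natr1.
by ring.
Qed.

End Separation.

Lemma coef_Xsub1_exp (A : comNzRingType) d :
  ((('X - 1) ^+ d : {poly A})`_d = 1) *
  ((('X - 1) ^+ d.+1 : {poly A})`_d = - d.+1%:R).
Proof.
elim: d => [|d [IHd IHd']].
  by rewrite expr0 expr1 coefB coefX !coef1 /= add0r.
have lead : (('X - 1) ^+ d.+1 : {poly A})`_d.+1 = 1.
  have /monicP : ('X - 1) ^+ d.+1 \is @monic A by rewrite monic_exp ?monicXsubC.
  by rewrite /lead_coef size_exp_XsubC.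
split=> //; rewrite exprS mulrBl mul1r coefB coefXM /= IHd' lead.
by rewrite -[in RHS]natr1 opprD.
Qed.

(** Let [D], of degree [d], be the difference of the monic polynomials with roots [s] and [t]; then
    [d < size s]. Subtracting the two instances of [ppl_drop] at [m = d] gives
    [size s * D_d = d * D_d], impossible in characteristic 0. *)
Lemma perm_eq_pp (C : numFieldType) (s t : seq C) :
  size s = size t -> (forall i, (0 < i <= size s)%N -> pp s i = pp t i) ->
  perm_eq s t.
Proof.
move=> st pst; apply: prod_XsubC_eq; rewrite -/(rootsp s) -/(rootsp t).
have psm (u : seq C) : size (rootsp u) = (size u).+1 by rewrite size_prod_XsubC.
have mon (u : seq C) : rootsp u \is monic by apply: monic_prod_XsubC.
apply/eqP; rewrite -subr_eq0; set D := rootsp s - rootsp t.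
apply: contraT => D0.
have sD : (size D <= size s)%N.
  apply/leq_sizeP => j; rewrite leq_eqVlt coefB => /predU1P [<-|sj].
    have /monicP := mon s; have /monicP := mon t.
    by rewrite /lead_coef !psm -st /= => -> ->; rewrite subrr.
  by rewrite !nth_default ?subrr // psm -?st.
have [d dE] : exists d, size D = d.+1.
  by exists (size D).-1; rewrite prednK // lt0n size_poly_eq0.
have drD : drop_poly d D = (D`_d)%:P.
  apply/polyP => i; rewrite coef_drop_poly coefC.
  by case: i => [//|i]; rewrite nth_default // dE !addSn ltnS leq_addl.
have Dd0 : D`_d != 0 by by move: D0; rewrite -lead_coef_eq0 /lead_coef dE.
(* Index 0 is the common size, and the given indices reach up to [size s], the degree of
   [rootsp t]. *)
have agree (f : {poly C}) : (size f <= (size s).+1)%N -> ppl s f = ppl t f.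
  move=> fs; rewrite !(pplE _ fs); apply: eq_bigr => i _; congr (_ * _).
  case: (posnP i) => [->|i0]; first by rewrite !pp0 st.
  by apply: pst; rewrite i0 -ltnS ltn_ord.
have : ppl s (drop_poly d D) = ('X * (D - (D \Po ('X - 1))))`_d.
  rewrite {1}/D linearB /= pplB ppl_drop [ppl s (drop_poly d (rootsp t))]agree.
    rewrite ppl_drop -coefB -mulrBr.
    suff -> : D - (D \Po ('X - 1)) = rootsp s - (rootsp s \Po ('X - 1))
      - (rootsp t - (rootsp t \Po ('X - 1))) by [].
    by rewrite /D comp_polyB; ring.
  by rewrite size_drop_poly psm st leq_subr.
rewrite drD pplC coefXM [(D - _)`_ _]coefB.
case: d => [|d] in dE drD Dd0 *; move/eqP.
  rewrite /= mulf_eq0 (negPf Dd0) pnatr_eq0 size_eq0.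
  by case: (s) sD; rewrite //= leqn0 size_poly_eq0 (negPf D0).
rewrite /= coef_comp_poly dE big_ord_recr big_ord_recr /=.
rewrite big1; last first.
  move=> i _; have /leq_sizeP-> // : (size (('X - 1) ^+ i : {poly C})%R <= d)%N.
    by rewrite (@size_exp_XsubC _ _ (1 : C)) ltn_ord.
  by rewrite mulr0.
rewrite add0r !coef_Xsub1_exp mulr1 opprD addrA subrr add0r mulrN opprK.
rewrite -subr_eq0 -mulrBr mulf_eq0 (negPf Dd0) subr_eq0 eqr_nat /=.
by move=> /eqP sd; move: sD; rewrite dE sd ltnn.
Qed.

(** * A polynomial model of Verma modules *)

Section Bracket.
Variable S : nzRingType.
Implicit Types a b c : S.

Definition br a b := a * b - b * a.

Lemma br_anti a b : br a b = - br b a.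
Proof. by rewrite /br opprB. Qed.

Lemma brxx a : br a a = 0.
Proof. exact: subrr. Qed.

Lemma brDl a b c : br (a + b) c = br a c + br b c.
Proof. by rewrite /br mulrDl mulrDr opprD addrACA. Qed.

Lemma brNl a c : br (- a) c = - br a c.
Proof. by rewrite /br mulNr mulrN opprB opprK addrC. Qed.

Lemma brBl a b c : br (a - b) c = br a c - br b c.
Proof. by rewrite brDl brNl. Qed.

Lemma brDr a b c : br a (b + c) = br a b + br a c.
Proof. by rewrite br_anti brDl opprD -!(br_anti a). Qed.

Lemma brNr a b : br a (- b) = - br a b.
Proof. by rewrite br_anti brNl opprK br_anti. Qed.

Lemma brBr a b c : br a (b - c) = br a b - br a c.
Proof. by rewrite brDr brNr. Qed.

Lemma brMl a b c : br (a * b) c = a * br b c + br a c * b.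
Proof. by rewrite /br mulrBr mulrBl !mulrA addrA subrK. Qed.

Lemma brMr a b c : br a (b * c) = br a b * c + b * br a c.
Proof. by rewrite br_anti brMl opprD -mulrN -mulNr -!br_anti addrC. Qed.

Lemma br_suml (I : Type) (r : seq I) (P : pred I) (F : I -> S) c :
  br (\sum_(i <- r | P i) F i) c = \sum_(i <- r | P i) br (F i) c.
Proof. by rewrite /br mulr_suml mulr_sumr -sumrB. Qed.

Lemma br_sumr (I : Type) (r : seq I) (P : pred I) (F : I -> S) c :
  br c (\sum_(i <- r | P i) F i) = \sum_(i <- r | P i) br c (F i).
Proof. by rewrite /br mulr_suml mulr_sumr -sumrB. Qed.

Lemma br0_comm a b : br a b = 0 -> a * b = b * a.
Proof. by move/eqP; rewrite subr_eq0 => /eqP. Qed.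

End Bracket.

Definition gl_on (S : nzRingType) (T : eqType) (P : pred T) (e : T -> T -> S) :=
  forall i j k l, P i -> P j -> P k -> P l ->
  br (e i j) (e k l) = e i l *+ (j == k) - e k j *+ (l == i).

Lemma sum_delta (V : nmodType) (T : finType) (P : pred T) (F : T -> V) i :
  P i -> \sum_(k | P k) F k *+ (i == k) = F i.
Proof.
move=> Pi; rewrite (bigD1 i) //= eqxx big1 ?addr0 // => k /andP [_ ki].
by rewrite eq_sym (negPf ki).
Qed.

Section ParabolicStep.
Variables (S : nzRingType) (T : finType) (P : pred T) (a : T).
Variables (e : T -> T -> S) (x d : T -> S) (c : S).
Hypothesis Pa : ~~ P a.
Hypothesis eP : gl_on P e.
Hypothesis xx : forall i k, br (x i) (x k) = 0.
Hypothesis dd : forall i k, br (d i) (d k) = 0.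
Hypothesis dx : forall i k, br (d i) (x k) = (i == k)%:R.
Hypothesis ex : forall i j k, P i -> P j -> br (e i j) (x k) = 0.
Hypothesis ed : forall i j k, P i -> P j -> br (e i j) (d k) = 0.
Hypothesis ce : forall i j, P i -> P j -> br c (e i j) = 0.
Hypothesis cx : forall k, br c (x k) = 0.
Hypothesis cd : forall k, br c (d k) = 0.

Let D := \sum_(k | P k) x k * d k.
(** The operator of [E_(a,i)]. In the induced module it has to kill the polynomials of degree 0 in
    [x] and to have the gl bracket with each [x k]; by induction on the degree this forces the
    formula. *)
Let f i := (c - D) * d i - \sum_(k | P k) d k * e k i.

(* [gl_(m+1)] acting on [N[x]] for a [gl_m]-module [N]: the new lowering
   operators are the multiplications by the variables. *)
Definition par_step i j : S :=
  if i == a then (if j == a then c - D else f j)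
  else (if j == a then x i else e i j + x i * d j).

Let xd i k : br (x i) (d k) = - (i == k)%:R.
Proof. by rewrite br_anti dx eq_sym. Qed.

Let Dx i : P i -> br D (x i) = x i.
Proof.
move=> Pi; rewrite /D br_suml -[RHS](sum_delta (x) Pi).
apply: eq_bigr => k _; rewrite brMl dx xx mul0r addr0 eq_sym.
by case: eqP; rewrite ?mulr1 ?mulr0.
Qed.

Let Dd i : P i -> br D (d i) = - d i.
Proof.
move=> Pi; rewrite /D br_suml -[d i in RHS](sum_delta (d) Pi) -sumrN.
apply: eq_bigr => k _; rewrite brMl dd xd mulr0 add0r mulNr eq_sym.
by case: eqP; rewrite ?mul1r ?mul0r.
Qed.

Let De i j : P i -> P j -> br D (e i j) = 0.
Proof.
move=> Pi Pj; rewrite /D br_suml big1 // => k _.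
by rewrite brMl (br_anti (d k)) (br_anti (x k)) ed // ex // !oppr0 mulr0 mul0r addr0.
Qed.

Let cD : br c D = 0.
Proof.
by rewrite /D br_sumr big1 // => k _; rewrite brMr cx cd mul0r mulr0 addr0.
Qed.

Let LL_x i j k : P i -> P j -> br (e i j + x i * d j) (x k) = x i *+ (j == k).
Proof.
move=> Pi Pj; rewrite brDl ex // add0r brMl dx xx mul0r addr0.
by case: eqP; rewrite ?mulr1 ?mulr0.
Qed.

Let LL_d i j k : P i -> P j -> br (e i j + x i * d j) (d k) = - d j *+ (k == i).
Proof.
move=> Pi Pj; rewrite brDl ed // add0r brMl dd xd mulr0 add0r mulNr eq_sym.
by case: eqP; rewrite ?mul1r ?mul0r ?oppr0.
Qed.

Let LL_e i j k l : P i -> P j -> P k -> P l ->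
  br (e i j + x i * d j) (e k l) = e i l *+ (j == k) - e k j *+ (l == i).
Proof.
move=> Pi Pj Pk Pl; rewrite brDl eP // brMl (br_anti (d j)) (br_anti (x i)).
by rewrite ed // ex // !oppr0 mulr0 mul0r !addr0.
Qed.

Let LL_D i j : P i -> P j -> br (e i j + x i * d j) (c - D) = 0.
Proof.
move=> Pi Pj; rewrite brBr !brDl !brMl (br_anti (e i j) c) ce //.
rewrite (br_anti (d j) c) (br_anti (x i) c) cx cd (br_anti (e i j) D) De //.
rewrite (br_anti (d j) D) (br_anti (x i) D) Dx // Dd //.
by rewrite !oppr0 opprK mulr0 mul0r mulNr subrr !addr0 subrr.
Qed.

Let LL_LL i j k l : P i -> P j -> P k -> P l ->
  br (e i j + x i * d j) (e k l + x k * d l) =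
  (e i l + x i * d l) *+ (j == k) - (e k j + x k * d j) *+ (l == i).
Proof.
move=> Pi Pj Pk Pl; rewrite brDr LL_e // brMr LL_x // LL_d //.
by rewrite mulrnAl mulNrn mulrN mulrnAr !mulrnDl opprD addrACA.
Qed.

Let LL_f i j k : P i -> P j -> P k ->
  br (e i j + x i * d j) (f k) = - f j *+ (k == i).
Proof.
move=> Pi Pj Pk; rewrite /f brBr brMr LL_D // mul0r add0r LL_d // br_sumr.
have -> : \sum_(l | P l) br (e i j + x i * d j) (d l * e l k) =
   - (\sum_(l | P l) d l * e l j *+ (k == i)).
  transitivity (\sum_(l | P l) ((d l * e i k) *+ (j == l)
      - (d j * e l k) *+ (i == l) - (d l * e l j) *+ (k == i))).
    apply: eq_bigr => l Pl; rewrite brMr LL_d // LL_e // (eq_sym l).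
    rewrite mulrBr !mulrnAr mulNrn mulNr mulrnAl addrA; congr (_ - _).
    by rewrite addrC.
  rewrite !sumrB (sum_delta (fun l => d l * e i k) Pj).
  by rewrite (sum_delta (fun l => d j * e l k) Pi) subrr add0r.
by rewrite sumrMnl mulrnAr mulrN opprK -mulrnDl opprB addrC.
Qed.

Let f_x k i : P i -> P k ->
  br (f k) (x i) = (c - D) *+ (k == i) - (e i k + x i * d k).
Proof.
move=> Pi Pk; rewrite /f brBl brMl dx brBl cx Dx // sub0r mulNr br_suml.
rewrite mulr_natr.
have -> : \sum_(l | P l) br (d l * e l k) (x i) =
   \sum_(l | P l) e l k *+ (i == l).
  apply: eq_bigr => l Pl; rewrite brMl ex // mulr0 add0r dx eq_sym.
  by rewrite mulr_natl.
by rewrite (sum_delta (e^~ k) Pi) opprD addrAC addrA.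
Qed.

Let f_D k : P k -> br (f k) (c - D) = - f k.
Proof.
move=> Pk; rewrite br_anti; congr (- _); rewrite /f brBr brMr brxx mul0r add0r.
rewrite brBl cd Dd // opprK add0r br_sumr; congr (_ - _).
apply: eq_bigr => l Pl; rewrite brMr !brBl cd Dd // ce // De //.
by rewrite !subr0 sub0r opprK mulr0 addr0.
Qed.

Let h_d i : P i -> br (c - D) (d i) = d i.
Proof. by move=> Pi; rewrite brBl cd Dd // sub0r opprK. Qed.

Let h_e i j : P i -> P j -> br (c - D) (e i j) = 0.
Proof. by move=> Pi Pj; rewrite brBl ce // De // subr0. Qed.

Let g i := \sum_(k | P k) d k * e k i.

Let fE i : f i = (c - D) * d i - g i. Proof. by []. Qed.

Let g_d k i : P k -> br (g k) (d i) = 0.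
Proof.
move=> Pk; rewrite br_suml big1 // => l Pl.
by rewrite brMl dd ed // mulr0 mul0r addr0.
Qed.

Let f_d k i : P i -> P k -> br (f k) (d i) = d i * d k.
Proof.
by move=> Pi Pk; rewrite fE brBl brMl dd mulr0 add0r h_d // g_d // subr0.
Qed.

Let f_e i j k : P i -> P j -> P k ->
  br (f k) (e i j) = d j * e i k - g j *+ (k == i).
Proof.
move=> Pi Pj Pk; rewrite fE brBl brMl h_e // (br_anti (d k)) ed // oppr0.
rewrite mulr0 mul0r addr0 sub0r br_suml.
have -> : \sum_(l | P l) br (d l * e l k) (e i j) =
   \sum_(l | P l) (d l * e l j *+ (k == i) - d l * e i k *+ (j == l)).
  apply: eq_bigr => l Pl; rewrite brMl eP // (br_anti (d l)) ed // oppr0 mul0r.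
  by rewrite addr0 mulrBr !mulrnAr.
by rewrite sumrB sumrMnl (sum_delta (fun l => d l * e i k) Pj) opprB.
Qed.

(** By [f_d] and [f_e] the sum in [f k] contributes [d k * g i]; all that is left is the commutator
    of [g i] with [d k]. *)
Let f_f i k : P i -> P k -> br (f i) (f k) = 0.
Proof.
move=> Pi Pk; rewrite [f k]fE brBr brMr f_D // f_d // br_sumr.
have -> : \sum_(l | P l) br (f i) (d l * e l k) = d k * g i.
  transitivity (\sum_(l | P l)
      (d i * (d l * e l k) + d k * (d l * e l i) - d l * g k *+ (i == l))).
    apply: eq_bigr => l Pl; rewrite brMr f_d // f_e //.
    rewrite mulrBr mulrnAr addrA -!mulrA; congr (_ + _ - _).
      by rewrite !mulrA (br0_comm (dd l i)).
    by rewrite !mulrA (br0_comm (dd l k)).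
  rewrite sumrB big_split /= -!mulr_sumr.
  by rewrite (sum_delta (fun l => d l * g k) Pi) addrAC subrr add0r.
rewrite fE mulNr mulrBl opprB -!mulrA (br0_comm (dd i k)) subrK.
by rewrite (br0_comm (g_d k Pi)) subrr.
Qed.

Lemma par_step_gl : gl_on [pred i | (i == a) || P i] par_step.
Proof.
have Na i : P i -> (i == a) = false by move=> Pi; apply: contraNF Pa => /eqP <-.
have aN i : P i -> (a == i) = false by move=> Pi; rewrite eq_sym Na.
have aa_f k : P k -> br (c - D) (f k) = f k.
  by move=> Pk; rewrite br_anti f_D // opprK.
have x_aa i : P i -> br (x i) (c - D) = x i.
  by move=> Pi; rewrite br_anti brBl cx Dx // sub0r opprK.
have x_f i k : P i -> P k ->
    br (x i) (f k) = (e i k + x i * d k) - (c - D) *+ (k == i).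
  by move=> Pi Pk; rewrite br_anti f_x // opprB.
move=> i j k l /predU1P [->|Pi] /predU1P [->|Pj] /predU1P [->|Pk] /predU1P [->|Pl].
all: rewrite /par_step ?eqxx ?Na ?aN ?mulr1n ?mulr0n ?subr0 ?sub0r //=.
all: rewrite ?brxx ?subrr //.
all: try by [apply: aa_f | apply: x_aa | apply: f_f | apply: x_f | apply: LL_LL].
- by rewrite br_anti x_aa.
- by rewrite br_anti LL_D ?oppr0.
- exact: f_D.
- exact: f_x.
- by rewrite br_anti LL_f // mulNrn opprK eq_sym.
- by rewrite br_anti LL_x // eq_sym.
- exact: LL_D.
- by rewrite LL_f // mulNrn.
- exact: LL_x.
Qed.
End ParabolicStep.

(** * The algebra of linear endomorphisms of a polynomial ring *)

Section LinearEnd.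
Variables (K : fieldType) (N : nat).
Local Notation V := {mpoly K[N]}.

Record mpend := Mpend { mpend_fun :> V -> V; mpendP : linear mpend_fun }.

HB.instance Definition _ := gen_eqMixin mpend.
HB.instance Definition _ := gen_choiceMixin mpend.

Lemma eq_mpend (f g : mpend) : f =1 g -> f = g.
Proof.
case: f g => [f fP] [g gP] /= /funext fg; case: g / fg gP => gP.
by congr Mpend; apply: Prop_irrelevance.
Qed.

Lemma mpendD (f : mpend) p q : f (p + q) = f p + f q.
Proof. by rewrite -[p]scale1r mpendP !scale1r. Qed.

Lemma mpend0 (f : mpend) : f 0 = 0.
Proof. by apply: (addIr (f 0)); rewrite -mpendD !add0r. Qed.

Lemma mpendZ (f : mpend) c p : f (c *: p) = c *: f p.
Proof. by rewrite -[c *: p]addr0 mpendP mpend0 addr0. Qed.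

Fact zero_lin : linear (fun _ : V => 0 : V).
Proof. by move=> c p q; rewrite scaler0 addr0. Qed.
Fact opp_lin (f : mpend) : linear (fun p => - f p).
Proof. by move=> c p q; rewrite mpendP opprD scalerN. Qed.
Fact add_lin (f g : mpend) : linear (fun p => f p + g p).
Proof. by move=> c p q; rewrite !mpendP scalerDr addrACA. Qed.
Fact id_lin : linear (fun p : V => p).
Proof. by []. Qed.
Fact comp_lin (f g : mpend) : linear (fun p => f (g p)).
Proof. by move=> c p q; rewrite !mpendP. Qed.
Fact scale_lin a (f : mpend) : linear (fun p => a *: f p).
Proof. by move=> c p q; rewrite mpendP scalerDr !scalerA mulrC. Qed.

Fact mpend_addA : associative (fun f g => Mpend (add_lin f g)).
Proof. by move=> f g h; apply: eq_mpend => p /=; rewrite addrA. Qed.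
Fact mpend_addC : commutative (fun f g => Mpend (add_lin f g)).
Proof. by move=> f g; apply: eq_mpend => p /=; rewrite addrC. Qed.
Fact mpend_add0 : left_id (Mpend zero_lin) (fun f g => Mpend (add_lin f g)).
Proof. by move=> f; apply: eq_mpend => p /=; rewrite add0r. Qed.
Fact mpend_addN : left_inverse (Mpend zero_lin)
  (fun f => Mpend (opp_lin f)) (fun f g => Mpend (add_lin f g)).
Proof. by move=> f; apply: eq_mpend => p /=; rewrite addNr. Qed.

HB.instance Definition _ := GRing.isZmodule.Build mpend
  mpend_addA mpend_addC mpend_add0 mpend_addN.

Fact mpend_mulA : associative (fun f g => Mpend (comp_lin f g)).
Proof. by move=> f g h; apply: eq_mpend. Qed.
Fact mpend_mul1 : left_id (Mpend id_lin) (fun f g => Mpend (comp_lin f g)).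
Proof. by move=> f; apply: eq_mpend. Qed.
Fact mpend_mulr1 : right_id (Mpend id_lin) (fun f g => Mpend (comp_lin f g)).
Proof. by move=> f; apply: eq_mpend. Qed.
Fact mpend_mulDl :
  left_distributive (fun f g => Mpend (comp_lin f g)) (@GRing.add mpend).
Proof. by move=> f g h; apply: eq_mpend. Qed.
Fact mpend_mulDr :
  right_distributive (fun f g => Mpend (comp_lin f g)) (@GRing.add mpend).
Proof. by move=> f g h; apply: eq_mpend => p /=; rewrite mpendD. Qed.
Fact mpend_1N0 : Mpend id_lin != 0.
Proof.
apply/eqP => /(congr1 (fun f : mpend => f 1)) /= /eqP.
by rewrite oner_eq0.
Qed.

HB.instance Definition _ := GRing.Zmodule_isNzRing.Build mpend
  mpend_mulA mpend_mul1 mpend_mulr1 mpend_mulDl mpend_mulDr mpend_1N0.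

Fact mpend_scaleA a b f :
  Mpend (scale_lin a (Mpend (scale_lin b f))) = Mpend (scale_lin (a * b) f).
Proof. by apply: eq_mpend => p /=; rewrite scalerA. Qed.
Fact mpend_scale1 : left_id 1 (fun a f => Mpend (scale_lin a f)).
Proof. by move=> f; apply: eq_mpend => p /=; rewrite scale1r. Qed.
Fact mpend_scaleDr :
  right_distributive (fun a f => Mpend (scale_lin a f)) (@GRing.add mpend).
Proof. by move=> a f g; apply: eq_mpend => p /=; rewrite scalerDr. Qed.
Fact mpend_scaleDl f :
  {morph (fun a => Mpend (scale_lin a f)) : a b / a + b}.
Proof. by move=> a b; apply: eq_mpend => p /=; rewrite scalerDl. Qed.

HB.instance Definition _ := GRing.Zmodule_isLmodule.Build K mpend
  mpend_scaleA mpend_scale1 mpend_scaleDr mpend_scaleDl.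

Fact mpend_scaleAl a (f g : mpend) : a *: (f * g) = (a *: f) * g.
Proof. exact: eq_mpend. Qed.

HB.instance Definition _ :=
  GRing.Lmodule_isLalgebra.Build K mpend mpend_scaleAl.

Fact mpend_scaleAr a (f g : mpend) : a *: (f * g) = f * (a *: g).
Proof. by apply: eq_mpend => p /=; rewrite mpendZ. Qed.

HB.instance Definition _ :=
  GRing.Lalgebra_isAlgebra.Build K mpend mpend_scaleAr.

Lemma mpend_addE (f g : mpend) p : (f + g) p = f p + g p. Proof. by []. Qed.
Lemma mpend_oppE (f : mpend) p : (- f) p = - f p. Proof. by []. Qed.
Lemma mpend_mulE (f g : mpend) p : (f * g) p = f (g p). Proof. by []. Qed.
Lemma mpend_oneE p : (1 : mpend) p = p. Proof. by []. Qed.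
Lemma mpend_scaleE c (f : mpend) p : (c *: f) p = c *: f p. Proof. by []. Qed.
Lemma mpend_sumE (I : Type) (r : seq I) (P : pred I) (F : I -> mpend) p :
  (\sum_(i <- r | P i) F i) p = \sum_(i <- r | P i) F i p.
Proof. by apply: (big_morph (fun f : mpend => f p)). Qed.

Fact mulX_lin i : linear (fun p : V => 'X_i * p).
Proof. by move=> c p q; rewrite mulrDr scalerAr. Qed.
Definition mulX i := Mpend (mulX_lin i).

Fact deriv_lin i : linear (@mderiv N K i).
Proof. by move=> c p q; rewrite linearP. Qed.
Definition derX i := Mpend (deriv_lin i).

Lemma br_mulX i j : br (mulX i) (mulX j) = 0.
Proof. by apply: eq_mpend => p; apply/eqP; rewrite subr_eq0 /= mulrCA. Qed.

Lemma br_derX i j : br (derX i) (derX j) = 0.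
Proof. by apply: eq_mpend => p; apply/eqP; rewrite subr_eq0 /= mderiv_comm. Qed.

Lemma br_derX_mulX i j : br (derX i) (mulX j) = (i == j)%:R.
Proof.
apply: eq_mpend => p; rewrite /br mpend_addE mpend_oppE !mpend_mulE /=.
rewrite mderivM addrK mderivX mnm1E eq_sym.
case: eqP => [->|_]; last by rewrite scale0r mul0r.
have -> : (U_(j) - U_(j))%MM = 0%MM :> 'X_{1..N}.
  by apply/mnmP => k; rewrite mnmBE mnm0E subnn.
by rewrite mpolyX0 scale1r mul1r.
Qed.

Lemma br_scalar (c : K) (f : mpend) : br (c *: 1) f = 0.
Proof. by rewrite /br -scalerAl -scalerAr mul1r mulr1 subrr. Qed.

End LinearEnd.

(** * The universal property of U(gl_n) and its generation by the matrix units *)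

Section FreeAlgebra.
Import monalg.

Lemma Ugl_surj (C : fieldType) (n : nat) (u : Ugl C n) :
  exists x, u = pi_alg (gl_rel_proper C n) x.
Proof. exact: pi_alg_surj. Qed.

Section UglLift.
Variables (C : fieldType) (n : nat) (S : algType C).
Variable e : 'I_n -> 'I_n -> S.
Hypothesis eP : gl_on predT e.
Local Notation FA := {malg C[{fmonom ('I_n * 'I_n)%type}]}.

Definition word_val (m : {fmonom ('I_n * 'I_n)%type}) : S :=
  \prod_(p <- (m : seq _)) e p.1 p.2.

Fact word_val_mmorphism : mmorphism word_val.
Proof.
split=> [x y|]; first by rewrite /word_val fmM big_cat.
by rewrite /word_val fm1 big_nil.
Qed.

HB.instance Definition _ :=
  isMultiplicative.Build _ S word_val word_val_mmorphism.

Definition free_lift (x : FA) : S := mmap (GRing.in_alg S) word_val x.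

Lemma free_liftB x y : free_lift (x - y) = free_lift x - free_lift y.
Proof. exact: mmapB. Qed.

Lemma free_liftM x y : free_lift (x * y) = free_lift x * free_lift y.
Proof.
apply: (commr_mmap_is_multiplicative _).1 => g m m' /=.
by rewrite /GRing.comm mulr_algl mulr_algr.
Qed.

Lemma free_lift1 : free_lift 1 = 1.
Proof. exact: mmap1. Qed.

Lemma free_liftZ c x : free_lift (c *: x) = c *: free_lift x.
Proof. by rewrite /free_lift mmapZ /= mulr_algl. Qed.

Lemma free_lift_gen i j : free_lift (gl_free_gen C i j) = e i j.
Proof. by rewrite /free_lift mmapU /= scale1r mul1r /word_val fmU big_seq1. Qed.

Lemma free_lift_ideal x : ideal_gen (@gl_rel C n) x -> free_lift x = 0.
Proof.
elim=> [{}x [i [j [k [l ->]]]]||{}x y _ hx _ hy|a {}x _ hx|a {}x _ hx].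
- have key (a b c d : FA) : free_lift (a * b - b * a - (c - d)) =
      free_lift a * free_lift b - free_lift b * free_lift a
      - (free_lift c - free_lift d).
    by rewrite (free_liftB (a * b - b * a)) (free_liftB (a * b)) (free_liftB c)
      (free_liftM a b) (free_liftM b a).
  apply: etrans (key _ _ _ _) _; rewrite !free_lift_gen.
  have fMn b u v : free_lift (gl_free_gen C u v *+ nat_of_bool b) = e u v *+ b.
    by case: b; rewrite ?mulr1n ?mulr0n ?free_lift_gen //; apply: mmap0.
  by rewrite !fMn [X in X - _]eP // subrr.
- exact: mmap0.
- by rewrite free_liftB hx hy subrr.
- by rewrite free_liftM hx mulr0.
- by rewrite free_liftM hx mul0r.
Qed.

Definition Ugl_lift (u : Ugl C n) : S :=
  free_lift (repr (u : {quot (ideal_pred (@gl_rel C n))})).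

Lemma Ugl_lift_pi x : Ugl_lift (pi_alg (gl_rel_proper C n) x) = free_lift x.
Proof.
apply/eqP; rewrite -subr_eq0 -free_liftB; apply/eqP/free_lift_ideal.
by apply/ideal_predP; rewrite idealrBE reprK.
Qed.

Lemma Ugl_liftE i j : Ugl_lift (Egl C i j) = e i j.
Proof. by rewrite Ugl_lift_pi free_lift_gen. Qed.

Lemma Ugl_lift1 : Ugl_lift 1 = 1.
Proof. by rewrite -[RHS]free_lift1 -Ugl_lift_pi. Qed.

Lemma Ugl_liftB u v : Ugl_lift (u - v) = Ugl_lift u - Ugl_lift v.
Proof.
have [x ->] := Ugl_surj u; have [y ->] := Ugl_surj v.
by rewrite -pi_algB !Ugl_lift_pi free_liftB.
Qed.

Lemma Ugl_liftM u v : Ugl_lift (u * v) = Ugl_lift u * Ugl_lift v.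
Proof.
have [x ->] := Ugl_surj u; have [y ->] := Ugl_surj v.
by rewrite -pi_algM !Ugl_lift_pi free_liftM.
Qed.

Lemma Ugl_liftZ c u : Ugl_lift (c *: u) = c *: Ugl_lift u.
Proof.
have [x ->] := Ugl_surj u.
by rewrite -pi_algZ !Ugl_lift_pi free_liftZ.
Qed.

End UglLift.

Lemma Ugl_corner_full (C : fieldType) (n : nat) (u : Ugl C n) : Ugl_corner n u.
Proof.
have [x ->] := Ugl_surj u; set G := gl_rel_proper C n.
have lin c y z : Ugl_corner n (pi_alg G y) -> Ugl_corner n (pi_alg G z) ->
    Ugl_corner n (pi_alg G (c *: y + z)).
  by move=> hy hz; rewrite pi_algD pi_algZ; apply: SubalgP.
have h0 : Ugl_corner n (pi_alg G 0).
  have -> : pi_alg G 0 = (-1) *: 1 + 1.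
    by rewrite -[X in pi_alg _ X](subrr 1) pi_algB scaleN1r addNr pi_alg1 subrr.
  by apply: SubalgP; apply: Subalg1.
rewrite (monalgE x); elim/big_rec: _ => // k y _ hy.
have -> : << mcoeff k x *g k >> = mcoeff k x *: (<< k >> : gl_free C n).
  by rewrite malgZ_def /fgscale msuppU1 big_seq_fset1 mcoeffUU mulr1.
apply: lin => //; move: {y hy x}(mcoeff k x) => _.
case: k => s; elim: s => [|[i j] s IHs].
  have -> : << FMonom [::] >> = 1 :> gl_free C n.
    by congr (mkmalgU _ _); apply/eqP; rewrite fmP fm1.
  by rewrite pi_alg1; apply: Subalg1.
have -> : << FMonom ((i, j) :: s) >> =
    gl_free_gen C i j * (<< FMonom s >> : gl_free C n).
  rewrite malgM_def fgmulUU mulr1; congr (mkmalgU _ _).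
  by apply/eqP; rewrite fmP fmM fmU.
rewrite (pi_algM G (gl_free_gen C i j)).
by apply: SubalgM IHs; apply: SubalgBase; exists i, j.
Qed.

End FreeAlgebra.

(** * The Verma module on a polynomial ring, and functionals dual to words *)

Section VermaModel.
Variables (C : fieldType) (n : nat) (lam : 'I_n -> C).
Local Notation N := #|{: 'I_n * 'I_n}|.
Local Notation V := {mpoly C[N]}.

Definition pidx (i j : 'I_n) : 'I_N := enum_rank (i, j).

Lemma pidx_eq i j k l : (pidx i j == pidx k l) = (i == k) && (j == l).
Proof. by rewrite (inj_eq enum_rank_inj). Qed.

Let X i j : mpend C N := mulX C (pidx i j).
Let D i j : mpend C N := derX C (pidx i j).

(** [par_step] is iterated from the bottom right corner up, each time adding a new smallest index
    and the column of variables below it. The ring has a variable for every pair from the outset, so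
    that all steps take place in one algebra of operators. *)
Lemma verma_model : exists e : 'I_n -> 'I_n -> mpend C N,
  [/\ gl_on predT e,
      forall i j : 'I_n, (i < j)%N -> e i j 1 = 0,
      forall i, e i i 1 = lam i *: 1 &
      forall i j : 'I_n, (j < i)%N -> forall p : V,
        (forall q, mderiv (pidx j q) p = 0) -> e i j p = 'X_(pidx i j) * p].
Proof.
pose I m : pred 'I_n := fun i => (n <= i + m)%N.
(* [I m] consists of the last [m] indices. The last clause keeps the other columns free: their
   variables and derivatives commute with the operators built so far, as [par_step] requires. *)
suff {} : forall m, (m <= n)%N -> exists e : 'I_n -> 'I_n -> mpend C N,
  [/\ gl_on (I m) e,
      forall i j : 'I_n, I m i -> I m j -> (i < j)%N -> e i j 1 = 0,
      forall i : 'I_n, I m i -> e i i 1 = lam i *: 1,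
      forall i j : 'I_n, I m i -> I m j -> (j < i)%N -> forall p : V,
        (forall q, mderiv (pidx j q) p = 0) -> e i j p = 'X_(pidx i j) * p &
      forall i j k l : 'I_n, I m i -> I m j -> ~~ I m l ->
        br (e i j) (X k l) = 0 /\ br (e i j) (D k l) = 0].
  move=> /(_ n (leqnn n)) [e [h1 h2 h3 h4 _]]; exists e.
  have In i : I n i by rewrite /I leq_addl.
  by split=> [i j k l *|i j|i|i j]; [apply: h1|apply: h2|apply: h3|apply: h4].
elim=> [_|m IHm mn].
  have I0 i : I 0%N i = false by rewrite /I addn0 leqNgt ltn_ord.
  exists (fun _ _ => 0).
  by split=> [i j k l|i j|i|i j|i j k l]; rewrite I0.
have [e [h1 h2 h3 h4 h5]] := IHm (ltnW mn).
have an : (n - m.+1 < n)%N by rewrite ltn_subrL (leq_ltn_trans _ mn).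
have [a aE] : exists a : 'I_n, nat_of_ord a = (n - m.+1)%N by exists (Ordinal an).
have Pa : ~~ I m a by rewrite /I aE; lia.
have IS i : I m.+1 i = (i == a) || I m i.
  by rewrite /I -val_eqE /= aE; lia.
have gtm i : I m i -> (a < i)%N by rewrite /I aE; lia.
pose x i := X i a; pose d i := D i a.
have XX i j k l : br (X i j) (X k l) = 0 by apply: br_mulX.
have DD i j k l : br (D i j) (D k l) = 0 by apply: br_derX.
have DX i j k l : br (D i j) (X k l) = ((i == k) && (j == l))%:R.
  by rewrite br_derX_mulX pidx_eq.
have D1 i j : D i j 1 = 0 by rewrite /= -mpolyC1 mderivC.
have cbr f : br (lam a *: 1 : mpend C N) f = 0 by apply: br_scalar.
have brE (f g : mpend C N) p : br f g = 0 -> f (g p) = g (f p).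
  by move/br0_comm => fg; rewrite -!mpend_mulE fg.
exists (par_step (I m) a e x d (lam a *: 1)).
have In i : I m i -> (i == a) = false.
  by move=> Ii; apply/negP => /eqP ia; rewrite ia (negPf Pa) in Ii.
split.
- move=> i j k l; rewrite !IS; apply: par_step_gl => //.
  + by move=> i' k'; apply: XX.
  + by move=> i' k'; apply: DD.
  + by move=> i' k'; rewrite /d /x DX eqxx andbT.
  + by move=> i' j' k' Pi Pj; apply: (h5 _ _ _ _ Pi Pj Pa).1.
  + by move=> i' j' k' Pi Pj; apply: (h5 _ _ _ _ Pi Pj Pa).2.
- move=> i j; rewrite !IS /par_step => /predU1P [->|Pi] /predU1P [->|Pj].
  + by rewrite ltnn.
  + rewrite eqxx (In _ Pj) => _.
    rewrite mpend_addE mpend_mulE mpend_oppE D1 mpend0 sub0r mpend_sumE.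
    rewrite big1 ?oppr0 // => k Pk.
    by rewrite mpend_mulE brE ?D1 ?mpend0 // br_anti (h5 _ _ _ _ Pk Pj Pa).2 oppr0.
  + by move=> ia; have := gtm _ Pi; lia.
  + rewrite (In _ Pi) (In _ Pj) => ij.
    by rewrite mpend_addE mpend_mulE D1 mpend0 addr0 h2.
- move=> i; rewrite IS /par_step => /predU1P [->|Pi].
  + rewrite eqxx mpend_addE mpend_oppE mpend_sumE big1 ?subr0 // => k _.
    by rewrite mpend_mulE D1 mpend0.
  + by rewrite (In _ Pi) mpend_addE mpend_mulE D1 mpend0 addr0 h3.
- move=> i j; rewrite !IS /par_step => /predU1P [->|Pi] /predU1P [->|Pj].
  + by rewrite ltnn.
  + by move=> ja; have := gtm _ Pj; lia.
  + by rewrite eqxx (In _ Pi).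
  + rewrite (In _ Pi) (In _ Pj) => ji p p0.
    (* The correction [x i * d j] differentiates along a variable of row [j], so it vanishes on
       [p]. *)
    have dp : d j p = 0 by apply: p0.
    by rewrite mpend_addE mpend_mulE dp mpend0 addr0 h4.
- move=> i j k l; rewrite !IS /par_step negb_or => Pi Pj /andP [la Pl].
  have al : (a == l) = false by rewrite eq_sym (negPf la).
  have bx i' : br (x i') (X k l) = 0 /\ br (x i') (D k l) = 0.
    by rewrite /x XX br_anti DX (negPf la) andbF oppr0.
  have bd i' : br (d i') (X k l) = 0 /\ br (d i') (D k l) = 0.
    by rewrite /d DD DX al andbF.
  have mulz (f g h : mpend C N) : br f h = 0 -> br g h = 0 -> br (f * g) h = 0.
    by move=> fh gh; rewrite brMl fh gh mulr0 mul0r addr0.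
  have bD h : (forall i', br (x i') h = 0) -> (forall i', br (d i') h = 0) ->
      br (lam a *: 1 - \sum_(k | I m k) x k * d k) h = 0.
    move=> xh dh; rewrite brBl cbr sub0r br_suml big1 ?oppr0 // => k' _.
    exact: mulz.
  have bD1 := bD _ (fun i' => (bx i').1) (fun i' => (bd i').1).
  have bD2 := bD _ (fun i' => (bx i').2) (fun i' => (bd i').2).
  case/predU1P: Pi => [->|Pi]; case/predU1P: Pj => [->|Pj].
  + by rewrite eqxx.
  + have be h : br (lam a *: 1 - \sum_(k | I m k) x k * d k) h = 0 ->
        (forall i', br (d i') h = 0) ->
        (forall i', I m i' -> br (e i' j) h = 0) ->
        br ((lam a *: 1 - \sum_(k | I m k) x k * d k) * d j
            - \sum_(k | I m k) d k * e k j) h = 0.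
      move=> ch dh eh; rewrite brBl mulz // sub0r br_suml big1 ?oppr0 // => k' Pk'.
      by rewrite mulz ?eh.
    rewrite eqxx (In _ Pj); split; apply: be => //.
    * by move=> i'; case: (bd i').
    * by move=> i' Pi'; case: (h5 _ _ k l Pi' Pj Pl).
    * by move=> i'; case: (bd i').
    * by move=> i' Pi'; case: (h5 _ _ k l Pi' Pj Pl).
  + by rewrite eqxx (In _ Pi).
  + rewrite (In _ Pi) (In _ Pj) !brDl.
    have [-> ->] := h5 _ _ k l Pi Pj Pl; have [xx1 xx2] := bx i.
    by have [dd1 dd2] := bd j; rewrite !add0r; split; apply: mulz.
Qed.

End VermaModel.

Section Words.
Variables (n : nat) (A : nzRingType) (E : 'I_n -> 'I_n -> A).
Implicit Types w : seq ('I_n * 'I_n).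

Definition EW w : A := \prod_(p <- w) E p.1 p.2.

(* In a word with weakly increasing rows the letters after [E_(i,j)], [j < i], avoid
   row [j]; in the polynomial model [E_(i,j)] multiplies their monomial by a variable. *)
Definition lowrow : rel ('I_n * 'I_n) := fun p q => (p.1 <= q.1)%N.
Definition loww w := all (fun p : 'I_n * 'I_n => p.2 < p.1)%N w && sorted lowrow w.

Lemma lowrow_trans : transitive lowrow.
Proof. by move=> p q r; apply: leq_trans. Qed.

Lemma EW0 : EW [::] = 1. Proof. exact: big_nil. Qed.
Lemma EW_cons p w : EW (p :: w) = E p.1 p.2 * EW w.
Proof. exact: big_cons. Qed.
Lemma EW_cat w w' : EW (w ++ w') = EW w * EW w'.
Proof. exact: big_cat. Qed.

Lemma EW_rcons w p : EW (rcons w p) = EW w * E p.1 p.2.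
Proof. by rewrite -cats1 EW_cat EW_cons EW0 mulr1. Qed.

Lemma loww_cons p w : loww (p :: w) ->
  [/\ (p.2 < p.1)%N, forall q, q \in w -> (p.1 <= q.1)%N & loww w].
Proof.
rewrite /loww /= (path_sortedE lowrow_trans).
case/andP=> /andP [pp aw] /andP [/allP pw sw].
by split; rewrite ?aw.
Qed.

Definition wmon w : 'X_{1..#|{: 'I_n * 'I_n}|} :=
  (\sum_(p <- w) U_(pidx p.1 p.2))%MM.

Lemma wmonE w i j : wmon w (pidx i j) = count_mem (i, j) w.
Proof.
rewrite /wmon; elim: w => [|[k l] w IHw]; first by rewrite big_nil mnm0E.
by rewrite big_cons mnmDE IHw mnm1E pidx_eq /= xpair_eqE.
Qed.

End Words.

(** Linear independence in dual form: [phi] reads off the coefficient of the monomial of [w] in [u]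
    applied to the constant 1, a vector killed by the Verma relations. *)
Lemma verma_functional (C : fieldType) (n : nat) (lam : 'rV[C]_n)
    (w : seq ('I_n * 'I_n)) :
  exists phi : Ugl C n -> C,
  [/\ forall c x y, phi (c *: x + y) = c * phi x + phi y,
      forall x, left_ideal_gen (verma_rel lam) x -> phi x = 0 &
      forall w', loww w' -> phi (EW (@Egl C n) w') = (perm_eq w w')%:R].
Proof.
have [e [eP e1 e2 e3]] := verma_model (lam 0).
pose F := Ugl_lift e.
have FB := Ugl_liftB eP; have FM := Ugl_liftM eP; have FZ := Ugl_liftZ eP.
have FE := Ugl_liftE eP; have F1 := Ugl_lift1 eP.
have FN v : F (- v) = - F v by rewrite -[- v]scaleN1r /F FZ scaleN1r.
have FD u v : F (u + v) = F u + F v.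
  by rewrite -[v in LHS]opprK /F FB -/F FN opprK.
have low w' : loww w' -> F (EW (@Egl C n) w') 1 = 'X_[wmon w'].
  elim: w' => [|p w' IHw] hw; first by rewrite EW0 /F F1 /wmon big_nil mpolyX0.
  have [pp pw hw'] := loww_cons hw.
  rewrite EW_cons /F FM FE mpend_mulE IHw // e3 //.
    by rewrite -mpolyXD /wmon big_cons.
  move=> q; rewrite mderivX wmonE (count_memPn _) ?scale0r //.
  by apply/negP => /pw /=; rewrite leqNgt pp.
exists (fun u => (F u 1)@_(wmon w)); split.
- by move=> c x y; rewrite FD /F FZ mpend_addE mpend_scaleE linearP.
- move=> x xJ; suff -> : F x 1 = 0 by rewrite mcoeff0.
  elim: xJ => [{}x [[i [j [ij ->]]]|[i ->]]||{}x y _ hx _ hy|a {}x _ hx].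
  + by rewrite /F FE e1.
  + rewrite /F FB FE FZ F1 mpend_addE mpend_oppE e2 mpend_scaleE mpend_oneE.
    by rewrite subrr.
  + by rewrite -(subrr 0) /F FB subrr.
  + by rewrite /F FB mpend_addE mpend_oppE hx hy subrr.
  + by rewrite /F FM mpend_mulE hx mpend0.
- move=> w' /low ->; rewrite mcoeffX; congr (nat_of_bool _)%:R.
  apply/eqP/idP => [h|h].
    by apply/allP => -[i j] _ /=; rewrite -!wmonE h.
  by rewrite /wmon; apply: perm_big; rewrite perm_sym.
Qed.

(** * Words in the matrix units *)

Section WordSpan.
Variables (C : fieldType) (n : nat) (U : algType C) (E : 'I_n -> 'I_n -> U).
Local Notation word := (seq ('I_n * 'I_n)).
Local Notation EW := (EW E).

(** With [J] the left ideal of the Verma relations, this span expresses statements on the module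
    without forming the quotient; with [J] zero, statements in U itself. *)
Inductive wspan (J : U -> Prop) (P : word -> Prop) : U -> Prop :=
| WspanWord w of P w : wspan J P (EW w)
| WspanJ x of J x : wspan J P x
| WspanLin c x y of wspan J P x & wspan J P y : wspan J P (c *: x + y).

Definition lin_map (f : U -> U) := forall c x y, f (c *: x + y) = c *: f x + f y.

Lemma lin_id : lin_map id. Proof. by []. Qed.
Lemma lin_mull a : lin_map (fun x => a * x).
Proof. by move=> c x y; rewrite mulrDr scalerAr. Qed.
Lemma lin_mulr a : lin_map (fun x => x * a).
Proof. by move=> c x y; rewrite mulrDl scalerAl. Qed.

Lemma wspan_bind (J J' : U -> Prop) (P P' : word -> Prop) f x :
  lin_map f -> (forall w, P w -> wspan J' P' (f (EW w))) ->
  (forall y, J y -> wspan J' P' (f y)) -> wspan J P x -> wspan J' P' (f x).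
Proof.
move=> fl fw fJ; elim=> [w /fw|y /fJ|c y z _ hy _ hz] //.
by rewrite fl; apply: WspanLin.
Qed.

Section Stable.
Variable J : U -> Prop.
Hypothesis J0 : J 0.
Implicit Types P Q : word -> Prop.

Lemma wspan0 P : wspan J P 0. Proof. exact: WspanJ. Qed.

Lemma wspanZ P c x : wspan J P x -> wspan J P (c *: x).
Proof. by move=> hx; rewrite -[c *: x]addr0; apply: WspanLin => //; apply: wspan0. Qed.

Lemma wspanD P x y : wspan J P x -> wspan J P y -> wspan J P (x + y).
Proof. by move=> hx hy; rewrite -[x]scale1r; apply: WspanLin. Qed.

Lemma wspanB P x y : wspan J P x -> wspan J P y -> wspan J P (x - y).
Proof. by move=> hx hy; apply: wspanD => //; rewrite -scaleN1r; apply: wspanZ. Qed.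

Lemma wspan_sub P Q x : (forall w, P w -> Q w) -> wspan J P x -> wspan J Q x.
Proof.
move=> PQ; apply: (wspan_bind lin_id) => [w /PQ|y]; first exact: WspanWord.
exact: WspanJ.
Qed.

Lemma wspan_trans P Q x :
  (forall w, P w -> wspan J Q (EW w)) -> wspan J P x -> wspan J Q x.
Proof. by move=> PQ; apply: (wspan_bind lin_id) => // y; apply: WspanJ. Qed.

Hypothesis JM : forall a x, J x -> J (a * x).

Lemma wspan_mull P Q a x : (forall w, P w -> wspan J Q (a * EW w)) ->
  wspan J P x -> wspan J Q (a * x).
Proof.
by move=> PQ; apply: (wspan_bind (lin_mull a)) => // y /JM Jy; apply: WspanJ.
Qed.

Lemma wspan_mulW P Q u x : (forall w, P w -> Q (u ++ w)) ->
  wspan J P x -> wspan J Q (EW u * x).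
Proof.
move=> PQ; apply: wspan_mull => w /PQ Qw.
by rewrite -EW_cat; apply: WspanWord.
Qed.

End Stable.

Definition zeroU (x : U) := x = 0.
Notation pspan := (wspan zeroU).

Lemma zeroU0 : zeroU 0. Proof. by []. Qed.
Lemma zeroUM a x : zeroU x -> zeroU (a * x).
Proof. by move=> ->; rewrite /zeroU mulr0. Qed.

(** The principal grading, that is the eigenvalue of [ad Hgl] on a letter. Lowering letters have
    positive height, so the height of a word in them bounds its length. *)
Definition ht1 (p : 'I_n * 'I_n) : int := (p.1 : nat)%:Z - (p.2 : nat)%:Z.
Definition ht (w : word) : int := \sum_(p <- w) ht1 p.

Lemma ht_cons p w : ht (p :: w) = ht1 p + ht w. Proof. exact: big_cons. Qed.
Lemma ht_cat w w' : ht (w ++ w') = ht w + ht w'. Proof. exact: big_cat. Qed.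
Lemma ht_perm w w' : perm_eq w w' -> ht w = ht w'.
Proof. exact: perm_big. Qed.

Section Sorting.
Hypothesis EP : forall i j k l,
  E i j * E k l - E k l * E i j = E i l *+ (j == k) - E k j *+ (l == i).
Variable L : pred ('I_n * 'I_n).
Hypothesis LT : forall i j l, L (i, j) -> L (j, l) -> L (i, l).

Definition smaller (w w' : word) :=
  [/\ all L w', (size w' < size w)%N & ht w' = ht w].

Lemma EW_swap p q w : all L (p :: q :: w) ->
  pspan (smaller (p :: q :: w)) (EW (p :: q :: w) - EW (q :: p :: w)).
Proof.
case: p q => [i j] [k l] /= /and3P [Lp Lq Lw].
rewrite !EW_cons !mulrA -mulrBl /= EP mulrBl.
apply: (wspanB zeroU0).
  case: eqP => [jk|_]; last by rewrite mul0r; apply: (wspan0 zeroU0).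
  subst k; rewrite -(EW_cons E (i, l)); apply: WspanWord.
  by split; rewrite /= ?(LT Lp Lq) ?Lw // !ht_cons /ht1 /=; ring.
case: eqP => [jk|_]; last by rewrite mul0r; apply: (wspan0 zeroU0).
subst l; rewrite -(EW_cons E (k, j)); apply: WspanWord.
by split; rewrite /= ?(LT Lq Lp) ?Lw // !ht_cons /ht1 /=; ring.
Qed.

Lemma smaller_cons p w w' : L p -> smaller w w' -> smaller (p :: w) (p :: w').
Proof. by move=> Lp [h1 h2 h3]; split; rewrite /= ?Lp // !ht_cons h3. Qed.

Lemma smaller_perm w w' v : perm_eq w w' -> smaller w v -> smaller w' v.
Proof.
move=> ww' [h1 h2 h3]; split; rewrite // -?(ht_perm ww') //.
by rewrite -(perm_size ww').
Qed.

Lemma EW_perm w w' : all L w -> perm_eq w w' ->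
  pspan (smaller w) (EW w - EW w').
Proof.
elim: w w' => [|p u IHu] w' /=.
  move=> _; rewrite perm_sym => /perm_nilP ->.
  by rewrite subrr; apply: (wspan0 zeroU0).
case/andP=> Lp Lu pw'; have pinw' : p \in w' by rewrite -(perm_mem pw') mem_head.
case/splitPr: pinw' pw' => a b pw'.
have pu : perm_eq u (a ++ b).
  by rewrite -(perm_cons p) (perm_trans pw') // perm_catC /= perm_cons perm_catC.
have -> : EW (p :: u) - EW (a ++ p :: b) =
    E p.1 p.2 * (EW u - EW (a ++ b)) + (EW (p :: a ++ b) - EW (a ++ p :: b)).
  by rewrite mulrBr -!EW_cons addrA subrK.
apply: wspanD.
  have := IHu _ Lu pu; apply: (wspan_mull zeroUM) => w /(smaller_cons Lp) sw.
  by rewrite -EW_cons; apply: WspanWord.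
have Lab : all L (a ++ b) by rewrite -(perm_all _ pu).
apply: (@wspan_sub _ (smaller (p :: a ++ b))).
  by move=> v; apply: smaller_perm; rewrite perm_cons perm_sym.
elim: a Lab {pw' pu} => [|q a IHa] /=; first by rewrite subrr => _; apply: (wspan0 zeroU0).
case/andP=> Lq Lab; have -> : EW (p :: q :: a ++ b) - EW (q :: a ++ p :: b) =
    (EW (p :: q :: a ++ b) - EW (q :: p :: a ++ b)) +
    E q.1 q.2 * (EW (p :: a ++ b) - EW (a ++ p :: b)).
  by rewrite mulrBr -!EW_cons addrA subrK.
apply: wspanD; first by apply: EW_swap; rewrite /= Lp Lq.
have := IHa Lab; apply: (wspan_mull zeroUM) => w /(smaller_cons Lq) sw.
rewrite -EW_cons; apply: WspanWord; apply: smaller_perm sw.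
by rewrite (perm_catCA [:: q] [:: p]).
Qed.

Variable rk : 'I_n * 'I_n -> nat.
Definition rkle : rel ('I_n * 'I_n) := fun p q => (rk p <= rk q)%N.

(** Poincare-Birkhoff-Witt straightening by induction on the length: permuting letters costs shorter
    words of the same height, whose letters stay in [L] because [L] is closed under brackets. *)
Lemma EW_sort w : all L w ->
  pspan (fun w' => [/\ all L w', sorted rkle w', (size w' <= size w)%N &
    ht w' = ht w]) (EW w).
Proof.
elim: {w}(size w) {-2}w (leqnn (size w)) => [|m IHm] w wm Lw.
  move: wm; rewrite leqn0 size_eq0 => /eqP ->; exact: WspanWord.
have ps : perm_eq w (sort rkle w) by rewrite perm_sym perm_sort.
rewrite -[EW w](subrK (EW (sort rkle w))); apply: wspanD; last first.
  apply: WspanWord; split; rewrite ?size_sort //.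
  - by rewrite (perm_all _ (permEl (perm_sort _ _))).
  - by apply: sort_sorted => p q; apply: leq_total.
  - by apply: ht_perm; rewrite perm_sort.
have := EW_perm Lw ps; apply: (wspan_trans) => v [Lv vw <-].
apply: (wspan_sub _ (IHm v _ Lv)) => [v' [h1 h2 h3 h4]|].
  by split=> //; apply: leq_trans h3 (ltnW vw).
by rewrite -ltnS; apply: leq_trans vw wm.
Qed.

End Sorting.

End WordSpan.
Notation pspan E := (wspan E (@zeroU _ _)).

(** * Triangularity of the Gelfand-Tsetlin subalgebra *)

Lemma weight_shift (C : nzRingType) (A : algType C) (h p t : A) (w c : C) :
  h * p = p * h + c *: p ->
  h * (p * t) - (w + c) *: (p * t) = p * (h * t - w *: t).
Proof.
move=> hp; rewrite mulrA hp mulrDl -mulrA -scalerAl (scalerDl _ w) opprD.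
by rewrite addrACA subrr addr0 mulrBr -scalerAr.
Qed.

Section Triangular.
Variables (C : numFieldType) (n : nat) (U : algType C) (E : 'I_n -> 'I_n -> U).
Local Notation word := (seq ('I_n * 'I_n)).
Local Notation EW := (EW E).
Hypothesis EP : forall i j k l,
  E i j * E k l - E k l * E i j = E i l *+ (j == k) - E k j *+ (l == i).
Variables (lam : 'I_n -> C) (J : U -> Prop).
Hypothesis J0 : J 0.
Hypothesis JM : forall a x, J x -> J (a * x).
Hypothesis Jup : forall i j : 'I_n, (i < j)%N -> J (E i j).
Hypothesis Jdiag : forall i, J (E i i - (lam i)%:A).

Definition rows k (t : word) := all (fun p : 'I_n * 'I_n => k <= p.1)%N t.
Definition cornl k (p : 'I_n * 'I_n) := (p.1 < k)%N && (p.2 < k)%N.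

Lemma cornl_trans k i j l : cornl k (i, j) -> cornl k (j, l) -> cornl k (i, l).
Proof. by rewrite /cornl /= => /andP [-> _] /andP [_ ->]. Qed.

(** A letter in column [c] weighs [n - c], so moving it to a later column lowers the weight of its
    row. The rows are kept apart in order to be compared lexicographically by [prec]. *)
Definition hrow (q : nat) (t : word) : nat :=
  \sum_(p <- t | p.1 == q :> nat) (n - p.2)%N.

Definition le_h (t' t : word) := forall q, (hrow q t' <= hrow q t)%N.
Definition lt_h (t' t : word) :=
  le_h t' t /\ exists q, (hrow q t' < hrow q t)%N.

Lemma le_lt_h t1 t2 t3 : le_h t1 t2 -> lt_h t2 t3 -> lt_h t1 t3.
Proof.
move=> le12 [le23 [q lt23]]; split; last by exists q; apply: leq_ltn_trans lt23.
by move=> q'; apply: leq_trans (le23 q').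
Qed.

Lemma hrow_cons q p t :
  hrow q (p :: t) = ((if p.1 == q :> nat then n - p.2 else 0) + hrow q t)%N.
Proof. by rewrite /hrow big_cons; case: ifP. Qed.

Lemma hrow_cat q u t : hrow q (u ++ t) = (hrow q u + hrow q t)%N.
Proof. by rewrite /hrow big_cat. Qed.

Lemma loww_rows (p : 'I_n * 'I_n) t : loww (p :: t) -> rows p.1 t.
Proof. by case/loww_cons => _ pt _; apply/allP => q /pt. Qed.

Lemma loww_consI (p : 'I_n * 'I_n) t : (p.2 < p.1)%N -> rows p.1 t -> loww t -> loww (p :: t).
Proof.
move=> pp /allP pt /andP [at_ st]; rewrite /loww /= pp at_ /=.
by rewrite (path_sortedE (@lowrow_trans n)) st andbT; apply/allP => q /pt.
Qed.

Lemma rows_trans k m t : (k <= m)%N -> rows m t -> rows k t.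
Proof. by move=> km /allP h; apply/allP => p /h /(leq_trans km). Qed.

(* [E_ab] acts on the lowering operators as a derivation sending [E_(p,a)] to
   [- E_(p,b)]; since [a < b] this decreases [hrow p]. *)
Lemma raise_word k (a b : 'I_n) t : (a < b < k)%N -> loww t -> rows k t ->
  wspan E J (fun t' => [/\ loww t', rows k t', lt_h t' t & ht t' = ht1 (a, b) + ht t])
    (E a b * EW t).
Proof.
elim: t k => [|p t IHt] k /andP [ab bk] lt rt.
  by rewrite EW0 mulr1; apply/WspanJ/Jup.
have [pp _ lt'] := loww_cons lt; have rpt := loww_rows lt.
have /andP [kp rkt] : (k <= p.1)%N && rows k t := rt.
have bp : (b < p.1)%N by apply: leq_trans bk kp.
rewrite EW_cons mulrA -[E a b * _](subrK (E p.1 p.2 * E a b)) EP mulrDl.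
have -> : (b == p.1) = false by apply/negbTE; rewrite neq_ltn bp.
rewrite mulr0n sub0r; apply: wspanD.
  case: eqP => [pa|_]; last by rewrite oppr0 mul0r; apply: wspan0 J0 _.
  rewrite mulr1n mulNr -scaleN1r; apply: (wspanZ J0).
  rewrite -(EW_cons E (p.1, b)); apply: WspanWord; split.
  - by apply: loww_consI.
  - by rewrite /rows /= kp; apply: rkt.
  - split=> [q|]; first by rewrite !hrow_cons leq_add2r /= pa; case: ifP; lia.
    by exists p.1; rewrite !hrow_cons ltn_add2r /= eqxx pa; have := ltn_ord a; lia.
  - by rewrite !ht_cons /ht1 /= pa; ring.
rewrite -mulrA; have abp : (a < b < p.1)%N by rewrite ab.
have := IHt _ abp lt' rpt; apply: (wspan_mull JM) => t' [h1 h2 [h3 [q h5]] h4].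
rewrite -EW_cons; apply: WspanWord; split.
- exact: loww_consI.
- by rewrite /rows /= kp; apply: rows_trans h2.
- split=> [q'|]; first by rewrite !hrow_cons leq_add2l.
  by exists q; rewrite !hrow_cons ltn_add2l.
- by rewrite !ht_cons h4 addrCA.
Qed.

Definition wt (a : 'I_n) (t : word) : C :=
  lam a + \sum_(p <- t) ((p.1 == a)%:R - (p.2 == a)%:R).

Lemma cartan_word a t : J (E a a * EW t - wt a t *: EW t).
Proof.
elim: t => [|p t IHt].
  by rewrite EW0 mulr1 /wt big_nil addr0; apply: Jdiag.
pose c : C := (p.1 == a)%:R - (p.2 == a)%:R.
have comm : E a a * E p.1 p.2 = E p.1 p.2 * E a a + c *: E p.1 p.2.
  apply/eqP; rewrite addrC -subr_eq EP scalerBl !scaler_nat (eq_sym a).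
  by apply/eqP; case: eqP => [->|_]; case: eqP => [->|_].
have wtE : wt a (p :: t) = wt a t + c by rewrite /wt big_cons addrCA addrC.
have -> : E a a * EW (p :: t) - wt a (p :: t) *: EW (p :: t) =
   E p.1 p.2 * (E a a * EW t - wt a t *: EW t).
  by rewrite wtE EW_cons; apply: weight_shift comm.
exact: JM.
Qed.

(** Normal form relative to gl_k: lowering letters of gl_k, then an outer part in the rows outside
    gl_k, on which the comparisons are made. *)
Definition split_word k (w : word) (P : word -> Prop) :=
  exists u t', [/\ w = u ++ t', all (cornl k) u, loww u, loww t' & rows k t' /\ P t'].

(* Lowering letters by rows, then Cartan letters, then raising letters. *)
Definition rk (p : 'I_n * 'I_n) : nat :=
  if (p.2 < p.1)%N then p.1 : nat else if p.2 == p.1 then n else n.+1.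

Lemma rk_low s : sorted (rkle rk) s -> all (fun p : 'I_n * 'I_n => p.2 < p.1)%N s ->
  loww s.
Proof.
move=> ss ls; rewrite /loww ls /=.
apply: (sub_in_sorted (P := fun p : 'I_n * 'I_n => (p.2 < p.1)%N)) ss; last first.
  by [].
by move=> p q; rewrite !unfold_in /rkle /lowrow /rk => -> ->.
Qed.

Lemma sorted_rcons_rk s p : sorted (rkle rk) (rcons s p) ->
  sorted (rkle rk) s /\ forall q, q \in s -> (rk q <= rk p)%N.
Proof.
have rkT : transitive (rkle rk) by move=> a b c; apply: leq_trans.
rewrite -cats1 (sorted_pairwise rkT) pairwise_cat /= => /and3P [h1 h2 _].
split; first by rewrite (sorted_pairwise rkT).
by move=> q qs; move/allrelP: h1; apply; rewrite ?inE.
Qed.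

Lemma rk_ltn p : (rk p < n)%N -> (p.2 < p.1)%N.
Proof. by rewrite /rk; case: ifP => // _; case: ifP; rewrite ?ltnn // ltnNge leqnSn. Qed.

Lemma ht_rcons (s : word) p : ht (rcons s p) = ht s + ht1 p.
Proof. by rewrite -cats1 ht_cat ht_cons /ht big_nil addr0. Qed.

Lemma rcons_low (s : word) p : sorted (rkle rk) (rcons s p) -> (p.2 < p.1)%N ->
  loww (rcons s p).
Proof.
move=> ss pl; apply: rk_low (ss) _; have [_ sp] := sorted_rcons_rk ss.
rewrite all_rcons pl; apply/allP => q /sp; rewrite {2}/rk pl => qp.
by apply: rk_ltn; apply: leq_ltn_trans qp (ltn_ord _).
Qed.

(** Sorting by [rk] leaves a raising letter in last place if there is one, else a Cartan letter if
    there is one. On [EW t] the former makes [t] smaller by [raise_word], the latter is a scalar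
    modulo [J], and [s] gets shorter either way. Otherwise [s] consists of lowering letters and the
    normal form is reached. *)
Lemma corner_word k s t : all (cornl k) s -> loww t -> rows k t ->
  wspan E J (fun w => split_word k w (fun t' => le_h t' t) /\ ht w = ht s + ht t)
    (EW s * EW t).
Proof.
elim: {s}(size s) {-2}s (leqnn (size s)) t => [|m IHm] s sm t Ls lt rt.
  move: sm; rewrite leqn0 size_eq0 => /eqP ->.
  rewrite EW0 mul1r; apply: WspanWord; split; last by rewrite /ht big_nil add0r.
  by exists [::], t; split=> //; split=> // q.
have := EW_sort EP (cornl_trans (k := k)) rk Ls.
apply: (wspan_bind (lin_mulr (EW t))) => [v [Lv sv vs <-]|y ->]; last first.
  by rewrite mul0r; apply: wspan0 J0 _.
have {vs sm s Ls} vm := leq_trans vs sm.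
case/lastP: v => [|v p] in Lv sv vm *.
  rewrite EW0 mul1r; apply: WspanWord; split; last by rewrite /ht big_nil add0r.
  by exists [::], t; split=> //; split=> // q.
have [sv' vp] := sorted_rcons_rk sv.
have /andP [Lp Lv'] : cornl k p && all (cornl k) v by rewrite -all_rcons.
have vm' : (size v <= m)%N by rewrite size_rcons in vm.
rewrite ht_rcons; case: (ltngtP p.2 p.1) => [pl|pu|pc].
- rewrite -EW_cat; apply: WspanWord; split; last by rewrite ht_cat ht_rcons.
  by exists (rcons v p), t; split=> //; [apply: rcons_low | split=> // q].
- have [p1k p2k] := andP Lp.
  rewrite EW_rcons -mulrA; have pk : (p.1 < p.2 < k)%N by rewrite pu.
  have := raise_word pk lt rt; apply: (wspan_mull JM) => t' [lt' rt' [tt' _] htt'].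
  apply: (wspan_sub _ (IHm v vm' t' Lv' lt' rt')) => w [[u [t2 [h1 h2 h3 h4 [h5 h6]]]] ->].
  split; last by rewrite htt' addrA -surjective_pairing.
  by exists u, t2; split=> //; split=> // q; apply: leq_trans (tt' q).
- rewrite EW_rcons -mulrA; have p12 : p.1 = p.2 by apply/val_inj.
  rewrite -p12 -[E _ _ * _](subrK (wt p.1 t *: EW t)) mulrDr -scalerAr.
  apply: wspanD; first exact/WspanJ/JM/cartan_word.
  have -> : ht1 p = 0 by rewrite /ht1 p12 subrr.
  by rewrite addr0; apply: (wspanZ J0); apply: IHm.
Qed.

Lemma low_ht_ge (s : word) : all (fun p : 'I_n * 'I_n => p.2 < p.1)%N s ->
  (size s)%:Z <= ht s.
Proof.
elim: s => [|p s IHs] /=; first by rewrite /ht big_nil.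
by case/andP=> pp /IHs; rewrite ht_cons /ht1; lia.
Qed.

(** A nonempty word in lowering letters has positive height. So a sorted [s] of height 0 is empty,
    or ends in a Cartan letter, which acts by a scalar, or in a raising letter, which makes [t]
    strictly smaller. *)
Lemma corner_central_word k s t : all (cornl k) s -> sorted (rkle rk) s ->
  ht s = 0 -> loww t -> rows k t ->
  exists c, wspan E J (fun w => split_word k w (fun t' => lt_h t' t) /\ ht w = ht t)
    (EW s * EW t - c *: EW t).
Proof.
move=> Ls ss hs lt rt; elim/last_ind: s => [|s p IHs] in Ls ss hs *.
  by exists 1; rewrite EW0 mul1r scale1r subrr; apply: wspan0 J0 _.
have [ss' sp] := sorted_rcons_rk ss.
have /andP [Lp Ls'] : cornl k p && all (cornl k) s by rewrite -all_rcons.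
have [p1k p2k] := andP Lp.
case: (ltngtP p.2 p.1) => [pl|pu|pc].
- have /andP [/low_ht_ge] := rcons_low ss pl.
  by rewrite hs size_rcons.
- exists 0; rewrite scale0r subr0 EW_rcons -mulrA.
  have pk : (p.1 < p.2 < k)%N by rewrite pu.
  have := raise_word pk lt rt; apply: (wspan_mull JM) => t' [lt' rt' tt' htt'].
  apply: (wspan_sub _ (corner_word Ls' lt' rt')) => w [[u [t2 [h1 h2 h3 h4 [h5 h6]]]] ->].
  split; last by rewrite htt' addrA -surjective_pairing -ht_rcons hs add0r.
  by exists u, t2; split=> //; split=> //; apply: le_lt_h tt'.
- have p12 : p.1 = p.2 by apply/val_inj.
  have hs' : ht s = 0 by rewrite -hs ht_rcons /ht1 p12 subrr addr0.
  have [c hc] := IHs Ls' ss' hs'; exists (wt p.1 t * c).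
  rewrite EW_rcons -mulrA -p12 -[E _ _ * _](subrK (wt p.1 t *: EW t)) mulrDr.
  rewrite -scalerAr -addrA -scalerA -scalerBr.
  by apply: wspanD; [exact/WspanJ/JM/cartan_word | apply: (wspanZ J0)].
Qed.

End Triangular.

(** * The centers of the corners act triangularly on words *)

Section Corner.
Variables (C : numFieldType) (n : nat) (U : algType C) (E : 'I_n -> 'I_n -> U).
Local Notation word := (seq ('I_n * 'I_n)).
Local Notation EW := (EW E).

Definition corner (k : nat) : U -> Prop :=
  subalg_gen (fun x => exists i j : 'I_n, [/\ (i < k)%N, (j < k)%N & x = E i j]).

Definition ccenter k x := corner k x /\ forall y, corner k y -> x * y = y * x.

Lemma corner_span k x : corner k x -> pspan E (all (cornl k)) x.
Proof.
elim=> [{}x [i [j [ik jk ->]]]||c {}x y _ hx _ hy|{}x y _ hx _ hy].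
- have -> : E i j = EW [:: (i, j)] by rewrite EW_cons EW0 mulr1.
  by apply: WspanWord; rewrite /= /cornl /= ik jk.
- by rewrite -(EW0 E); apply: WspanWord.
- exact: WspanLin.
- move: hx; apply: (wspan_bind (lin_mulr y)) => [w hw|z ->]; last first.
    by rewrite mul0r; apply: wspan0 (zeroU0 _) _.
  by apply: (wspan_mulW (@zeroUM _ _) _ hy) => w' hw'; rewrite all_cat hw.
Qed.

Lemma corner_EW k w : all (cornl k) w -> corner k (EW w).
Proof.
elim: w => [|[i j] w IHw] /=; first by rewrite EW0 => _; apply: Subalg1.
case/andP=> /andP [ik jk] /IHw hw; rewrite EW_cons; apply: SubalgM => //.
by apply: SubalgBase; exists i, j.
Qed.

Lemma subalg_gen_comm (G : U -> Prop) y x :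
  (forall z, G z -> y * z = z * y) -> subalg_gen G x -> y * x = x * y.
Proof.
move=> yG; elim=> [z /yG||c a b _ ha _ hb|a b _ ha _ hb] //.
- by rewrite mulr1 mul1r.
- by rewrite mulrDr mulrDl -scalerAr -scalerAl ha hb.
- by rewrite mulrA ha -[a * y * b]mulrA hb mulrA.
Qed.

Lemma subalg_genS (G G' : U -> Prop) x :
  (forall z, G z -> subalg_gen G' z) -> subalg_gen G x -> subalg_gen G' x.
Proof.
move=> GG; elim=> [z /GG||c a b _ ha _ hb|a b _ ha _ hb] //.
- exact: Subalg1.
- exact: SubalgP.
- exact: SubalgM.
Qed.

Lemma corner_leq k m x : (k <= m)%N -> corner k x -> corner m x.
Proof.
move=> km; apply: subalg_genS => z [i [j [ik jk ->]]]; apply: SubalgBase.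
by exists i, j; rewrite !(leq_trans _ km).
Qed.

Hypothesis EP : forall i j k l,
  E i j * E k l - E k l * E i j = E i l *+ (j == k) - E k j *+ (l == i).

Lemma brZr c (a b : U) : br a (c *: b) = c *: br a b.
Proof. by rewrite /br -scalerAl -scalerAr scalerBr. Qed.

Definition Hgl : U := \sum_(a < n) (a : nat)%:R *: E a a.

Lemma br_Hgl_E i j : br Hgl (E i j) = (ht1 (i, j))%:~R *: E i j.
Proof.
rewrite /Hgl br_suml.
have -> : \sum_(a < n) br ((a : nat)%:R *: E a a) (E i j) =
   \sum_(a < n) ((i : nat)%:R *: E i j *+ (i == a) - (j : nat)%:R *: E i j *+ (j == a)).
  apply: eq_bigr => a _; rewrite /br -scalerAl -scalerAr -scalerBr EP.
  rewrite scalerBr (eq_sym a).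
  by case: eqP => [->|_]; case: eqP => [->|_]; rewrite ?mulr0n ?scaler0 ?mulr1n.
rewrite sumrB !(sum_delta (fun=> _)) // -scalerBl.
by rewrite /ht1 /= rmorphB.
Qed.

Lemma br_Hgl_EW w : br Hgl (EW w) = (ht w)%:~R *: EW w.
Proof.
elim: w => [|p w IHw].
  by rewrite EW0 /ht big_nil scale0r /br mulr1 mul1r subrr.
rewrite EW_cons brMr IHw br_Hgl_E -surjective_pairing.
by rewrite -scalerAl -scalerAr -scalerDl -rmorphD -ht_cons.
Qed.

Lemma pspan_ht P x : pspan E P x ->
  exists hs : seq int, pspan E (fun w => P w /\ (ht w \in hs)) x.
Proof.
elim=> [w Pw|y ->|c y z _ [hs1 h1] _ [hs2 h2]].
- by exists [:: ht w]; apply: WspanWord; rewrite mem_head.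
- by exists [::]; apply: WspanJ.
- exists (hs1 ++ hs2); apply: WspanLin.
    by apply: wspan_sub h1 => w [Pw hw]; rewrite mem_cat hw.
  by apply: wspan_sub h2 => w [Pw hw]; rewrite mem_cat hw orbT.
Qed.

(* [1 - ad Hgl / h] fixes [x] and kills the words of height [h]. *)
Lemma pspan_ht0 P x : pspan E P x -> br Hgl x = 0 ->
  pspan E (fun w => P w /\ ht w = 0) x.
Proof.
move=> /pspan_ht [hs hx] Hx.
have {hx} : pspan E (fun w => P w /\ (ht w = 0 \/ ht w \in hs)) x.
  by apply: wspan_sub hx => w [Pw hw]; split=> //; right.
elim: hs => [|h hs IHs] hx.
  by apply: wspan_sub hx => w [Pw []].
apply: IHs; have [h0|h0] := eqVneq h 0.
  apply: wspan_sub hx => w [Pw [->|]]; first by split=> //; left.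
  by rewrite inE h0 => /predU1P [->|hw]; split=> //; [left | right].
have hC : h%:~R != 0 :> C by rewrite intr_eq0.
have -> : x = x - (h%:~R)^-1 *: br Hgl x by rewrite Hx scaler0 subr0.
move: hx; apply: (@wspan_bind _ _ _ _ _ _ _ _ (fun y => y - (h%:~R)^-1 *: br Hgl y)).
- move=> c y z; rewrite brDr brZr scalerDr opprD addrACA (scalerBr c y) !scalerA.
  by rewrite mulrC.
- move=> w [Pw hw]; rewrite br_Hgl_EW scalerA -{1}[EW w]scale1r -scalerBl.
  have [wh|wh] := eqVneq (ht w) h.
    rewrite wh mulVf // subrr scale0r; exact: wspan0 (zeroU0 _) _.
  apply: (wspanZ (zeroU0 _)); apply: WspanWord; split=> //.
  by case: hw => [|]; [left|rewrite inE (negPf wh); right].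
- move=> y ->; rewrite /br mulr0 mul0r subrr scaler0 subrr.
  exact: wspan0 (zeroU0 _) _.
Qed.

(** For [a < k] the Cartan element lies in gl_k, and for [a >= k] it commutes with all of gl_k; thus
    one grading element of gl_n serves for every corner. *)
Lemma ccenter_Hgl k x : ccenter k x -> br Hgl x = 0.
Proof.
case=> xk xc; rewrite /Hgl br_suml big1 // => a _.
suff : E a a * x = x * E a a.
  by move=> h; rewrite /br -scalerAl -scalerAr h subrr.
have [ak|ka] := ltnP a k.
  by rewrite xc //; apply: SubalgBase; exists a, a.
apply: subalg_gen_comm xk => z [i [j [ik jk ->]]].
apply: br0_comm; rewrite /br EP.
have -> : (a == i) = false.
  by apply/negbTE; rewrite -val_eqE neq_ltn (leq_trans ik ka) orbT.
have -> : (j == a) = false.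
  by apply/negbTE; rewrite -val_eqE neq_ltn (leq_trans jk ka).
by rewrite subrr.
Qed.

Variables (lam : 'I_n -> C) (J : U -> Prop).
Hypothesis J0 : J 0.
Hypothesis JM : forall a x, J x -> J (a * x).
Hypothesis Jup : forall i j : 'I_n, (i < j)%N -> J (E i j).
Hypothesis Jdiag : forall i, J (E i i - (lam i)%:A).

Lemma loww_split k (w : word) : loww w -> exists u t,
  [/\ w = u ++ t, loww u /\ all (cornl k) u, loww t & rows k t].
Proof.
elim: w => [_|p w IHw lw]; first by exists [::], [::].
have [pp _ lw'] := loww_cons lw; have rw := loww_rows lw.
have [pk|kp] := ltnP p.1 k; last first.
  exists [::], (p :: w); split=> //.
  by rewrite /rows /= kp; apply: rows_trans rw.
have [u [t [wE [lu Lu] lt rt]]] := IHw lw'; exists (p :: u), t; split=> //.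
- by rewrite wE.
- split; last by rewrite /= Lu /cornl pk (ltn_trans pp).
  apply: loww_consI => //; apply/allP => q qu.
  by move/allP: rw; apply; rewrite wE mem_cat qu.
Qed.

Lemma loww_cat k (u t : word) : loww u -> all (cornl k) u -> loww t -> rows k t ->
  loww (u ++ t).
Proof.
move=> lu Lu lt rt; elim: u => [//|p u IHu] in lu Lu *.
have [pp _ lu'] := loww_cons lu; have [/andP [pk _] Lu'] := andP Lu.
apply: loww_consI => //; last exact: IHu.
apply/allP => q; rewrite mem_cat => /orP [qu|qt].
  by move/allP: (loww_rows lu); apply.
by apply: leq_trans (ltnW pk) _; move/allP: rt; apply.
Qed.

Lemma hrow_corner k q (u : word) : all (cornl k) u -> (k <= q)%N -> hrow q u = 0%N.
Proof.
move=> /allP Lu kq; rewrite /hrow big_seq_cond big_pred0 // => p.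
by apply/negP => /andP [/Lu /andP [pk _] /eqP pq]; rewrite pq ltnNge kq in pk.
Qed.

Lemma hrow_rows k q (t : word) : rows k t -> (q < k)%N -> hrow q t = 0%N.
Proof.
move=> /allP rt kq; rewrite /hrow big_seq_cond big_pred0 // => p.
by apply/negP => /andP [/rt kp /eqP pq]; rewrite pq leqNgt kq in kp.
Qed.

(** Lexicographic comparison from the last row down. A central element of U(gl_k), beyond its scalar
    part, may change the letters in gl_k arbitrarily but lowers the rows of index at least [k]; so
    one order suits all corners. *)
Definition prec (w' w : word) := exists q,
  (hrow q w' < hrow q w)%N /\ forall q', (q < q')%N -> hrow q' w' = hrow q' w.

Lemma prec_trans w1 w2 w3 : prec w1 w2 -> prec w2 w3 -> prec w1 w3.
Proof.
move=> [p [p1 p2]] [q [q1 q2]]; exists (maxn p q); split=> [|q'].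
  by case: (ltngtP p q) => [pq|qp|pq]; [rewrite p2|rewrite -q2|move: q1; rewrite -pq; lia].
by rewrite gtn_max => /andP [pq qq]; rewrite p2 // q2.
Qed.

Lemma prec_irr w : ~ prec w w.
Proof. by case=> q []; rewrite ltnn. Qed.

Lemma prec_cat k (u u' t t' : word) : all (cornl k) u -> all (cornl k) u' ->
  rows k t -> lt_h t' t -> prec (u' ++ t') (u ++ t).
Proof.
move=> Lu Lu' rt [tt' [q0 q0P]].
(* Rows of index at least [n] are empty, so there is a last row in which [t'] is smaller. *)
have bnd q : (hrow q t' < hrow q t)%N -> (q <= n)%N.
  apply: contraTT; rewrite -ltnNge -leqNgt => nq.
  rewrite [hrow q t]big_pred0 // => p; apply/negbTE.
  by rewrite neq_ltn (ltn_trans (ltn_ord _) nq).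
case: (ex_maxnP (ex_intro _ q0 q0P) bnd) => q qP qmax.
have kq : (k <= q)%N.
  by rewrite leqNgt; apply/negP => /(hrow_rows rt) q00; rewrite q00 in qP.
exists q; rewrite !hrow_cat !(hrow_corner Lu, hrow_corner Lu') // !add0n.
split=> // q' qq'; rewrite !hrow_cat.
have kq' := leq_trans kq (ltnW qq').
rewrite !(hrow_corner Lu, hrow_corner Lu') // !add0n.
apply/eqP; rewrite eqn_leq tt' leqNgt; apply/negP => /qmax.
by rewrite leqNgt qq'.
Qed.

Definition lower_words w := fun w' : word => [/\ loww w', ht w' = ht w & prec w' w].

(** With [w = u ++ t], [u] in gl_k and [t] outside, the central [x] passes through [u]. It is a
    combination of sorted words of height 0 in gl_k, each of them a scalar on [t] modulo smaller
    words. *)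
Lemma ccenter_lower k x w : ccenter k x -> loww w ->
  exists c, wspan E J (lower_words w) (x * EW w - c *: EW w).
Proof.
move=> xc lw; have [u [t [-> [lu Lu] lt rt]]] := loww_split k lw.
have := pspan_ht0 (corner_span xc.1) (ccenter_Hgl xc).
have xu : x * EW u = EW u * x by apply/xc.2/corner_EW.
rewrite EW_cat mulrA xu => hx.
have {hx} [c hc] : exists c, wspan E J
    (fun v => split_word k v (fun t' => lt_h t' t) /\ ht v = ht t)
    (x * EW t - c *: EW t).
  have {hx} : pspan E (fun s => [/\ all (cornl k) s, sorted (rkle (@rk n)) s & ht s = 0]) x.
    apply: wspan_trans hx => v [Lv hv].
    have := EW_sort EP (@cornl_trans n k) (@rk n) Lv.
    by apply: wspan_sub => s [h1 h2 _ h3]; rewrite h3.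
  elim=> [s [Ls ss hs]|y ->|a y z _ [c1 h1] _ [c2 h2]].
  - exact: (corner_central_word EP J0 JM Jup Jdiag Ls ss hs lt rt).
  - by exists 0; rewrite mul0r scale0r subrr; apply: wspan0 J0 _.
  - exists (a * c1 + c2).
    have -> : (a *: y + z) * EW t - (a * c1 + c2) *: EW t =
        a *: (y * EW t - c1 *: EW t) + (z * EW t - c2 *: EW t).
      by rewrite mulrDl scalerDl scalerBr scalerA scalerAl opprD addrACA.
    exact: WspanLin.
exists c.
rewrite -mulrA scalerAr -mulrBr; move: hc; apply: (wspan_mull JM).
move=> v [[u1 [t1 [-> Lu1 lu1 lt1 [rt1 tt1]]]] hv].
(* The rows of [u ++ u1] need not increase. It is sorted within the lowering letters of gl_k, which
   affects neither [t1] nor the comparison by [prec]. *)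
rewrite -EW_cat catA EW_cat.
pose L := [pred p : 'I_n * 'I_n | cornl k p && (p.2 < p.1)%N].
have LT i j l : L (i, j) -> L (j, l) -> L (i, l).
  by rewrite /= /cornl /=; lia.
have LL : all L (u ++ u1).
  have aL v' : loww v' -> all (cornl k) v' -> all L v'.
    by move=> /andP [a1 _] a2; rewrite all_predI a2.
  by rewrite all_cat !aL.
have := EW_sort EP LT (fun p => p.1 : nat) LL.
apply: (wspan_bind (lin_mulr (EW t1))) => [v' [Lv' sv' _ hv']|y ->]; last first.
  by rewrite mul0r; apply: wspan0 J0 _.
move: Lv'; rewrite all_predI => /andP [Lv' lv'].
rewrite -EW_cat; apply: WspanWord; split.
- by apply: (loww_cat (k := k)); rewrite // /loww lv'.
- by rewrite !ht_cat hv' ht_cat -addrA -(ht_cat u1) hv.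
- exact: (prec_cat (k := k)).
Qed.

End Corner.

(** * Eigenvalues of the generators *)

Section PowerTrace.
Variables (C : numFieldType) (n : nat) (U : algType C) (E : 'I_n -> 'I_n -> U).
Variable k : nat.
Hypothesis kn : (k <= n)%N.

Fixpoint pw (i : nat) (a b : 'I_n) : U :=
  if i is i'.+1 then \sum_(c < n | (c < k)%N) E a c * pw i' c b else (a == b)%:R.

Lemma pwS i a b : pw i.+1 a b = \sum_(c < n | (c < k)%N) E a c * pw i c b.
Proof. by []. Qed.

Definition path_prod m (g : nat -> 'I_n) b : U :=
  (\prod_(t < m) E (g t) (g t.+1)) * E (g m) b.

Lemma path_prodS m g b :
  path_prod m.+1 g b = E (g 0) (g 1%N) * path_prod m (fun t => g t.+1) b.
Proof. by rewrite /path_prod big_ord_recl mulrA. Qed.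

Lemma eq_path_prod m (g h : nat -> 'I_n) b : (forall t, (t <= m)%N -> g t = h t) ->
  path_prod m g b = path_prod m h b.
Proof.
move=> gh; rewrite /path_prod gh //; congr (_ * _); apply: eq_bigr => t _.
by rewrite !gh // ltnW.
Qed.

Definition fcons m (a : 'I_n) (r : {ffun 'I_m -> 'I_n}) : {ffun 'I_m.+1 -> 'I_n} :=
  [ffun t => if unlift ord0 t is Some t' then r t' else a].

Lemma fcons0 m a (r : {ffun 'I_m -> 'I_n}) : fcons a r ord0 = a.
Proof. by rewrite ffunE unlift_none. Qed.

Lemma fconsS m a (r : {ffun 'I_m -> 'I_n}) t : fcons a r (lift ord0 t) = r t.
Proof. by rewrite ffunE liftK. Qed.

Definition inpath m (r : {ffun 'I_m -> 'I_n}) := [forall t, (r t < k)%N].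

Lemma inpath_fcons m (a : 'I_n) (r : {ffun 'I_m -> 'I_n}) : (a < k)%N ->
  inpath (fcons a r) = inpath r.
Proof.
move=> ak; apply/forallP/forallP => h t; first by rewrite -(fconsS a) h.
by case: (unliftP ord0 t) => [t'|] ->; rewrite ?fconsS ?fcons0.
Qed.

Lemma pw_paths m (a b : 'I_n) : (a < k)%N -> (b < k)%N -> pw m.+1 a b =
  \sum_(r : {ffun 'I_m.+1 -> 'I_n} | (r ord0 == a) && inpath r)
     path_prod m (fun t => r (inord t)) b.
Proof.
elim: m a => [|m IHm] a ak bk.
  rewrite pwS (big_pred1 [ffun=> a]); last first.
    move=> r /=; apply/andP/eqP => [[/eqP ra _]|->].
      by apply/ffunP => t; rewrite ffunE (ord1 t).
    by split; [rewrite ffunE|apply/forallP => t; rewrite ffunE].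
  rewrite /path_prod big_ord0 mul1r ffunE (bigD1 b) //= eqxx mulr1.
  by rewrite big1 ?addr0 // => c /andP [_ cb]; rewrite (negPf cb) mulr0.
rewrite (reindex_onto (fcons a) (fun r => [ffun t => r (lift ord0 t)])); last first.
  move=> r /andP [/eqP ra _]; apply/ffunP => t.
  by case: (unliftP ord0 t) => [t'|] ->; rewrite ?fconsS ?fcons0 ?ffunE.
rewrite (eq_bigl (@inpath m.+1)); last first.
  move=> r /=; rewrite fcons0 eqxx inpath_fcons //= andbC.
  by have -> : [ffun t => fcons a r (lift ord0 t)] == r
    by apply/eqP/ffunP => t; rewrite ffunE fconsS.
rewrite pwS (partition_big (fun r : {ffun _} => r ord0) (fun c : 'I_n => (c < k)%N));
  last by move=> r /forallP.
apply: eq_bigr => c ck; rewrite IHm // big_distrr /=.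
apply: eq_big => [r|r /andP [/eqP rc _]]; first by rewrite andbC.
have i0 : inord 0 = ord0 :> 'I_m.+2 by apply/val_inj; rewrite /= inordK.
have iS t : (t <= m)%N -> inord t.+1 = lift ord0 (inord t) :> 'I_m.+2.
  by move=> tm; apply/val_inj; rewrite /= /bump /= !inordK.
have i0' : inord 0 = ord0 :> 'I_m.+1 by apply/val_inj; rewrite /= inordK.
rewrite path_prodS i0 fcons0 iS // fconsS i0' rc; congr (_ * _).
by apply: eq_path_prod => t tm; rewrite iS // fconsS.
Qed.

Definition pw_tr i := \sum_(a < n | (a < k)%N) pw i a a.

Lemma pw_tr_cycles m : pw_tr m.+1 =
  \sum_(r : {ffun 'I_m.+1 -> 'I_n} | [forall t, (r t < k)%N])
    \prod_(t < m.+1) E (r t) (r (ordS t)).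
Proof.
rewrite /pw_tr (partition_big (fun r : {ffun _} => r ord0)
  (fun a : 'I_n => (a < k)%N)); last by move=> r /forallP.
apply: eq_bigr => a ak; rewrite pw_paths //.
apply: eq_big => [r|r /andP [/eqP ra _]]; first by rewrite andbC.
rewrite big_ord_recr /= /path_prod; congr (_ * _); last first.
  congr (E (r _) _); first by apply/val_inj; rewrite /= inordK.
  by rewrite -ra; congr (r _); apply/val_inj; rewrite /= modnn.
apply: eq_bigr => t _; congr (E (r _) (r _)); apply/val_inj => /=.
  by rewrite inordK // ltnS ltnW.
by rewrite inordK ?ltnS // modn_small // ltnS.
Qed.

Hypothesis EP : forall i j k l,
  E i j * E k l - E k l * E i j = E i l *+ (j == k) - E k j *+ (l == i).

(** Under the adjoint action of gl_k the entries of a power of the matrix of generators transform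
    like the generators, since the terms in the inner summation index cancel. Hence the trace is
    central. *)
Lemma br_pw i (a b c d : 'I_n) :
  (a < k)%N -> (b < k)%N -> (c < k)%N -> (d < k)%N ->
  br (E a b) (pw i c d) = pw i a d *+ (b == c) - pw i c b *+ (d == a).
Proof.
elim: i c => [|i IHi] c ak bk ck dk.
  rewrite /= /br mulr_natr mulr_natl subrr.
  by rewrite (eq_sym c) (eq_sym d); case: (b == c); case: (a == d); rewrite subrr.
rewrite !pwS br_sumr.
have -> : \sum_(e < n | (e < k)%N) br (E a b) (E c e * pw i e d) =
  \sum_(e < n | (e < k)%N) ((E a e * pw i e d) *+ (b == c)
   - (E c b * pw i a d) *+ (a == e) + (E c e * pw i a d) *+ (b == e)
   - (E c e * pw i e b) *+ (d == a)).
  apply: eq_bigr => e ek; rewrite brMr IHi // [br _ (E c e)]EP.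
  rewrite mulrBl mulrBr !mulrnAl !mulrnAr addrA (eq_sym e).
  by case: (a =P e) => [<-|_]; rewrite ?mulr0n.
rewrite sumrB big_split /= sumrB !sumrMnl.
rewrite (sum_delta (fun=> E c b * pw i a d) ak).
by rewrite (sum_delta (fun e => E c e * pw i a d) bk) subrK.
Qed.

Lemma pw_corner i (a b : 'I_n) : (a < k)%N -> corner E k (pw i a b).
Proof.
have c0 : corner E k 0.
  by rewrite -(subrr 1) addrC -scaleN1r; apply: SubalgP; apply: Subalg1.
have cD x y : corner E k x -> corner E k y -> corner E k (x + y).
  by move=> hx hy; rewrite -[x]scale1r; apply: SubalgP.
elim: i a => [|i IHi] a ak /=.
  by case: (a == b); [apply: Subalg1 | ].
elim/big_rec: _ => // c x ck hx; apply: cD => //; apply: SubalgM; last exact: IHi.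
by apply: SubalgBase; exists a, c.
Qed.

Lemma ccenter_pw_tr i : ccenter E k (pw_tr i).
Proof.
split.
  have c0 : corner E k 0.
    by rewrite -(subrr 1) addrC -scaleN1r; apply: SubalgP; apply: Subalg1.
  rewrite /pw_tr; elim/big_rec: _ => // c x ck hx.
  by rewrite -[pw i c c]scale1r; apply: SubalgP => //; apply: pw_corner.
move=> y; apply: subalg_gen_comm => z [a [b [ak bk ->]]].
apply/esym/br0_comm; rewrite br_sumr.
have -> : \sum_(c < n | (c < k)%N) br (E a b) (pw i c c) =
  \sum_(c < n | (c < k)%N) (pw i a c *+ (b == c) - pw i c b *+ (a == c)).
  by apply: eq_bigr => c ck; rewrite br_pw // (eq_sym c).
by rewrite sumrB (sum_delta _ bk) (sum_delta (pw i ^~ b) ak) subrr.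
Qed.

Section HighestWeight.
Variables (L : U -> Prop) (w : U) (mu : nat -> C).
Hypothesis L0 : L 0.
Hypothesis LP : forall c x y, L x -> L y -> L (c *: x + y).
Hypothesis LE : forall (a b : 'I_n) x, (a < k)%N -> (b < k)%N -> L x -> L (E a b * x).
Hypothesis Lup : forall a b : 'I_n, (a < b < k)%N -> L (E a b * w).
Hypothesis Ldiag : forall a : 'I_n, (a < k)%N -> L (E a a * w - mu a *: w).

(* The eigenvalue of the [b]-th diagonal entry of the [i]-th power of the matrix of
   the [E a b], [a, b < k], on a highest weight vector of weight [mu]. *)
Fixpoint pp_tri (i b : nat) : C :=
  if i is i'.+1 then
    (mu b + (k.-1 - b)%:R) * pp_tri i' b - \sum_(b.+1 <= c < k) pp_tri i' c
  else 1.

Let LD x y : L x -> L y -> L (x + y).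
Proof. by move=> hx hy; rewrite -[x]scale1r; apply: LP. Qed.
Let LZ c x : L x -> L (c *: x).
Proof. by move=> hx; rewrite -[_ *: _]addr0; apply: LP. Qed.
Let LB x y : L x -> L y -> L (x - y).
Proof. by move=> hx hy; rewrite addrC -scaleN1r; apply: LP. Qed.
Let Lsum (I : finType) (P : pred I) F :
  (forall i, P i -> L (F i)) -> L (\sum_(i | P i) F i).
Proof. by move=> LF; elim/big_rec: _ => // i x Pi Lx; apply: LD (LF i Pi) Lx. Qed.

Let Lpw i (a b : 'I_n) x : (a < k)%N -> (b < k)%N -> L x -> L (pw i a b * x).
Proof.
move=> + bk Lx; elim: i a => [|i IHi] a ak /=.
  by case: (a == b); rewrite ?mul1r ?mul0r.
by rewrite mulr_suml; apply: Lsum => c ck; rewrite -mulrA; apply: LE (IHi _ ck).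
Qed.

Lemma pp_triS i (b : 'I_n) : (b < k)%N -> pp_tri i.+1 b =
  mu b * pp_tri i b + \sum_(c < n | (b < c < k)%N) (pp_tri i b - pp_tri i c).
Proof.
move=> bk; rewrite /= sumrB mulrDl addrA; congr (_ + _ - _).
  rewrite sumr_const mulr_natl; congr (_ *+ _).
  have -> : (k.-1 - b = \sum_(b.+1 <= c < k) 1)%N.
    by rewrite sum_nat_const_nat muln1; lia.
  rewrite big_geq_mkord (big_ord_widen_cond _ (fun c => b < c)%N (fun=> 1%N) kn).
  by rewrite sum1_card.
by rewrite big_geq_mkord (big_ord_widen_cond _ (fun c => b < c)%N (pp_tri i) kn).
Qed.

(** The next power is the sum of the [E a c * pw i c b]. For [c < b] the second factor kills [w]
    modulo [L]; for [c = b] it is a scalar; for [c > b] the raising [E a c] kills [w], and its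
    bracket with [pw i c b] leaves [pw i a b], minus [pw i c c] if [a = b]. [G c] is the resulting
    contribution of [c]. *)
Lemma pw_hw i (a b : 'I_n) : (a <= b)%N -> (b < k)%N ->
  L (pw i a b * w - (pp_tri i b *+ (a == b)) *: w).
Proof.
elim: i a b => [|i IHi] a b ab bk.
  by rewrite /=; case: (a == b); rewrite ?mul1r ?scale1r ?mul0r ?scale0r subrr.
have ak := leq_ltn_trans ab bk.
pose G (c : 'I_n) : C := if (c < b)%N then 0
  else (if c == b then mu b * pp_tri i b else pp_tri i b - pp_tri i c) *+ (a == b).
have -> : pp_tri i.+1 b *+ (a == b) = \sum_(c < n | (c < k)%N) G c.
  rewrite pp_triS // [RHS](bigID (fun c : 'I_n => (c < b)%N)) /=.
  rewrite [X in _ = X + _]big1; last by move=> c /andP [_ cb]; rewrite /G cb.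
  rewrite add0r [RHS](bigD1 b) /=; last by rewrite bk ltnn.
  rewrite {1}/G ltnn eqxx mulrnDl -sumrMnl; congr (_ + _).
  apply: eq_big => [c|c /andP [bc _]].
    by rewrite -val_eqE /=; lia.
  rewrite /G ltnNge (ltnW bc) /= ifF //.
  by apply/negbTE; rewrite -val_eqE neq_ltn bc orbT.
rewrite pwS mulr_suml scaler_suml -sumrB; apply: Lsum => c ck.
rewrite /G -mulrA; case: (ltngtP c b) => [cb|bc|/val_inj cb].
- have := IHi c b (ltnW cb) bk.
  have -> : (c == b) = false by apply/negbTE; rewrite -val_eqE neq_ltn cb.
  by rewrite mulr0n !scale0r !subr0; apply: LE.
- have -> : (c == b) = false by apply/negbTE; rewrite -val_eqE neq_ltn bc orbT.
  have acw : L (pw i c b * (E a c * w)).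
    by apply: Lpw => //; apply: Lup; rewrite (leq_ltn_trans ab bc).
  have := br_pw i ak ck ck bk; rewrite eqxx mulr1n (eq_sym b) => brE.
  have -> : E a c * (pw i c b * w) -
     ((pp_tri i b - pp_tri i c) *+ (a == b)) *: w =
     (pw i a b * w - (pp_tri i b *+ (a == b)) *: w) -
     (pw i c c * w - (pp_tri i c *+ (c == c)) *: w) *+ (a == b)
     + pw i c b * (E a c * w).
    rewrite mulrA -[E a c * _](subrK (pw i c b * E a c)) -/(br _ _) brE.
    rewrite eqxx mulr1n mulrDl mulrBl -mulrA addrAC; congr (_ + _).
    rewrite mulrnAl; case: (a == b); rewrite ?mulr1n ?mulr0n ?scale0r ?subr0 //.
    by rewrite scalerBl !opprB addrACA [RHS]addrACA [- _ + - _]addrC.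
  apply: LD acw; apply: LB; first exact: IHi.
  by case: (a == b); [exact: IHi|].
- rewrite cb eqxx; have hb := IHi b b (leqnn b) bk; rewrite eqxx mulr1n in hb.
  have -> : E a b * (pw i b b * w) - ((mu b * pp_tri i b) *+ (a == b)) *: w =
     E a b * (pw i b b * w - pp_tri i b *: w) +
     pp_tri i b *: (E a b * w - (mu b *+ (a == b)) *: w).
    by rewrite mulrBr scalerBr -scalerAr subrKA scalerA mulrnAr mulrC.
  apply: LD; first exact: LE.
  apply: LZ; have [->|nab] := eqVneq a b; first exact: Ldiag.
  rewrite mulr0n scale0r subr0; apply: Lup; rewrite bk andbT.
  by rewrite ltn_neqAle ab andbT.
Qed.

(** The tail sums satisfy [ppS] with [y = mu b - b + k.-1]: the next diagonal entry at [b] is [y]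
    times the difference of the sums from [b] and from [b.+1], minus the latter. *)
Lemma sum_pp_tri d b i : (b + d = k)%N -> \sum_(b <= c < k) pp_tri i c =
  pp [seq mu c - c%:R + (k.-1)%:R | c <- iota b d] i.
Proof.
elim: d b i => [|d IHd] b i; first by rewrite addn0 => ->; rewrite big_geq.
rewrite addnS -addSn => bd; have bk : (b < k)%N by rewrite -bd ltnS leq_addr.
rewrite [map _ _]/=; elim: i => [|i IHi].
  by rewrite big_ltn // IHd //= addrC.
rewrite ppS -IHi -!IHd // (big_ltn bk) [pp_tri i.+1 b]/=.
rewrite [in RHS](big_ltn bk) addrK.
have -> : (k.-1 - b)%:R = - b%:R + (k.-1)%:R :> C.
  by rewrite natrB 1?addrC // -ltnS prednK //; lia.
by rewrite -!addrA; ring.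
Qed.

Lemma pw_tr_hw i :
  L (pw_tr i * w - pp [seq mu c - c%:R + (k.-1)%:R | c <- iota 0 k] i *: w).
Proof.
rewrite -sum_pp_tri // /pw_tr mulr_suml big_mkord (big_ord_widen _ (pp_tri i) kn).
rewrite scaler_suml -sumrB; apply: Lsum => b bk.
by have := pw_hw i (leqnn b) bk; rewrite eqxx mulr1n.
Qed.

End HighestWeight.
End PowerTrace.

(** * Characters occurring in a module with triangular action *)

Section Support.
Variables (C : numFieldType) (n : nat) (U : algType C) (E : 'I_n -> 'I_n -> U).
Local Notation word := (seq ('I_n * 'I_n)).
Local Notation EW := (EW E).
Hypothesis EP : forall i j k l,
  E i j * E k l - E k l * E i j = E i l *+ (j == k) - E k j *+ (l == i).
Hypothesis full : forall x, corner E n x.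
Variables (lam : nat -> C) (J : U -> Prop).
Hypothesis J0 : J 0.
Hypothesis JB : forall x y, J x -> J y -> J (x - y).
Hypothesis JM : forall a x, J x -> J (a * x).
Hypothesis Jup : forall i j : 'I_n, (i < j)%N -> J (E i j).
Hypothesis Jdiag : forall i : 'I_n, J (E i i - (lam i)%:A).
Variable phi : word -> U -> C.
Hypothesis phiP : forall w c x y, phi w (c *: x + y) = c * phi w x + phi w y.
Hypothesis phiJ : forall w x, J x -> phi w x = 0.
Hypothesis phiE : forall w w', loww w' -> phi w (EW w') = (perm_eq w w')%:R.

Let JD x y : J x -> J y -> J (x + y).
Proof.
move=> hx hy; have hN : J (- y) by rewrite -sub0r; apply: JB.
by rewrite -[y]opprK; apply: JB.
Qed.
Let JZ c x : J x -> J (c *: x).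
Proof. by rewrite -mulr_algl; apply: JM. Qed.

Let phi0 w : phi w 0 = 0. Proof. exact: phiJ. Qed.
Let phiZ w c x : phi w (c *: x) = c * phi w x.
Proof. by rewrite -[c *: x]addr0 phiP phi0 addr0. Qed.
Let phiB w x y : phi w (x - y) = phi w x - phi w y.
Proof. by rewrite addrC -scaleN1r phiP mulN1r addrC. Qed.

Lemma phi_span w (P : word -> Prop) x :
  (forall w', P w' -> loww w' /\ ~~ perm_eq w w') -> wspan E J P x -> phi w x = 0.
Proof.
move=> Pw; elim=> [w' /Pw [lw' pw]|y /phiJ|c y z _ hy _ hz] //.
  by rewrite phiE // (negPf pw).
by rewrite phiP hy hz mulr0 addr0.
Qed.

Lemma prec_perm (w w' : word) : prec w' w -> ~~ perm_eq w w'.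
Proof.
case=> q [qq _]; apply/negP => ww'; move: qq.
by rewrite /hrow (perm_big _ ww') ltnn.
Qed.

Definition gt (x : U) :=
  subalg_gen (fun x => exists k, (1 <= k <= n)%N /\ ccenter E k x) x.
(** The diagonal coefficient of [x] at [w], a character of Gamma because the action is
    triangular. *)
Definition chi w x := phi w (x * EW w).

Lemma gtB x y : gt x -> gt y -> gt (x - y).
Proof. by move=> hx hy; rewrite addrC -scaleN1r; apply: SubalgP. Qed.
Lemma gt0 : gt 0.
Proof. by rewrite -(subrr 1); apply: gtB; apply: Subalg1. Qed.
Lemma gtD x y : gt x -> gt y -> gt (x + y).
Proof. by move=> hx hy; rewrite -[x]scale1r; apply: SubalgP. Qed.
Lemma gtZ c x : gt x -> gt (c *: x).
Proof. by move=> hx; rewrite -[_ *: _]addr0; apply: SubalgP gt0. Qed.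
Lemma gtX x m : gt x -> gt (x ^+ m).
Proof.
move=> hx; elim: m => [|m IHm]; first exact: Subalg1.
by rewrite exprS; apply: SubalgM.
Qed.

Lemma gt_comm x y : gt x -> gt y -> x * y = y * x.
Proof.
move=> hx; apply: subalg_gen_comm => z [k [_ [zk zc]]].
apply/esym; move: hx; apply: subalg_gen_comm => t [m [_ [tm tc]]].
have [km|mk] := leqP k m; last by apply: zc; apply: corner_leq (ltnW mk) tm.
by apply/esym/tc; apply: corner_leq km zk.
Qed.

Lemma lower_words_trans (w w1 w2 : word) :
  lower_words w w1 -> lower_words w1 w2 -> lower_words w w2.
Proof.
move=> [h1 h2 h3] [g1 g2 g3]; split; rewrite // ?g2 //.
exact: prec_trans g3 h3.
Qed.

Lemma phi_lower w x : wspan E J (lower_words w) x -> phi w x = 0.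
Proof. by apply: phi_span => w' [lw _ /prec_perm]. Qed.

Let triangular x := forall w, loww w ->
  exists c, wspan E J (lower_words w) (x * EW w - c *: EW w).

Let triangular_lower x w y : triangular x ->
  wspan E J (lower_words w) y -> wspan E J (lower_words w) (x * y).
Proof.
move=> xT; apply: (wspan_mull JM) => w1 hw1; have [lw1 _ _] := hw1.
have [c hc] := xT _ lw1; rewrite -[x * _](subrK (c *: EW w1)); apply: wspanD.
  by apply: wspan_sub hc => w2; apply: lower_words_trans.
by apply: (wspanZ J0); apply: WspanWord.
Qed.

Let gt_tri x : gt x -> triangular x.
Proof.
elim=> [{}x [k [_ xk]]||c {}x y _ hx _ hy|{}x y _ hx _ hy] w lw.
- exact: (ccenter_lower EP J0 JM Jup Jdiag xk lw).
- by exists 1; rewrite mul1r scale1r subrr; apply: wspan0 J0 _.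
- have [a ha] := hx w lw; have [b hb] := hy w lw; exists (c * a + b).
  have -> : (c *: x + y) * EW w - (c * a + b) *: EW w =
    c *: (x * EW w - a *: EW w) + (y * EW w - b *: EW w).
    by rewrite mulrDl scalerDl scalerBr scalerA scalerAl opprD addrACA.
  exact: WspanLin.
- have [a ha] := hx w lw; have [b hb] := hy w lw; exists (b * a).
  have -> : x * y * EW w - (b * a) *: EW w =
    x * (y * EW w - b *: EW w) + b *: (x * EW w - a *: EW w).
    by rewrite mulrBr mulrA -scalerAr scalerBr scalerA subrKA.
  by apply: wspanD; [apply: triangular_lower|apply: (wspanZ J0)].
Qed.

Lemma gt_lower x w y : gt x ->
  wspan E J (lower_words w) y -> wspan E J (lower_words w) (x * y).
Proof. by move=> /gt_tri; apply: triangular_lower. Qed.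

Lemma phi_self w : loww w -> phi w (EW w) = 1.
Proof. by move=> lw; rewrite phiE // perm_refl. Qed.

Lemma chi_lower x w : gt x -> loww w ->
  wspan E J (lower_words w) (x * EW w - chi w x *: EW w).
Proof.
move=> gx lw; have [c hc] := gt_tri gx lw.
suff -> : chi w x = c by [].
by apply/eqP; rewrite -subr_eq0 -[c]mulr1 -(phi_self lw) -phiZ -phiB phi_lower.
Qed.

Definition gt_char (f : U -> C) := [/\ f 1 = 1,
  forall c x y, gt x -> gt y -> f (c *: x + y) = c * f x + f y &
  forall x y, gt x -> gt y -> f (x * y) = f x * f y].

Lemma chi_char w : loww w -> gt_char (chi w).
Proof.
move=> lw; split; first by rewrite /chi mul1r phi_self.
  by move=> c x y _ _; rewrite /chi mulrDl -scalerAl phiP.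
move=> x y gx gy; rewrite {1}/chi.
have -> : x * y * EW w = x * (y * EW w - chi w y *: EW w) + chi w y *: (x * EW w).
  by rewrite mulrBr mulrA -scalerAr subrK.
rewrite -[x * (_ - _)]scale1r phiP phi_lower ?mulr0 ?add0r; last first.
  by apply: gt_lower => //; apply: chi_lower.
by rewrite phiZ mulrC.
Qed.

(** Here [k] is the size of a corner, while rows and columns of letters count from 0; so [k <= p.1]
    means a row outside gl_k. *)
Definition tab (w : word) (k c : nat) : nat :=
  count (fun p : 'I_n * 'I_n => (k <= p.1)%N && (p.2 == c :> nat)) w.

Lemma wt_tab k (a : 'I_n) (t : word) : (a < k)%N -> rows k t ->
  wt (fun i : 'I_n => lam i) a t = lam a - (tab t k a)%:R.
Proof.
move=> ak; rewrite /wt => rt; congr (_ + _); elim: t rt => [|p t IHt] /=.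
  by rewrite big_nil oppr0.
case/andP=> kp rt; rewrite big_cons IHt // kp natrD opprD.
have -> : (p.1 == a) = false.
  by apply/negbTE; rewrite -val_eqE neq_ltn (leq_trans ak kp) orbT.
by rewrite sub0r.
Qed.

(** [EW t] is a highest weight vector of gl_k modulo the span [L] of the normal forms with a smaller
    outer part, and [corner_word] makes [L] stable under gl_k; so [pw_tr_hw] applies. The inner part
    [u] commutes with the trace. *)
Lemma chi_pw_tr k i w : (k <= n)%N -> loww w -> chi w (pw_tr E k i) =
  pp [seq lam c - (tab w k c)%:R - c%:R + (k.-1)%:R | c <- iota 0 k] i.
Proof.
move=> kn lw; have [u [t [-> [lu Lu] lt rt]]] := loww_split k lw.
have tabt c : tab (u ++ t) k c = tab t k c.
  rewrite /tab count_cat -[RHS]add0n; congr (_ + _)%N; apply/eqP.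
  rewrite -leqn0 leqNgt -has_count; apply/hasPn => p.
  by move/allP: Lu => /[apply] /andP [pk _] /=; rewrite leqNgt pk.
rewrite (eq_map (fun c => congr1 (fun x => lam c - x%:R - c%:R + (k.-1)%:R) (tabt c))).
pose mu c : C := lam c - (tab t k c)%:R; pose L := wspan E J
  (fun v => split_word k v (fun t' => lt_h t' t)).
have LEW v x : all (cornl k) v -> L x -> L (EW v * x).
  move=> Lv; apply: (wspan_mull JM) => _ [u1 [t1 [-> Lu1 lu1 lt1 [rt1 tt1]]]].
  have Lvu : all (cornl k) (v ++ u1) by rewrite all_cat Lv.
  rewrite -EW_cat catA EW_cat.
  apply: wspan_sub (corner_word EP J0 JM Jup Jdiag Lvu lt1 rt1).
  move=> _ [[u2 [t2 [-> h1 h2 h3 [h4 h5]]]] _].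
  by exists u2, t2; split=> //; split=> //; apply: le_lt_h tt1.
have cc : ccenter E k (pw_tr E k i) by apply: ccenter_pw_tr.
have hw : L (pw_tr E k i * EW t -
    pp [seq mu c - c%:R + (k.-1)%:R | c <- iota 0 k] i *: EW t).
  apply: (pw_tr_hw kn EP (L := L)).
  - exact: wspan0 J0 _.
  - by move=> c x y; apply: WspanLin.
  - move=> a b x ak bk; rewrite -[E a b]mulr1 -(EW0 E) -(EW_cons E (a, b)).
    by apply: LEW; rewrite /= /cornl ak bk.
  - move=> a b abk; have := raise_word EP J0 JM Jup abk lt rt.
    apply: wspan_sub => t' [h1 h2 h3 _].
    by exists [::], t'.
  - move=> a ak; rewrite /mu -wt_tab //; apply: WspanJ.
    exact: (cartan_word EP JM Jdiag).
have xu : pw_tr E k i * EW u = EW u * pw_tr E k i by apply/cc.2/corner_EW.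
rewrite /chi EW_cat mulrA xu -mulrA.
rewrite -[pw_tr E k i * EW t](subrK (pp [seq mu c - c%:R + (k.-1)%:R | c <- iota 0 k] i *: EW t)).
rewrite mulrDr -[EW u * (_ - _)]scale1r phiP (phi_span _ (LEW _ _ Lu hw)).
  rewrite mulr0 add0r -scalerAr -EW_cat phiZ phi_self ?mulr1 //.
  exact: (loww_cat lu Lu lt rt).
move=> _ [u1 [t1 [-> Lu1 lu1 lt1 [rt1 tt1]]]]; split; first exact: (loww_cat lu1 Lu1).
by apply: prec_perm; apply: prec_cat Lu Lu1 rt tt1.
Qed.

Section Char.
Variable f : U -> C.
Hypothesis fc : gt_char f.
Let f1 : f 1 = 1. Proof. by case: fc. Qed.
Let fP c x y : gt x -> gt y -> f (c *: x + y) = c * f x + f y.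
Proof. by case: fc => _ h _; apply: h. Qed.
Let fM x y : gt x -> gt y -> f (x * y) = f x * f y.
Proof. by case: fc => _ _ h; apply: h. Qed.

Lemma gt_charX x m : gt x -> f (x ^+ m) = f x ^+ m.
Proof.
move=> gx; elim: m => [|m IHm]; first by rewrite !expr0.
by rewrite !exprS fM ?IHm //; apply: gtX.
Qed.

Lemma gt_charB x y : gt x -> gt y -> f (x - y) = f x - f y.
Proof. by move=> gx gy; rewrite addrC -scaleN1r fP // mulN1r addrC. Qed.

Lemma gt_charZ c x : gt x -> f (c *: x) = c * f x.
Proof.
move=> gx; have f0 : f 0 = 0 by rewrite -(subrr 1) gt_charB ?subrr //; apply: Subalg1.
by rewrite -[c *: x]addr0 fP ?f0 ?addr0 //; apply: gt0.
Qed.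

End Char.

(** Lagrange interpolation: if [chi w] differs from [f], it does so at some [x], and
    [(x - chi w x) / (f x - chi w x)] becomes a factor of [g]. *)
Lemma separate f (F : seq word) : gt_char f -> (forall w, w \in F -> loww w) ->
  exists g, [/\ gt g, f g = 1 & forall w, w \in F ->
    chi w g = 0 \/ forall x, gt x -> chi w x = f x].
Proof.
move=> fc; have [f1 fP fM] := fc; elim: F => [_|w F IHF lF].
  by exists 1; split=> //; apply: Subalg1.
have lw : loww w by apply: lF; rewrite mem_head.
have [c1 cP cM] := chi_char lw.
have [|g [gg fg hg]] := IHF; first by move=> v vF; apply: lF; rewrite inE vF orbT.
have [h|] := pselect (forall x, gt x -> chi w x = f x).
  by exists g; split=> // v; rewrite inE => /predU1P [->|/hg //]; right.
move=> /existsNP [x /not_implyP [gx /eqP xN]].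
have gA : gt ((chi w x)%:A) by apply: gtZ; apply: Subalg1.
have gx' : gt (x - (chi w x)%:A) by apply: gtB.
pose y := (f x - chi w x)^-1 *: (x - (chi w x)%:A).
have gy : gt y by apply: gtZ.
exists (g * y); split.
- exact: SubalgM.
- rewrite fM // fg mul1r (gt_charZ fc) // (gt_charB fc) // (gt_charZ fc); last exact: Subalg1.
  by rewrite f1 mulr1 mulVf // subr_eq0 eq_sym.
- move=> v; rewrite inE => /predU1P [->|vF].
    left; rewrite cM //; have cc := chi_char lw.
    rewrite (gt_charZ cc) // (gt_charB cc) // (gt_charZ cc); last exact: Subalg1.
    by rewrite c1 mulr1 subrr !mulr0.
  have lv : loww v by apply: lF; rewrite inE vF orbT.
  have [v1 vP vM] := chi_char lv.
  by case: (hg v vF) => [h0|]; [left; rewrite vM // h0 mul0r|right].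
Qed.

Lemma finite_words (d : nat) :
  exists F : seq word, forall w, (w \in F) = loww w && (ht w <= d%:Z).
Proof.
exists [seq w <- flatten [seq [seq val t | t <- enum {: m.-tuple ('I_n * 'I_n)}]
    | m <- iota 0 d.+1] | loww w && (ht w <= d%:Z)].
move=> w; rewrite mem_filter andb_idr // => /andP [/andP [lw _] hw].
apply/flatten_mapP; exists (size w); last first.
  by apply/mapP; exists (in_tuple w); rewrite ?mem_enum.
by rewrite mem_iota add0n ltnS; have := le_trans (low_ht_ge lw) hw; rewrite lez_nat.
Qed.

Section Nilpotent.
Variables (d : nat) (F : seq word).
Hypothesis FP : forall w, (w \in F) = loww w && (ht w <= d%:Z).

Definition rank w := count (fun w' => `[< prec w' w >]) F.

Lemma rank_lt w w' : w' \in F -> prec w' w -> (rank w' < rank w)%N.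
Proof.
move=> w'F w'w; pose a v := `[< prec v w' >].
have : (count (predU a (pred1 w')) F <= rank w)%N.
  apply: sub_count => v /= /orP [/asboolP h|/eqP ->]; apply/asboolP => //.
  exact: prec_trans h w'w.
apply: leq_trans.
have := count_predUI a (pred1 w') F.
have -> : count (predI a (pred1 w')) F = 0%N.
  apply/eqP; rewrite -leqn0 leqNgt -has_count; apply/hasPn => v _ /=.
  by apply/negP => /andP [/asboolP h /eqP vw]; rewrite vw in h; apply: prec_irr h.
rewrite addn0 => ->; rewrite -addn1 leq_add2l -has_count.
by apply/hasP; exists w' => /=.
Qed.

Definition kills r x := forall w, w \in F -> (rank w < r)%N -> J (x * EW w).

(** An element with zero diagonal sends a word to words of smaller rank, so a product of [r] of them
    kills the ranks below [r]. No rank exceeds [size F], whence the exponent [(size F).+1] below. *)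
Lemma killsS r x y : gt y -> (forall w, w \in F -> chi w y = 0) ->
  kills r x -> kills r.+1 (x * y).
Proof.
move=> gy y0 xr w wF wr; have := wF; rewrite FP => /andP [lw hw].
rewrite -mulrA; have := chi_lower gy lw; rewrite y0 // scale0r subr0.
elim=> [w' [lw' hw' pw']|z Jz|c z1 z2 _ h1 _ h2].
- have w'F : w' \in F by rewrite FP lw' hw' hw.
  by apply: xr => //; rewrite -ltnS; apply: leq_trans (rank_lt w'F pw') wr.
- exact: JM.
- by rewrite mulrDr -scalerAr; apply: JD => //; apply: JZ.
Qed.

Lemma kills_exp g r : gt g -> (forall w, w \in F -> chi w g = 0) ->
  kills r (g ^+ r).
Proof.
move=> gg g0; elim: r => [|r IHr]; first by move=> w _; rewrite ltn0.
by rewrite exprSr; apply: killsS.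
Qed.

Lemma kills_all x : kills (size F).+1 x ->
  forall w, w \in F -> J (x * EW w).
Proof. by move=> h w wF; apply: h => //; rewrite ltnS count_size. Qed.

End Nilpotent.

Definition gt_ker (f : U -> C) (x : U) := gt x /\ f x = 0.
Definition idmul (I I' : U -> Prop) (x : U) := exists s : seq (U * U),
  (forall p, p \in s -> I p.1 /\ I' p.2) /\ x = \sum_(p <- s) p.1 * p.2.
Definition gt_ker_pow f r := iter r (idmul (gt_ker f)) gt.
Definition gt_occurs f := exists2 u, ~ J u &
  exists r, forall a, gt_ker_pow f r a -> J (a * u).

(* Multiply [EW w] by a power of some [g] that separates [chi w] from the other
   characters occurring in bounded height. *)
Lemma chi_occurs w : loww w -> gt_occurs (chi w).
Proof.
move=> lw; have [d hd] : exists d : nat, ht w <= d%:Z.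
  by exists `|ht w|%N; apply: lez_abs.
have [F FP] := finite_words d; set N := (size F).+1.
have wF : w \in F by rewrite FP lw.
have cc := chi_char lw; have [c1 cP cM] := cc.
have [|g [gg g1 gF]] := separate cc (F := F).
  by move=> v; rewrite FP => /andP [].
exists (g ^+ N * EW w).
  by move/(phiJ w)/eqP; rewrite -/(chi w _) (gt_charX cc) // g1 expr1n oner_eq0.
exists N => a aN; rewrite mulrA; apply: (kills_all _ wF) => //.
(* Each factor from the kernel is paired with one [g]: [p.1 * g] has zero diagonal on [F], since at
   each word either [g] has value 0 or the character is [chi w], which vanishes on [p.1]. *)
suff {aN} : forall r b, gt_ker_pow (chi w) r b -> gt b /\ kills F r (b * g ^+ r).
  by move=> /(_ N a aN) [].
elim=> [|r IHr] b; first by move=> gb; split=> // v _; rewrite ltn0.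
case=> s [hs ->]; rewrite mulr_suml big_seq [in X in _ /\ X]big_seq.
split; elim/big_rec: _ => [|p x ps hx]; [exact: gt0| |by move=> v _ _; rewrite mul0r|].
  have [[gp _] /IHr [gp2 _]] := hs p ps.
  by apply: gtD hx; apply: SubalgM.
have [[gp p0] /IHr [gp2 kp2]] := hs p ps.
move=> v vF vr; rewrite mulrDl; apply: JD; last exact: hx.
have gX : gt (g ^+ r) by apply: gtX.
have -> : p.1 * p.2 * g ^+ r.+1 = (p.2 * g ^+ r) * (p.1 * g).
  rewrite exprSr mulrA; have gpg : gt (p.2 * g ^+ r) by apply: SubalgM.
  by rewrite -(mulrA p.1) (gt_comm gp gpg) -!mulrA.
apply: (killsS FP) vF vr => //; first exact: SubalgM.
move=> v' v'F; have := v'F; rewrite FP => /andP [lv' _].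
have [_ _ vM] := chi_char lv'; rewrite vM //.
by case: (gF v' v'F) => [->|->]; rewrite ?mulr0 // p0 mul0r.
Qed.

Lemma span_finite u : exists d : nat,
  wspan E J (fun w => loww w && (ht w <= d%:Z)) u.
Proof.
have hu : wspan E J (fun w => loww w) u.
  have := corner_span (full u); apply: (wspan_bind (@lin_id _ U)) => [w Lw|y ->]; last first.
    exact: wspan0 J0 _.
  (* The full corner, applied to the empty word [t]. *)
  rewrite -[EW w]mulr1 -(EW0 E); have := corner_word EP J0 JM Jup Jdiag Lw.
  move=> /(_ [::] isT isT); apply: wspan_sub => v [[x [t [-> Lx lx lt [rt _]]]] _].
  exact: (loww_cat lx Lx lt rt).
elim: hu => [w lw|y Jy|c x y _ [d1 h1] _ [d2 h2]].
- exists `|ht w|%N; apply: WspanWord; rewrite lw /=; exact: lez_abs.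
- by exists 0%N; apply: WspanJ.
- exists (maxn d1 d2); apply: WspanLin.
    apply: wspan_sub h1 => w /andP [-> h] /=; apply: le_trans h _.
    by rewrite lez_nat leq_maxl.
  apply: wspan_sub h2 => w /andP [-> h] /=; apply: le_trans h _.
  by rewrite lez_nat leq_maxr.
Qed.

(** Otherwise some [g] with [f g = 1] has zero diagonal on the finitely many words up to the height
    of [u], so [g ^+ N] kills [u] modulo [J]. Then [h = 1 - g ^+ N] fixes [u] modulo [J], yet it
    lies in the kernel of [f], so a power of it kills [u]. *)
Lemma occurs_chi f : gt_char f -> gt_occurs f ->
  exists2 w, loww w & forall x, gt x -> chi w x = f x.
Proof.
move=> fc [u Ju [r ur]]; have [d hd] := span_finite u.
have [F FP] := finite_words d; set N := (size F).+1.
apply: contrapT => noF.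
have [|g [gg fg gF]] := separate fc (F := F).
  by move=> v; rewrite FP => /andP [].
have g0 w : w \in F -> chi w g = 0.
  move=> wF; case: (gF w wF) => // h; case: noF; exists w => //.
  by move: wF; rewrite FP => /andP [].
have Jgu : J (g ^+ N * u).
  elim: hd => [w wF|y|c x y _ hx _ hy].
  - by apply: (kills_all (kills_exp FP gg g0)); rewrite FP.
  - exact: JM.
  - by rewrite mulrDr -scalerAr; apply: JD => //; apply: JZ.
have [f1 fP fM] := fc.
pose h := 1 - g ^+ N.
have gX : gt (g ^+ N) by apply: gtX.
have gh : gt h by apply: gtB => //; apply: Subalg1.
have fh : f h = 0.
  by rewrite (gt_charB fc) ?(gt_charX fc) ?f1 ?fg ?expr1n ?subrr //; apply: Subalg1.
have pow m : gt_ker_pow f m (h ^+ m).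
  elim: m => [|m IHm]; first exact: Subalg1.
  exists [:: (h, h ^+ m)]; split; last by rewrite big_seq1 exprS.
  by move=> p; rewrite inE => /eqP ->.
apply: Ju; have := ur _ (pow r); elim: r {ur} => [|r IHr]; first by rewrite mul1r.
rewrite exprSr -mulrA {2}/h mulrBl mul1r mulrBr => hr; apply: IHr.
have := JD hr (JM (h ^+ r) Jgu); by rewrite subrK.
Qed.

Lemma gt_occurs_words (I : Type) (k i : I -> nat) (y : I -> C) :
  (forall a, 0 < k a <= n)%N -> (exists f, [/\ gt_char f,
      forall a, f (pw_tr E (k a) (i a)) = y a & gt_occurs f]) <->
  exists2 w : word, loww w & forall a, y a =
    pp [seq lam c - (tab w (k a) c)%:R - c%:R + ((k a).-1)%:R | c <- iota 0 (k a)] (i a).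
Proof.
move=> kn; have kn' a : (k a <= n)%N by case/andP: (kn a).
split=> [[f [fc fy /(occurs_chi fc) [w lw hw]]]|[w lw hw]].
  exists w => // a; rewrite -chi_pw_tr // -fy; apply/esym/hw/SubalgBase.
  by exists (k a); split=> //; apply: ccenter_pw_tr.
exists (chi w); split; [exact: chi_char | by move=> a; rewrite chi_pw_tr | exact: chi_occurs].
Qed.

End Support.

(** * Tableaux *)

Section Tableaux.
Variable n : nat.
Local Notation word := (seq ('I_n * 'I_n)).

Lemma word_of_count (T : finType) (t : T -> nat) :
  exists w : seq T, forall p, count_mem p w = t p.
Proof.
exists (flatten [seq nseq (t q) q | q <- enum T]) => p.
have gen s : uniq s ->
    count_mem p (flatten [seq nseq (t q) q | q <- s]) = ((p \in s) * t p)%N.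
  elim: s => //= q s IHs /andP [qs us]; rewrite count_cat count_nseq IHs //= inE.
  have [<-|_] := eqVneq q p; first by rewrite (negPf qs) mul0n addn0.
  by rewrite mul0n add0n.
by rewrite gen ?enum_uniq // mem_enum mul1n.
Qed.

Lemma count_sum (T : finType) (P : pred T) (w : seq T) :
  count P w = \sum_(p | P p) count_mem p w.
Proof.
elim: w => [|q w IHw] /=; first by rewrite big1.
rewrite big_split /= -IHw; congr (_ + _)%N.
have [Pq|Pq] := boolP (P q).
  rewrite (bigD1 q) //= eqxx big1 // => p /andP [_ pq].
  by rewrite eq_sym (negPf pq).
by rewrite big1 // => p Pp; case: eqP => // qp; rewrite qp Pp in Pq.
Qed.

(** The letter [E_(i,c)] is taken [y i c - y i.-1 c] times; over the rows beyond [k] this telescopes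
    to [y n.-1 c - y k c]. *)
Lemma word_of_tableau (y : nat -> nat -> int) :
  (forall p c, (c <= p)%N -> (p.+1 < n)%N -> y p c <= y p.+1 c) ->
  (forall c, y n.-1 c = 0) ->
  exists2 w : word, loww w & forall k c, (k < n)%N -> (c <= k)%N ->
    (tab w k.+1 c)%:Z = - y k c.
Proof.
move=> yle y0.
pose t (p : 'I_n * 'I_n) : nat :=
  if (p.2 < p.1)%N then `|y p.1 p.2 - y p.1.-1 p.2|%N else 0%N.
have [w0 w0t] := word_of_count t.
have ps : perm_eq (sort (@lowrow n) w0) w0 by rewrite perm_sort.
exists (sort (@lowrow n) w0).
  rewrite /loww sort_sorted ?andbT; last by move=> p q; apply: leq_total.
  apply/allP => p; rewrite (perm_mem ps) -has_pred1 has_count w0t /t.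
  by case: ifP.
move=> k c kn ck; rewrite /tab (permP ps) count_sum.
have cn := leq_ltn_trans ck kn; pose c' := Ordinal cn.
transitivity (\sum_(i < n | (k < i)%N) (y i c - y i.-1 c)); last first.
  have -> : \sum_(i < n | (k < i)%N) (y i c - y i.-1 c) =
      \sum_(k.+1 <= i < n) (y i c - y i.-1 c) by rewrite [RHS]big_geq_mkord.
  rewrite -[n]prednK; last by apply: leq_trans kn.
  rewrite big_add1 /= telescope_sumr ?y0 ?sub0r //.
  by rewrite -ltnS prednK // (leq_trans _ kn).
rewrite (eq_bigl (fun p : 'I_n * 'I_n => (k < p.1)%N && (p.2 == c'))); last by [].
rewrite -(pair_big (fun i : 'I_n => (k < i)%N) (fun j => j == c')
  (fun i j => count_mem (i, j) w0)) /=.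
rewrite (big_morph Posz PoszD (erefl _)); apply: eq_bigr => i ki.
rewrite big_pred1_eq w0t /t /= (leq_ltn_trans ck ki).
have i0 : i = i.-1.+1 :> nat by rewrite prednK // (leq_ltn_trans _ ki).
rewrite gez0_abs // subr_ge0 {2}i0; apply: yle; rewrite -?i0 //.
by rewrite -ltnS -i0; apply: leq_ltn_trans ck ki.
Qed.

Lemma tab_leq (w : word) k c : (tab w k.+1 c <= tab w k c)%N.
Proof. by apply: sub_count => p /= /andP [/ltnW -> ->]. Qed.

(** The rows of the tableau of [w] satisfy the inequality entrywise, so the number of entries at
    least [y k i] does not drop from one row to the next. For decreasing rows it exceeds [i] in row
    [k], and would be at most [i] in the next row if [y k.+1 i < y k i]. *)
Lemma tableau_row_leq (y : nat -> nat -> int) (w : word) k :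
  (forall i j, (i <= j <= k)%N -> y k j <= y k i) ->
  (forall i j, (i <= j <= k.+1)%N -> y k.+1 j <= y k.+1 i) ->
  perm_eq [seq y k c | c <- iota 0 k.+1] [seq - (tab w k.+1 c)%:Z | c <- iota 0 k.+1] ->
  perm_eq [seq y k.+1 c | c <- iota 0 k.+2]
          [seq - (tab w k.+2 c)%:Z | c <- iota 0 k.+2] ->
  forall i, (i <= k)%N -> y k i <= y k.+1 i.
Proof.
move=> s1 s2 p1 p2 i ik; rewrite leNgt; apply/negP => lt_y.
pose P := [pred x : int | y k i <= x].
have c1 : (i < count P [seq y k c | c <- iota 0 k.+1])%N.
  have -> : iota 0 k.+1 = iota 0 i.+1 ++ iota i.+1 (k - i).
    by rewrite -iotaD addSn subnKC.
  rewrite map_cat count_cat; apply: leq_trans (leq_addr _ _).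
  rewrite -[in X in (X <= _)%N](size_iota 0 i.+1) -(size_map (y k)).
  rewrite -[X in (size X <= _)%N]filter_predT size_filter.
  rewrite (@eq_in_count _ predT P) // => x /mapP [c]; rewrite mem_iota => ci ->.
  by rewrite /= s1 //; lia.
have c2 : (count P [seq y k.+1 c | c <- iota 0 k.+2] <= i)%N.
  have -> : iota 0 k.+2 = iota 0 i ++ iota i (k.+2 - i).
    by rewrite -iotaD subnKC //; lia.
  rewrite map_cat count_cat [X in (_ + X)%N](_ : _ = 0%N) ?addn0.
    by apply: leq_trans (count_size _ _) _; rewrite size_map size_iota.
  apply/eqP; rewrite -leqn0 leqNgt -has_count; apply/hasPn => x /mapP [c].
  rewrite mem_iota => ci -> /=; rewrite -ltNge; apply: le_lt_trans lt_y.
  by apply: s2; lia.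
have : (count P [seq - (tab w k.+1 c)%:Z | c <- iota 0 k.+1] <=
   count P [seq - (tab w k.+2 c)%:Z | c <- iota 0 k.+2])%N.
  rewrite -[in X in (_ <= X)%N]addn1 iotaD map_cat count_cat.
  apply: leq_trans (leq_addr _ _); rewrite !count_map.
  apply: sub_count => c /= h; apply: le_trans h _.
  by rewrite lerN2 lez_nat addn1 tab_leq.
rewrite -(permP p1) -(permP p2) => c12.
by have := leq_trans c1 (leq_trans c12 c2); rewrite ltnn.
Qed.

End Tableaux.

(** * The support of the Verma module in terms of words *)

Lemma pi_modZ (R : nzRingType) (G : R -> Prop) (a x : R) :
  a *: pi_mod G x = pi_mod G (a * x).
Proof. exact: quot_scaleE. Qed.

Lemma pi_mod_eq0 (R : nzRingType) (G : R -> Prop) (x : R) :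
  pi_mod G x = 0 <-> left_ideal_gen G x.
Proof.
have p0 : pi_mod G 0 = 0 by rewrite -[X in pi_mod _ X](subrr 0) pi_modB subrr.
rewrite -p0; split=> [/pi_modE|h]; first by rewrite subr0 => /left_ideal_predP.
by apply/pi_modE; rewrite subr0; apply/left_ideal_predP.
Qed.

Section VermaSupport.
Variables (C : numFieldType) (n : nat).
Local Notation U := (Ugl C n).
Local Notation E := (@Egl C n).

Lemma GT_support_quot (G : U -> Prop) v : @GT_support C n (quot_mod G) v <->
  exists2 f, GT_char v f & exists2 u, ~ left_ideal_gen G u &
  exists r, forall a, GT_ker_pow f r a -> left_ideal_gen G (a * u).
Proof.
split=> [[f fc [x x0 [r fx]]]|[f fc [u u0 [r fu]]]]; exists f => //.
  have [u xu] := pi_mod_surj x; rewrite xu in x0 fx; exists u.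
    by move=> h; case/eqP: x0; apply/pi_mod_eq0.
  by exists r => a /fx h; apply/pi_mod_eq0; rewrite -pi_modZ.
exists (pi_mod G u); first by apply/eqP => /pi_mod_eq0.
by exists r => a /fu h; rewrite pi_modZ; apply/pi_mod_eq0.
Qed.

Lemma GT_gen_pw (a : vtx n) : GT_gen C a = pw_tr E (vrow a) (vcol a).
Proof. exact: esym (pw_tr_cycles _ _ _). Qed.

Lemma rho_tildeN i : (- rho_tilde C n) 0 i = (i : nat)%:R.
Proof. by rewrite /rho_tilde opprK mxE. Qed.

Lemma gt_charE (f : U -> C) : gt_char E f = [/\ f 1 = 1,
  forall (c : C) x y, GT_subalg x -> GT_subalg y -> f (c *: x + y) = c * f x + f y &
  forall x y, GT_subalg x -> GT_subalg y -> f (x * y) = f x * f y].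
Proof. by []. Qed.

Lemma gt_occursE (G : U -> Prop) f : gt_occurs E (left_ideal_gen G) f =
  exists2 u, ~ left_ideal_gen G u &
  exists r, forall a, GT_ker_pow f r a -> left_ideal_gen G (a * u).
Proof. by []. Qed.

Lemma GT_charE v f : GT_char v f <-> gt_char E f /\
  forall a : vtx n, f (pw_tr E (vrow a) (vcol a)) = gamma_at v a.
Proof.
rewrite gt_charE; split=> [fc|[fc fg]].
  split; first exact: And3 (GT_char1 fc) (GT_charP fc) (GT_charM fc).
  by move=> a; rewrite -GT_gen_pw; apply: (GT_char_gen fc).
case: fc => f1 fP fM.
have fg' a : f (GT_gen C a) = gamma_at v a by rewrite GT_gen_pw.
exact: Build_GT_char f1 fP fM fg'.
Qed.

(** The first [c%:R] is the highest weight and [- c%:R] the shift from [sum_pp_tri]; both stay in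
    place until [tab_map] cancels them. *)
Lemma verma_support_words (v : {ffun vtx n -> C}) :
  GT_support (verma (- rho_tilde C n)) v <->
  exists2 w : seq ('I_n * 'I_n), loww w & forall a, gamma_at v a =
    pp [seq c%:R - (tab w (vrow a) c)%:R - c%:R + ((vrow a).-1)%:R
       | c <- iota 0 (vrow a)] (vcol a).
Proof.
pose J := left_ideal_gen (verma_rel (- rho_tilde C n)).
have J0 : J 0 by apply: LIdeal0.
have JB x y : J x -> J y -> J (x - y) by apply: LIdealB.
have JM a x : J x -> J (a * x) by apply: LIdealMl.
have Jup (i j : 'I_n) : (i < j)%N -> J (E i j).
  by move=> ij; apply: LIdealBase; left; exists i, j.
have Jdiag (i : 'I_n) : J (E i i - ((i : nat)%:R)%:A).
  by apply: LIdealBase; right; exists i; rewrite rho_tildeN.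
have /choice [phi phiA] := verma_functional (- rho_tilde C n).
have phiP w c x y : phi w (c *: x + y) = c * phi w x + phi w y by case: (phiA w).
have phiJ w x : J x -> phi w x = 0 by case: (phiA w) => _ h _; apply: h.
have phiE w w' : loww w' -> phi w (EW E w') = (perm_eq w w')%:R.
  by case: (phiA w) => _ _ h; apply: h.
have main := @gt_occurs_words C n U E (@Egl_comm C n) (@Ugl_corner_full C n)
  (fun c => c%:R) J J0 JB JM Jup Jdiag phi phiP phiJ phiE _ (@vrow n) (@vcol n)
  (gamma_at v).
apply: iff_trans (GT_support_quot _ v) _; apply: iff_trans (main _); last first.
  by move=> a; rewrite /vrow /= ltn_ord.
split=> [[f /GT_charE [fc fg]]|[f [fc fg]]].
  by rewrite -gt_occursE => occ; exists f.
rewrite gt_occursE => occ; exists f => //.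
exact/GT_charE/(conj fc fg).
Qed.

End VermaSupport.

Section TableauSupport.
Variables (C : numFieldType) (n : nat) (z : {ffun vtx n -> int}).

(* The entry of [z] in row [k] and column [c], both counted from [0]. *)
Definition entry (k c : nat) : int :=
  if (insub k : option 'I_n) is Some k' then z (Tagged (fun k : 'I_n => 'I_k.+1) (inord c : 'I_k'.+1))
  else 0.

Lemma entryE (k : 'I_n) (j : 'I_k.+1) :
  entry k j = z (Tagged (fun k : 'I_n => 'I_k.+1) j).
Proof. by rewrite /entry valK inord_val. Qed.

Lemma gamma_entry (a : vtx n) : gamma_at (tab_embed C z) a =
  pp [seq (entry (tag a) c)%:~R + (tag a : nat)%:R | c <- iota 0 (vrow a)] (vcol a).
Proof.
rewrite /gamma_at gamma_pp -val_enum_ord -map_comp; congr pp.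
by apply: eq_map => j /=; rewrite ffunE entryE.
Qed.

Let g (k : nat) (x : int) : C := x%:~R + k%:R.

Let gI k : injective (g k).
Proof. by move=> x y /addIr /intr_inj. Qed.

Let entry_map (k : nat) : [seq (entry k c)%:~R + k%:R | c <- iota 0 k.+1] =
  map (g k) [seq entry k c | c <- iota 0 k.+1].
Proof. by rewrite -map_comp. Qed.

Let tab_map (w : seq ('I_n * 'I_n)) (k : nat) :
  [seq c%:R - (tab w k.+1 c)%:R - c%:R + (k.+1.-1)%:R | c <- iota 0 k.+1] =
  map (g k) [seq - (tab w k.+1 c)%:Z | c <- iota 0 k.+1].
Proof.
rewrite -map_comp; apply: eq_map => c /=.
by rewrite /g [c%:R - _]addrC addrK rmorphN.
Qed.

Lemma support_word :
  GT_support (verma (- rho_tilde C n)) (tab_embed C z) ->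
  exists w : seq ('I_n * 'I_n), forall k, (k < n)%N ->
    perm_eq [seq entry k c | c <- iota 0 k.+1]
            [seq - (tab w k.+1 c)%:Z | c <- iota 0 k.+1].
Proof.
case/verma_support_words => w lw hw; exists w => k kn.
apply: (perm_map_inj (@gI k)); apply: perm_eq_pp; first by rewrite !size_map.
move=> i; rewrite !size_map size_iota => /andP [i0 ik].
have ik' : (i.-1 < k.+1)%N by rewrite prednK.
have := hw (Tagged (fun k : 'I_n => 'I_k.+1) (Ordinal ik' : 'I_(Ordinal kn).+1)).
by rewrite gamma_entry /vrow /vcol [tag _]/= [tagged _]/= tab_map -entry_map prednK.
Qed.

Lemma word_support (w : seq ('I_n * 'I_n)) : loww w ->
  (forall k c, (k < n)%N -> (c <= k)%N -> (tab w k.+1 c)%:Z = - entry k c) ->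
  GT_support (verma (- rho_tilde C n)) (tab_embed C z).
Proof.
move=> lw hw; apply/verma_support_words; exists w => // a.
rewrite gamma_entry tab_map entry_map; congr (pp (map _ _) _).
apply/eq_in_map => c; rewrite mem_iota => ca.
by rewrite hw ?opprK // ltn_ord.
Qed.

End TableauSupport.

Lemma verma_tableau_support (C : numFieldType) (n : nat) (z : {ffun vtx n -> int}) :
  in_D0 z ->
  GT_support (verma (- rho_tilde C n)) (tab_embed C z) <->
  forall k c, (k.+1 < n)%N -> (c <= k)%N -> entry z k c <= entry z k.+1 c.
Proof.
case=> ztop zrow.
have row k i j : (k < n)%N -> (i <= j <= k)%N -> entry z k j <= entry z k i.
  move=> kn /andP [ij jk]; have ik := leq_trans ij jk.
  pose k' : 'I_n := Ordinal kn; pose i' : 'I_k'.+1 := Ordinal (ik : (i < k.+1)%N).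
  pose j' : 'I_k'.+1 := Ordinal (jk : (j < k.+1)%N).
  have -> : entry z k j = z (Tagged (fun k : 'I_n => 'I_k.+1) j').
    exact: (entryE z j').
  have -> : entry z k i = z (Tagged (fun k : 'I_n => 'I_k.+1) i').
    exact: (entryE z i').
  have := kn; rewrite leq_eqVlt => /predU1P [kn1|kn1]; last exact: zrow.
  by rewrite !ztop.
split=> [/support_word [w hw] k c kn ck|yle].
  have kn' := ltnW kn.
  apply: (tableau_row_leq _ _ (hw _ kn') (hw _ kn)) ck => i j; exact: row.
(* This includes [c] beyond the row, where [inord] falls back to a vertex of the same row. *)
have top c : entry z n.-1 c = 0.
  rewrite /entry; case: insubP => // k' _ kE; apply: ztop.
  by rewrite /vrow /= kE prednK // (leq_ltn_trans _ (ltn_ord k')).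
have [w lw hw] := word_of_tableau (fun p c cp pn => yle p c pn cp) top.
exact: word_support lw hw.
Qed.

Lemma entry_tagged n (z : {ffun vtx n -> int}) (a : vtx n) :
  z a = entry z (vrow a).-1 (vcol a).-1.
Proof. by case: a => k j; rewrite entryE. Qed.

Lemma entry_vtx n (z : {ffun vtx n -> int}) k c : (k < n)%N -> (c <= k)%N ->
  exists a : vtx n, [/\ vrow a = k.+1, vcol a = c.+1 & entry z k c = z a].
Proof.
move=> kn ck; pose k' : 'I_n := Ordinal kn.
pose c' : 'I_k'.+1 := Ordinal (ck : (c < k.+1)%N).
exists (Tagged (fun k : 'I_n => 'I_k.+1) c'); split=> //.
exact: (entryE z c').
Qed.

(** * The inequalities between neighbouring rows and the graph *)

Section Conditions.
Variables (n : nat) (z : {ffun vtx n -> int}).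
Hypothesis zD : in_D0 z.

(** Since rows decrease, comparing equal columns is as strong as comparing [i <= j]. Comparison with
    the zero top row gives nonpositivity, carried down by induction on the distance [m] to that
    row. *)
Lemma tableau_cond : (0 < n)%N ->
  (forall k c, (k.+1 < n)%N -> (c <= k)%N -> entry z k c <= entry z k.+1 c) <->
  (forall a : vtx n, (vrow a <= n.-1)%N -> z a <= 0) /\
  (forall a b : vtx n,
     (2 <= vrow a <= n.-1)%N -> vrow b = (vrow a).-1 ->
     (vcol a <= vcol b)%N -> z b <= z a).
Proof.
have [ztop zrow] := zD; have vrown (a : vtx n) : (vrow a <= n)%N by rewrite /vrow.
have vcolk (a : vtx n) : (vcol a <= vrow a)%N by rewrite /vcol /vrow.
move=> n0; split=> [h|[h1 h2] k c kn ck].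
  have h0 m : forall k c, (k + m = n.-1)%N -> (c <= k)%N -> entry z k c <= 0.
    elim: m => [|m IHm] k c.
      rewrite addn0 => kE ck; have kn : (k < n)%N by rewrite kE prednK.
      have [a [ra _ ->]] := entry_vtx z kn ck.
      by rewrite ztop // ra kE prednK.
    rewrite addnS -addSn => kE ck; apply: le_trans (IHm k.+1 c kE (leqW ck)).
    by apply: h => //; lia.
  split=> [a an|a b an ba ab].
    rewrite entry_tagged; apply: (h0 (n.-1 - (vrow a).-1)%N); first lia.
    by have := vcolk a; rewrite /vcol; lia.
  have bk := vcolk b; have a1 : (vrow a).-1.+1 = vrow a by lia.
  have b1 : (vcol b).-1.+1 = vcol b by [].
  have kn : ((vrow a).-1 < n)%N by lia.
  have ck : ((vcol b).-1 <= (vrow a).-1)%N by rewrite -ba; lia.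
  (* [a'] has the row of [a] and the column of [b], so it mediates between the two. *)
  have [a' [ra' ca' aE]] := entry_vtx z kn ck.
  apply: (@le_trans _ _ (z a')); last by apply: zrow; rewrite ?ra' ?ca' ?a1 ?b1 //; lia.
  rewrite -aE entry_tagged ba.
  have a2 : (vrow a).-1 = (vrow a).-2.+1 by lia.
  by rewrite [in X in _ <= X]a2; apply: h; rewrite -?a2 //; lia.
have [b [rb cb ->]] := entry_vtx z (ltnW kn) ck.
have [a [ra ca ->]] := entry_vtx z kn (leqW ck).
have [kn'|kn'] := ltnP k.+2 n.
  by apply: h2; rewrite ?ra ?rb ?ca ?cb //=; lia.
rewrite (ztop a); last by rewrite ra; lia.
by apply: h1; rewrite rb; lia.
Qed.

End Conditions.

Theorem theorem6p4 (R : realType) (n : nat) (hn : (1 <= n)%N) :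
  (forall z : {ffun vtx n -> int}, in_D0 z ->
     (GT_support (verma (- rho_tilde R[i] n)) (tab_embed R[i] z) <->
      (forall a : vtx n, (vrow a <= n.-1)%N -> z a <= 0) /\
      (forall a b : vtx n,
         (2 <= vrow a <= n.-1)%N -> vrow b = (vrow a).-1 ->
         (vcol a <= vcol b)%N -> z b <= z a)))
  /\
  (forall z : {ffun vtx n -> int},
     (in_D0 z /\ GT_support (verma (- rho_tilde R[i] n)) (tab_embed R[i] z))
     <-> Pbar (omega_plus (v_dec n)) z).
Proof.
have supp z : in_D0 z -> GT_support (verma (- rho_tilde R[i] n)) (tab_embed R[i] z) <->
    forall k c, (k.+1 < n)%N -> (c <= k)%N -> entry z k c <= entry z k.+1 c.
  exact: verma_tableau_support.
split=> [z zD|z]; first exact: iff_trans (supp z zD) (tableau_cond zD hn).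
split=> [[zD /(supp z zD) /(tableau_cond zD hn) [h1 h2]]|[zD h]]; split=> //.
  (* Below the top row, [1 - vcol b <= 1 - vcol a] means [vcol a <= vcol b], the second family of
     inequalities; at the top row every edge is present and asks for [z b <= 0]. *)
  have edge a b : vrow a = (vrow b).+1 -> v_dec n b <= v_dec n a -> z b <= z a.
    move=> ab; have an : (vrow a <= n)%N by rewrite /vrow.
    have b0 : (0 < vrow b)%N by [].
    rewrite !ffunE; have [an'|na] := ltnP (vrow a) n; last first.
      move=> _; rewrite (zD.1 a); last by apply/eqP; rewrite eqn_leq an.
      by apply: h1; lia.
    by rewrite -ab ltnW // => v_le; apply: h2; rewrite ?ab //; lia.
  move=> a b /orP [] /andP [/eqP ab vab]; apply/orP; [left|right].
    by rewrite ab eqxx edge.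
  by rewrite ab eqxx edge.
apply/(supp z zD) => k c kn ck.
have [b [rb cb ->]] := entry_vtx z (ltnW kn) ck.
have [a [ra ca ->]] := entry_vtx z kn (leqW ck).
(* Equal columns are joined: the entries of [v_dec] agree below the top row, and [1 - vcol b <= 0]
   at it. *)
have /h : omega_plus (v_dec n) a b.
  rewrite /omega_plus ra rb eqxx /= !ffunE ra rb ca cb kn.
  by case: ifP => _ //; lia.
by rewrite /omega_plus ra rb; lia.
Qed.
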